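(* Let $L$ be a first-order language containing a binary relation symbol $<$, let $(\mathcal M_i)_i$ be a family of o-minimal $L$-structures, and let $\mathcal M_\natural$ be their ultraproduct with respect to a non-principal ultrafilter on the index set. Suppose that for each $L$-formula $\varphi$ without parameters (in any finite number of free variables) there exists $N_\varphi\in\mathbb N$ such that $|\chi_{\mathcal M_i}(\varphi)|\leq N_\varphi$ for all $i$. Then $\mathcal M_\natural$ is o-minimal.
   Context: All $L$-structures are assumed to be dense linear orders without endpoints with respect to $<$. Definable means definable with parameters. An $L$-structure $\mathcal M$ is o-minimal if every definable subset of $M$ is a finite union of points and open intervals (with endpoints in $M\cup\{\pm\infty\}$). For an o-minimal structure $\mathcal M$ and a definable set $X\subseteq M^n$, the Euler characteristic is $\chi_{\mathcal M}(X)=\sum_{C}(-1)^{\dim C}$, where the sum runs over the cells $C$ of any finite cell decomposition of $X$ (independent of the decomposition). For a formula $\varphi$ without parameters, $\chi_{\mathcal M}(\varphi)$ denotes the Euler characteristic of the set $\varphi(\mathcal M)$ defined by $\varphi$ in $\mathcal M$. *)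

(* Defs.v *)
From mathcomp Require Import all_boot all_order all_algebra.
From mathcomp Require Import boolp classical_sets filter.

Set Implicit Arguments.
Unset Strict Implicit.
Unset Printing Implicit Defensive.

Import Order.TTheory GRing.Theory Num.Theory.
Local Open Scope classical_set_scope.

(** * First-order languages, structures and formulas *)

Record language := Language {
  fsym : Type;
  farity : fsym -> nat;
  rsym : Type;
  rarity : rsym -> nat;
  less : rsym;
  less_binary : rarity less = 2 }.

Record structure (L : language) := Structure {
  carrier :> Type;
  fint : forall f : fsym L, ('I_(farity f) -> carrier) -> carrier;
  rint : forall r : rsym L, ('I_(rarity r) -> carrier) -> Prop }.

(* [term L n] and [formula L n] have their free variables among 'I_n. *)
Inductive term (L : language) (n : nat) : Type :=
| Var of 'I_n
| App (f : fsym L) of ('I_(farity f) -> term L n).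

(* The quantifier binds the last variable, [ord_max : 'I_n.+1]; the other
   connectives and the existential quantifier are the usual classical
   abbreviations. *)
Inductive formula (L : language) : nat -> Type :=
| FFalse n : formula L n
| FEq n of term L n & term L n : formula L n
| FRel n (r : rsym L) of ('I_(rarity r) -> term L n) : formula L n
| FImp n of formula L n & formula L n : formula L n
| FAll n of formula L n.+1 : formula L n.

(** * Points of [M^n], seen as functions ['I_n -> M] *)

Definition snoc (T : Type) n (x : 'I_n -> T) (a : T) : 'I_n.+1 -> T :=
  fun k => if unlift ord_max k is Some j then x j else a.

Definition init (T : Type) n (x : 'I_n.+1 -> T) : 'I_n -> T :=
  fun j => x (lift ord_max j).

Definition final (T : Type) n (x : 'I_n.+1 -> T) : T := x ord_max.

Definition fcat (T : Type) n m (x : 'I_n -> T) (y : 'I_m -> T) :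
    'I_(n + m) -> T :=
  fun k => match split k with inl i => x i | inr j => y j end.

(** * Satisfaction and definability *)

Section Semantics.
Variables (L : language) (M : structure L).

Fixpoint teval n (t : term L n) (x : 'I_n -> M) : M :=
  match t with
  | Var i => x i
  | App f ts => fint (fun k => teval (ts k) x)
  end.

Fixpoint holds n (phi : formula L n) : ('I_n -> M) -> Prop :=
  match phi with
  | FFalse _ => fun _ => False
  | FEq _ t u => fun x => teval t x = teval u x
  | FRel _ r ts => fun x => rint (fun k => teval (ts k) x)
  | FImp _ p q => fun x => holds p x -> holds q x
  | FAll _ p => fun x => forall a : M, holds p (snoc x a)
  end.

Definition solutions n (phi : formula L n) : set ('I_n -> M) :=
  [set x | holds phi x].

(* Definable with parameters; the tuple of parameters is [b]. *)
Definition definable n (X : set ('I_n -> M)) : Prop :=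
  exists m (phi : formula L (n + m)) (b : 'I_m -> M),
    X = [set x | holds phi (fcat x b)].

(** * The order, and o-minimality *)

(* Coordinate 0 of the pair is [a] and coordinate 1 is [b]. *)
Definition lt (a b : M) : Prop :=
  rint (r := less L) (fun k => if val k == 0 then a else b).

Definition dlo_without_endpoints : Prop :=
  [/\ inhabited M,
      (forall a, ~ lt a a) /\ (forall a b c, lt a b -> lt b c -> lt a c),
      forall a b, [\/ lt a b, a = b | lt b a],
      forall a b, lt a b -> exists c, lt a c /\ lt c b
    & forall a, (exists b, lt b a) /\ (exists c, lt a c)].

(* A lower bound [None] stands for -oo and an upper bound [None] for +oo. *)
Definition above (l : option M) (a : M) : Prop :=
  if l is Some b then lt b a else True.

Definition below (a : M) (u : option M) : Prop :=
  if u is Some b then lt a b else True.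

Definition interval (l u : option M) : set M :=
  [set a | above l a /\ below a u].

Definition ominimal : Prop :=
  dlo_without_endpoints /\
  forall A : set M, definable [set x : 'I_1 -> M | A (x ord0)] ->
    exists k (B : 'I_k -> set M),
      (forall j, (exists a, B j = [set a]) \/
                 (exists l u, B j = interval l u)) /\
      A = \bigcup_j B j.

(** * Cells and the Euler characteristic *)

Definition definable_fun n (C : set ('I_n -> M)) (f : ('I_n -> M) -> M) :=
  definable [set x : 'I_n.+1 -> M | C (init x) /\ final x = f (init x)].

(* Continuity of the restriction of [f] to [C], for the order topology on [M]
   and the product topology on [M^n]. *)
Definition continuous_fun n (C : set ('I_n -> M)) (f : ('I_n -> M) -> M) :=
  forall x, C x -> forall a b, lt a (f x) -> lt (f x) b ->
  exists u v : 'I_n -> M,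
    (forall j, lt (u j) (x j) /\ lt (x j) (v j)) /\
    (forall y, C y -> (forall j, lt (u j) (y j) /\ lt (y j) (v j)) ->
       lt a (f y) /\ lt (f y) b).

Definition cell_fun n (C : set ('I_n -> M)) (f : ('I_n -> M) -> M) : Prop :=
  definable_fun C f /\ continuous_fun C f.

(* A boundary of a band: a function, or the constant -oo or +oo if [None]. *)
Definition cell_bound n (C : set ('I_n -> M))
    (f : option (('I_n -> M) -> M)) : Prop :=
  if f is Some g then cell_fun C g else True.

(* [cell d C]: [C] is a cell of dimension [d], i.e. an (i_1,...,i_n)-cell with
   i_1 + ... + i_n = d.  The induction starts at the one-point space M^0, so
   that the cells of M^1 are the points and the nonempty open intervals. *)
Inductive cell : forall n, nat -> set ('I_n -> M) -> Prop :=
| cell_point : cell (n := 0) 0 setT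
| cell_graph n d (C : set ('I_n -> M)) f :
    cell d C -> cell_fun C f ->
    cell d [set x : 'I_n.+1 -> M | C (init x) /\ final x = f (init x)]
| cell_band n d (C : set ('I_n -> M)) (f g : option (('I_n -> M) -> M)) :
    cell d C -> cell_bound C f -> cell_bound C g ->
    (forall f0 g0, f = Some f0 -> g = Some g0 ->
       forall x, C x -> lt (f0 x) (g0 x)) ->
    cell d.+1 [set x : 'I_n.+1 -> M | C (init x) /\
      interval (omap (@^~ (init x)) f) (omap (@^~ (init x)) g) (final x)].

Definition cell_decomposition n (X : set ('I_n -> M)) k
    (d : 'I_k -> nat) (C : 'I_k -> set ('I_n -> M)) : Prop :=
  [/\ forall j, cell (d j) (C j), trivIset setT C & X = \bigcup_j C j].

(* The sum over some cell decomposition of [X]; the value 0 is a default for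
   sets without a cell decomposition, such as non-definable sets. *)
Definition euler n (X : set ('I_n -> M)) : int :=
  xget 0%R [set z : int | exists k (d : 'I_k -> nat) C,
    cell_decomposition X d C /\ z = (\sum_(j < k) (-1) ^+ d j)%R].

End Semantics.

(** * Ultraproducts *)

Section Ultraproduct.
Variables (L : language) (I : Type) (U : set_system I) (FU : UltraFilter U).
Variable M : I -> structure L.

Definition ueq (x y : {classic forall i, M i}) : bool :=
  `[< U [set i | x i = y i] >].

Fact ueq_refl : reflexive ueq.
Proof. by move=> x; apply/asboolP; apply: filterS filterT. Qed.

Fact ueq_sym : symmetric ueq.
Proof.
by move=> x y; apply/asboolP/asboolP; apply: filterS => i /= ->.
Qed.

Fact ueq_trans : transitive ueq.
Proof.
move=> y x z /asboolP xy /asboolP yz; apply/asboolP.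
by apply: filterS2 xy yz => i /= -> ->.
Qed.

Canonical ueq_equiv := EquivRel ueq ueq_refl ueq_sym ueq_trans.

Definition ultraproduct_type := {eq_quot ueq_equiv}%qT.

(* Independent of the choice of representatives [repr], as [U] is a filter. *)
Definition ultraproduct : structure L := {|
  carrier := ultraproduct_type;
  fint := fun f (c : 'I_(farity f) -> ultraproduct_type) =>
    (\pi_ultraproduct_type (fun i => fint (fun k => repr (c k) i)))%qT;
  rint := fun r (c : 'I_(rarity r) -> ultraproduct_type) =>
    U [set i | rint (fun k => repr (c k) i)] |}.

End Ultraproduct.

(* Main.v *)
Require Import Defs.
From mathcomp Require Import all_boot all_order all_algebra.
From mathcomp Require Import boolp classical_sets filter.

Set Implicit Arguments.
Unset Strict Implicit.
Unset Printing Implicit Defensive.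

Local Open Scope classical_set_scope.

(** If the ultraproduct is not o-minimal, some formula [phi(x, y)] defines, for
    suitable parameters [y] in the [M i], sets with more and more boundary
    points: a uniform bound on their number would pass to the ultraproduct by
    the theorem of Los ([holds_ultra]) and bound the number of points and
    intervals there.  So the theorem is a uniform finiteness statement: given a
    formula whose fibres [D y] are finite subsets of the line, their size is
    bounded independently of [y] and of [i] ([uniform_finiteness]).

    The Euler characteristic bounds this size over a cell [C] on which the
    points of [D y] depend continuously on [y].  If all the fibres over [C] have
    [k] elements, then the part of [D] over [C] is the disjoint union of [k]
    graphs of continuous functions on [C], each of which is a cell of the
    dimension of [C]; its Euler characteristic is [k] or [- k]
    ([euler_sheets]).  That the Euler characteristic does not depend on the
    decomposition is proved by integrating indicator functions one variable at
    a time ([euler_relation]).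

    It remains to cover the space of parameters, uniformly in [i], by boundedly
    many cells of this kind that are defined without parameters.  This is a
    cell decomposition theorem, proved by induction on the dimension
    ([uniform_covers]), in which the usual finiteness property is replaced by
    the bound just explained.  A cell cover of [M^n] over which the boundary
    points of the given sets vary continuously gives a cell cover of [M^(n+1)],
    made of these points and of the gaps between them ([cell_covers_step]); the
    bound ensures that they are boundedly many.  Conversely, over a cell of
    [M^(n+1)] that is a band, the points near which the fibres vary continuously
    form a definable set which meets every subcell of the same type
    ([band_steady_point]); the remaining points lie in cells of smaller
    dimension, which are treated by induction ([steady_refinement_cell]).

    Two ideas make the argument uniform.  First, the continuity of the fibres is
    expressed by a first-order condition although their size is not bounded in
    advance: nearby fibres have as many points as [D y] in each strip that
    contains at most one point of [D y] ([steady]).  Second, the induction runs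
    at the same time over all families of o-minimal structures in which sheets
    are boundedly many ([sheets_bounded]).  A single structure with all its
    elements as constants is such a family, for trivial reasons, and the local
    part of the proof, where parameters have to be fixed, takes place there.

    In dimension one, the ingredients are the monotonicity theorem
    ([monotonicity]) and the fact that a definable family of finite sets over an
    interval varies continuously near some point ([generic_steady]). *)

(** * Dense linear orders and finite sets *)

Arguments lt {L M} a b : simpl never.

Section Order.
Variables (L : language) (M : structure L).
Hypothesis dM : dlo_without_endpoints M.
Implicit Types (a b c x y : M) (A B : set M).

Lemma lt_irr a : ~ lt a a.
Proof. by case: dM => _ [h _] _ _ _; apply: h. Qed.

Lemma lt_trans a b c : lt a b -> lt b c -> lt a c.
Proof. by case: dM => _ [_ h] _ _ _; apply: h. Qed.

Lemma lt_total a b : [\/ lt a b, a = b | lt b a].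
Proof. by case: dM => _ _ h _ _; apply: h. Qed.

Lemma lt_dense a b : lt a b -> exists c, lt a c /\ lt c b.
Proof. by case: dM => _ _ _ h _; apply: h. Qed.

Lemma lt_below a : exists b, lt b a.
Proof. by case: dM => _ _ _ _ h; case: (h a). Qed.

Lemma lt_above a : exists b, lt a b.
Proof. by case: dM => _ _ _ _ h; case: (h a). Qed.

Lemma lt_le_trans a b c : lt a b -> ~ lt c b -> lt a c.
Proof.
by move=> ab cb; case: (lt_total b c) => [|<-//|//]; apply: lt_trans.
Qed.

Lemma le_lt_trans a b c : ~ lt b a -> lt b c -> lt a c.
Proof. by move=> ba bc; case: (lt_total a b) => [h|->//|//]; apply: lt_trans h bc. Qed.

Lemma le_trans a b c : ~ lt b a -> ~ lt c b -> ~ lt c a.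
Proof. by move=> ba cb ca; apply: cb; case: (lt_total a b) => [|<-|] // /(lt_trans ca). Qed.

End Order.

(** Exploring from the single source [a] keeps the number of derived relations
    linear in the size of the context. *)
Ltac ord_reach dM a :=
  repeat match goal with
  | H1 : lt a ?x, H2 : lt ?x ?y |- _ =>
      lazymatch goal with _ : lt a y |- _ => fail | _ => pose proof (lt_trans dM H1 H2) end
  | H1 : lt a ?x, H2 : ~ lt ?y ?x |- _ =>
      lazymatch goal with _ : lt a y |- _ => fail | _ => pose proof (lt_le_trans dM H1 H2) end
  | H1 : ~ lt ?x a, H2 : lt ?x ?y |- _ =>
      lazymatch goal with _ : lt a y |- _ => fail | _ => pose proof (le_lt_trans dM H1 H2) end
  | H1 : ~ lt ?x a, H2 : ~ lt ?y ?x |- _ =>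
      lazymatch goal with
      | _ : lt a y |- _ => fail
      | _ : ~ lt y a |- _ => fail
      | _ => pose proof (le_trans dM H1 H2)
      end
  end.

Ltac ord_subst :=
  repeat match goal with
  | H : @eq (@Defs.carrier _ _) ?a ?b |- _ =>
      first [subst a | subst b | rewrite -> H in *; clear H]
  end.

(** A contradiction between order relations is a cycle with a strict step. *)
Ltac ord_false dM :=
  match goal with
  | H : lt ?a ?a |- _ => exact (lt_irr dM H)
  | H : lt ?x ?y, K : ~ lt ?x ?y |- _ => exact (K H)
  | H : lt ?x ?y |- _ =>
      ord_reach dM y;
      match goal with
      | K : lt y x |- _ => exact (lt_irr dM (lt_trans dM H K))
      | K : ~ lt x y |- _ => exact (K H)
      end
  end.

(** Proves an order relation by reachability from one of its sides, or by
    exhibiting a cycle; weak inequalities are negated strict ones and are never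
    split into cases. *)
Ltac ord :=
  intros; cbv beta iota delta [above below] in *; try assumption;
  lazymatch goal with
  | dM : dlo_without_endpoints _ |- _ =>
    ord_subst;
    lazymatch goal with
    | |- ~ lt ?a ?b =>
        first [ord_reach dM b; solve [match goal with
                 | K : lt b a |- _ => exact (fun H => lt_irr dM (lt_trans dM H K))
                 | K : ~ lt a b |- _ => exact K end]
              | let H := fresh "H" in intro H; ord_false dM]
    | |- lt ?a ?b =>
        first [ord_reach dM a; assumption | exfalso; ord_false dM]
    | |- ?a = ?b =>
        let H := fresh "H" in
        destruct (lt_total dM a b) as [H|H|H]; [exfalso|exact H|exfalso];
        ord_false dM
    | |- ~ _ => let H := fresh "H" in intro H; ord_subst; ord_false dM
    | _ => exfalso; ord_false dM
    end
  end.

Section FiniteSets.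
Variables (L : language) (M : structure L).
Hypothesis dM : dlo_without_endpoints M.
Implicit Types (a b c x y : M) (A B : set M).

Lemma max2 a b : exists c, ~ lt c a /\ ~ lt c b /\ (c = a \/ c = b).
Proof.
case: (lt_total dM a b) => h.
- by exists b; split; [ord|split; [ord|right]].
- by exists a; split; [ord|split; [ord|left]].
- by exists a; split; [ord|split; [ord|left]].
Qed.

Lemma min2 a b : exists c, ~ lt a c /\ ~ lt b c /\ (c = a \/ c = b).
Proof.
case: (lt_total dM a b) => h.
- by exists a; split; [ord|split; [ord|left]].
- by exists a; split; [ord|split; [ord|left]].
- by exists b; split; [ord|split; [ord|right]].
Qed.

Lemma between2 a b x : lt a x -> lt b x -> exists c, [/\ lt a c, lt b c & lt c x].
Proof.
move=> ax bx; case: (max2 a b) => m [h1 [h2 h3]].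
have mx : lt m x by case: h3 => ->.
by case: (lt_dense dM mx) => c [h4 h5]; exists c; split=> //; ord.
Qed.

Lemma between2' a b x : lt x a -> lt x b -> exists c, [/\ lt c a, lt c b & lt x c].
Proof.
move=> ax bx; case: (min2 a b) => m [h1 [h2 h3]].
have mx : lt x m by case: h3 => ->.
by case: (lt_dense dM mx) => c [h4 h5]; exists c; split=> //; ord.
Qed.

(** The recursion removes the least element, which makes the statement that a
    definable set has [k] elements first order, for each [k]. *)
Fixpoint ncard (k : nat) (A : set M) : Prop :=
  if k is k'.+1 then
    exists y, [/\ A y, forall y', A y' -> ~ lt y' y
                & ncard k' [set y' | A y' /\ lt y y']]
  else forall y, ~ A y.

Definition fin A := exists k, ncard k A.

Definition nth_elt m A y := A y /\ ncard m [set y' | A y' /\ lt y' y].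

Lemma set_ext T (A B : set T) : (forall t, A t <-> B t) -> A = B.
Proof. by move=> h; rewrite predeqE. Qed.

Lemma ncardS k A : ncard k.+1 A <->
  exists y, [/\ A y, forall y', A y' -> ~ lt y' y & ncard k [set y' | A y' /\ lt y y']].
Proof. by []. Qed.

Lemma ncard_ext k A B : (forall t, A t <-> B t) -> ncard k A -> ncard k B.
Proof. by move=> /set_ext ->. Qed.

Lemma ncard_uniq k l A : ncard k A -> ncard l A -> k = l.
Proof.
elim: k l A => [|k IH] [|l] A //=.
- by move=> h [y [Ay _ _]]; case: (h y).
- by move=> [y [Ay _ _]] h; case: (h y).
- move=> [y [Ay my ky]] [z [Az mz kz]].
  have ? : y = z by have := my z Az; have := mz y Ay; ord.
  by subst z; rewrite (IH _ _ ky kz).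
Qed.

Lemma ncard_add k A b : ncard k A -> ~ A b -> ncard k.+1 [set y | A y \/ y = b].
Proof.
elim: k A => [|k IH] A /=.
  move=> h nb; exists b; split; first by right.
    by move=> y' [/h//|->]; ord.
  by move=> y [[/h//|->]]; apply: (lt_irr dM).
move=> [y [Ay my ky]] nb.
case: (lt_total dM y b) => yb.
- exists y; split; first by left.
    by move=> y' [/my//|->]; ord.
  have : ncard k.+1 [set y0 | (A y0 /\ lt y y0) \/ y0 = b] by apply: IH ky _ => -[].
  congr ncard; apply: set_ext => z /=; split.
    by move=> [[Az yz]|->]; split; [left| |right|].
  by move=> [[Az|->] yz]; [left|right].
- by subst y.
- exists b; split; first by right.
    by move=> y' [/my|->]; ord.
  exists y; split; first by split; [left|].
    by move=> y' [[/my//|->]]; ord.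
  move: ky; congr ncard; apply: set_ext => z /=; split.
    by move=> [Az yz]; split; [split; [left|ord]|].
  by move=> [[[Az|->] bz] yz]; [split|ord].
Qed.

Lemma ncard_sub k A B : ncard k A -> (forall y, B y -> A y) ->
  exists2 l, l <= k & ncard l B.
Proof.
elim: k A B => [|k IH] A B /=.
  by move=> h s; exists 0 => //= y /s /h.
move=> [y [Ay my ky]] s.
have [|l lk cl] := IH _ [set z | B z /\ lt y z] ky; first by move=> z [/s].
case: (pselect (B y)) => By.
  exists l.+1 => //=; exists y; split=> // z /s /my //.
exists l; first exact: leqW.
move: cl; congr ncard; apply: set_ext => z /=; split; first by case.
move=> Bz; split=> //.
by case: (lt_total dM y z) => // h; [subst; case: (By)|case: (my z) => //; apply: s].
Qed.

Lemma ncard_le k l A B : ncard k A -> ncard l B -> (forall y, B y -> A y) -> l <= k.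
Proof. by move=> kA lB /(ncard_sub kA) [m mk /(ncard_uniq lB) ->]. Qed.

Lemma fin_sub A B : fin A -> (forall y, B y -> A y) -> fin B.
Proof. by move=> [k kA] /(ncard_sub kA) [l _ ?]; exists l. Qed.

Lemma fin_add A b : fin A -> fin [set y | A y \/ y = b].
Proof.
move=> [k kA]; case: (pselect (A b)) => Ab.
  exists k; move: kA; congr ncard; apply: set_ext => y /=.
  by split=> [|[]//->//]; left.
by exists k.+1; apply: ncard_add.
Qed.

Lemma fin_range k (p : 'I_k -> M) A : (forall y, A y -> exists i, y = p i) -> fin A.
Proof.
elim: k p A => [|k IH] p A h; first by exists 0 => y /h [[]].
have [|m hm] := IH (init p) [set y | A y /\ y <> p ord_max].
  move=> y [/h [i ->]] /= ne; case: (unliftP ord_max i) ne => [j ->|->] // _.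
  by exists j.
apply: (fin_sub (fin_add (p ord_max) (ex_intro _ m hm))) => y Ay.
by case: (pselect (y = p ord_max)); [right|left].
Qed.

Lemma fin_codom (T : finType) (p : T -> M) : fin [set y | exists i, y = p i].
Proof.
apply: (fin_range (p := fun i : 'I_#|T| => p (enum_val i))) => y [i ->].
by exists (enum_rank i); rewrite enum_rankK.
Qed.

Lemma ncard_cat i j A B : ncard i A -> ncard j B ->
  (forall a b, A a -> B b -> lt a b) -> ncard (i + j) [set y | A y \/ B y].
Proof.
elim: i A => [|i IH] A /=.
  move=> h jB _; move: jB; congr ncard; apply: set_ext => y /=.
  by split=> [|[/h|]//]; right.
move=> [y [Ay my iy]] jB lAB; exists y; split; first by left.
  by move=> z [/my//|/(lAB _ _ Ay)]; ord.
have := IH _ iy jB; have l1 a b : A a /\ lt y a -> B b -> lt a b.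
  by move=> [? ? ?]; apply: lAB.
move=> /(_ l1); congr ncard; apply: set_ext => z /=; split.
  by move=> [[? ?]|Bz]; split=> //; [left|right|apply: lAB].
by move=> [[Az|Bz] yz]; [left|right].
Qed.

Lemma nth_lt k A l y : ncard k A -> nth_elt l A y -> l < k.
Proof.
move=> kA [Ay cl]; have := ncard_add cl (b := y).
have -> : (~ [set y' | A y' /\ lt y' y] y) = True.
  by rewrite propeqE; split=> // _ [_]; apply: (lt_irr dM).
move=> /(_ I) h; apply: (ncard_le kA h) => z /= [[]//|->//].
Qed.

Lemma nth_mono A l m y z : nth_elt l A y -> nth_elt m A z -> lt y z -> l < m.
Proof.
move=> [Ay cl] [Az cm] yz.
apply: (@nth_lt _ [set y' | A y' /\ lt y' z]  _ y) => //; split=> //.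
move: cl; congr ncard; apply: set_ext => x /=; split=> [[Ax xy]|[[Ax _] ?]] //.
by split=> //; split=> //; ord.
Qed.

Lemma nth_inj A l y z : nth_elt l A y -> nth_elt l A z -> y = z.
Proof.
move=> ly lz; case: (lt_total dM y z) => // h.
  by have := nth_mono ly lz h; rewrite ltnn.
by have := nth_mono lz ly h; rewrite ltnn.
Qed.

Lemma nth_mono' A l m y z : nth_elt l A y -> nth_elt m A z -> l < m -> lt y z.
Proof.
move=> ly mz lm; case: (lt_total dM y z) => // h.
  by subst z; have := ncard_uniq ly.2 mz.2 => e; rewrite e ltnn in lm.
by have := ltn_trans lm (nth_mono mz ly h); rewrite ltnn.
Qed.

Lemma nth_ex k A l : ncard k A -> l < k -> exists y, nth_elt l A y.
Proof.
elim: k A l => // k IH A [|l] /= [y [Ay my ky]].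
  by move=> _; exists y; split=> //= z [/my].
move=> /(IH _ _ ky) [z [[Az yz] cz]]; exists z; split=> //=.
exists y; split=> //; first by move=> w [/my].
move: cz; congr ncard; apply: set_ext => w /=.
by split=> [[[? ?] ?]|[[? ?] ?]].
Qed.

Lemma nth_all k A y : ncard k A -> A y -> exists2 l, l < k & nth_elt l A y.
Proof.
move=> kA Ay; have [|l lk cl] := @ncard_sub k A [set z | A z /\ lt z y] kA.
  by move=> z [].
by exists l => //; apply: (nth_lt (k := k) (A := A) (y := y)).
Qed.

Lemma fin_min A y : fin A -> A y -> exists z, A z /\ forall w, A w -> ~ lt w z.
Proof.
move=> [[|k] /=]; first by move=> h /h.
by move=> [z [? ? _]] _; exists z.
Qed.

Lemma fin_max A y : fin A -> A y -> exists z, A z /\ forall w, A w -> ~ lt z w.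
Proof.
move=> [[|k] kA]; first by move=> /kA.
move=> _; case: (nth_ex kA (ltnSn k)) => z zk; exists z; split; first by case: zk.
move=> w /(nth_all kA) [l lk lw] zw.
by have := nth_mono zk lw zw; rewrite ltnNge -ltnS lk.
Qed.

Lemma fin_gap_left A a y : fin A -> lt a y ->
  exists c, [/\ lt a c, lt c y & forall z, A z -> lt z y -> lt z c].
Proof.
move=> fA ay; case: (pselect (exists z, A z /\ lt z y)) => [[z zy]|n].
  have [|w [[Aw wy] mw]] := @fin_max [set z | A z /\ lt z y] z _ zy.
    by apply: fin_sub fA _ => ? [].
  case: (between2 ay wy) => c [ac wc cy]; exists c; split=> // v Av vy.
  by have := mw v (conj Av vy); ord.
by case: (lt_dense dM ay) => c [ac cy]; exists c; split=> // z Az zy; case: n; exists z.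
Qed.

Lemma fin_gap_right A b y : fin A -> lt y b ->
  exists c, [/\ lt c b, lt y c & forall z, A z -> lt y z -> lt c z].
Proof.
move=> fA ay; case: (pselect (exists z, A z /\ lt y z)) => [[z zy]|n].
  have [|w [[Aw wy] mw]] := @fin_min [set z | A z /\ lt y z] z _ zy.
    by apply: fin_sub fA _ => ? [].
  case: (between2' ay wy) => c [ac wc cy]; exists c; split=> // v Av vy.
  by have := mw v (conj Av vy); ord.
by case: (lt_dense dM ay) => c [ac cy]; exists c; split=> // z Az zy; case: n; exists z.
Qed.

Lemma ncard1 A y : A y -> (forall z, A z -> z = y) -> ncard 1 A.
Proof.
move=> Ay h; exists y; split=> // [z /h -> |z /= [/h -> ]]; exact: lt_irr.
Qed.

(** Transports the number of points of a strip from one fibre to another, along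
    the bijection that preserves ranks. *)
Lemma ncard_iso k A B (P Q : set M) i : ncard k A -> ncard k B ->
  (forall l y z, l < k -> nth_elt l A y -> nth_elt l B z -> (P y <-> Q z)) ->
  ncard i [set y | A y /\ P y] -> ncard i [set y | B y /\ Q y].
Proof.
elim: k A B i => [|k IH] A B i.
  by move=> hA hB _ /=; congr ncard; apply: set_ext => z /=; split=> -[] => [/hA|/hB].
move=> hA hB h.
case: (hA) => y [Ay my ky]; case: (hB) => z [Bz mz kz].
have y0 : nth_elt 0 A y by split=> // w [/my].
have z0 : nth_elt 0 B z by split=> // w [/mz].
have nS A0 y1 : A0 y1 -> (forall w, A0 w -> ~ lt w y1) -> forall l w,
    nth_elt l [set y' | A0 y' /\ lt y1 y'] w -> nth_elt l.+1 A0 w.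
  move=> A1 m1 l w [[Aw lw] cw]; split=> //=; exists y1; split=> //.
    by move=> v [/m1].
  move: cw; congr ncard; apply: set_ext => v /=.
  by split=> [[[? ?] ?]|[[? ?] ?]].
have IH' := IH [set y' | A y' /\ lt y y'] [set y' | B y' /\ lt z y'] _ ky kz.
have {}IH' j : ncard j [set y' | (A y' /\ lt y y') /\ P y'] ->
    ncard j [set y' | (B y' /\ lt z y') /\ Q y'].
  apply: (IH' j) => l v w lk lv lw; apply: (h l.+1) => //.
    exact: nS Ay my _ _ lv.
  exact: nS Bz mz _ _ lw.
have PQ : P y <-> Q z by apply: (h 0).
case: (pselect (P y)) => Py.
  case: i => [/(_ y)|i]; first by case.
  move=> [y1 [[A1 P1] m1 c1]] /=.
  have e : y1 = y by have := m1 y (conj Ay Py); have := my y1 A1; ord.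
  subst y1; exists z; split; [by split=> //; apply/PQ|by move=> w [/mz]|].
  have : ncard i [set y' | (A y' /\ lt y y') /\ P y'].
    by move: c1; congr ncard; apply: set_ext => v /=; split=> [[[? ?] ?]|[[? ?] ?]].
  by move=> /IH'; congr ncard; apply: set_ext => v /=; split=> [[[? ?] ?]|[[? ?] ?]].
have aux A0 y1 (P0 : set M) : (forall w, A0 w -> ~ lt w y1) -> ~ P0 y1 ->
    [set y' | A0 y' /\ P0 y'] = [set y' | (A0 y' /\ lt y1 y') /\ P0 y'].
  move=> m1 n1; apply: set_ext => v /=; split=> [[Av Pv]|[[? ?] ?]] //.
  split=> //; split=> //; have := m1 v Av.
  by case: (lt_total dM y1 v) => // e; subst.
rewrite (aux A y) // (aux B z) //; first exact: IH'.
by move=> /PQ.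
Qed.

End FiniteSets.

(** * Continuously varying finite fibres *)

Section Continuity.
Variables (L : language) (M : structure L).
Hypothesis dM : dlo_without_endpoints M.
Implicit Types (a b c y : M) (A B : set M).

Definition strip (l u : option M) : set M :=
  [set y | above l y /\ (if u is Some b then ~ lt b y else True)].

Definition free A (o : option M) := if o is Some c then ~ A c else True.

(** The fibre [D x'] varies continuously, with multiplicity, as [x'] tends to
    [x] along [F].  Only strips with at most one point are tested, so that the
    condition is first order even without a bound on the size of [D x]. *)
Definition steady T (F : set_system T) (D : T -> set M) (x : T) :=
  forall l u i, i < 2 -> free (D x) l -> free (D x) u ->
    ncard i (D x `&` strip l u) -> F [set x' | ncard i (D x' `&` strip l u)].

Definition nth_continuous T (F : set_system T) (D : T -> set M) l (x : T) :=
  forall y a b, nth_elt l (D x) y -> lt a y -> lt y b ->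
    F [set x' | exists y', [/\ nth_elt l (D x') y', lt a y' & lt y' b]].

Variables (T : Type) (F : set_system T) (FF : Filter F).
Implicit Types (D : T -> set M) (x : T).

Lemma strip_cat A l c u i j : (forall y, strip (Some c) u y -> above l y) ->
  (forall y, strip l (Some c) y -> strip l u y) ->
  ncard i (A `&` strip l (Some c)) -> ncard j (A `&` strip (Some c) u) ->
  ncard (i + j) (A `&` strip l u).
Proof.
move=> cl cu ci cj; have := ncard_cat dM ci cj.
have h a b : (A `&` strip l (Some c)) a -> (A `&` strip (Some c) u) b -> lt a b.
  by move=> [_ [_ /= ?]] [_ [/= ? _]]; ord.
move=> /(_ h); congr ncard; apply: set_ext => y /=; split.
  move=> [[Ay /cu sy]|[Ay sy]] //; split=> //; split; first exact: cl.
  by case: sy.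
move=> [Ay [ly uy]]; case: (pselect (lt c y)) => h1; [right|left] => //.
Qed.

(** By induction on the number of points: a strip is cut between its first two
    points, and the strip condition applies to the first part. *)
Lemma steady_card D x : steady F D x -> forall k l u, free (D x) l -> free (D x) u ->
  ncard k (D x `&` strip l u) -> F [set x' | ncard k (D x' `&` strip l u)].
Proof.
move=> st; elim=> [|k IH] l u fl fu ck; first exact: st.
case: k IH ck => [_|k IH] ck; first exact: st.
case: (ck) => y [[Dy sy] my [z [[[Dz sz] yz] mz cz]]].
case: (lt_dense dM yz) => c [yc cz'].
have sc w : strip (Some c) u w -> above l w.
  by case: l sy {fl ck my mz cz sz} => //= a [ay _] [h _]; ord.
have su w : strip l (Some c) w -> strip l u w.
  by move=> [h1 h2]; split=> //; case: u sz {fu ck my mz cz sy sc} => //= b [_ ?]; move: h2 => /= ?; ord.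
have nDc : ~ D x c.
  move=> Dc; apply: (mz c) => //; split=> //; split=> //; split.
    by case: (l) sy => //= a [? _]; ord.
  by case: (u) sz => //= b [_ ?]; ord.
have c1 : ncard 1 (D x `&` strip l (Some c)).
  apply: (ncard1 dM (y := y)).
    by split=> //; split; [case: sy|rewrite /=; ord].
  move=> w [Dw sw]; have := my w (conj Dw (su w sw)) => h1.
  case: (pselect (lt y w)) => yw; last by ord.
  have := mz w (conj (conj Dw (su w sw)) yw); case: sw => _ /=; ord.
have ck1 : ncard k.+1 (D x `&` strip (Some c) u).
  case/ncardS: ck => y1 [[D1 s1] m1 ck1].
  have e : y1 = y by have := my _ (conj D1 s1); have := m1 _ (conj Dy sy); ord.
  subst y1; apply: ncard_ext ck1 => w; split.
    move=> [[Dw sw] yw]; split=> //; split; last by case: sw.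
    by have := mz w (conj (conj Dw sw) yw) => ? /=; ord.
  move=> [Dw sw]; split; last by case: sw => /=; ord.
  by split=> //; split; [apply: sc|case: sw].
have := IH (Some c) u nDc fu ck1.
have := st l (Some c) 1 isT fl nDc c1.
apply: filterS2 => x' h1 h2; rewrite -[k.+2]/(1 + k.+1).
by apply: strip_cat h1 h2.
Qed.

Lemma stripNN A : A `&` strip None None = A.
Proof. by apply: set_ext => y /=; split=> [[]|]. Qed.

Lemma steady_cardT D x k : steady F D x -> ncard k (D x) -> F [set x' | ncard k (D x')].
Proof.
move=> /steady_card st ck; have := st k None None I I.
rewrite stripNN => /(_ ck); apply: filterS => x'.
by rewrite /= stripNN.
Qed.

(** Separate the point from the rest of the fibre by a strip [(a', b']]: nearby
    fibres have one point in it, and as many points as [D x] before it. *)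
Lemma steady_nth D x l : fin (D x) -> steady F D x -> nth_continuous F D l x.
Proof.
move=> fD /steady_card st y a b [Dy cl] ay yb.
case: (fin_gap_left dM fD ay) => a' [aa' a'y ha].
case: (fin_gap_right dM fD yb) => b' [b'b yb' hb].
have na : ~ D x a' by move=> /ha /(_ a'y); ord.
have nb : ~ D x b' by move=> /hb /(_ yb'); ord.
have := st l None (Some a') I na.
have -> : D x `&` strip None (Some a') = [set y' | D x y' /\ lt y' y].
  apply: set_ext => z /=; split; first by move=> [Dz [_ h]]; split=> //; ord.
  by move=> [Dz zy]; split=> //; split=> //=; have := ha z Dz zy; ord.
move=> /(_ cl) h1; have := st 1 (Some a') (Some b') na nb.
have h : ncard 1 (D x `&` strip (Some a') (Some b')).
  apply: (ncard1 dM (y := y)); first by split=> //; split=> //=; ord.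
  move=> z [Dz [/= az zb]]; case: (lt_total dM z y) => // h.
    by have := ha z Dz h; ord.
  by have := hb z Dz h; ord.
move=> /(_ h) h2; apply: filterS2 h1 h2 => x' /= c1 [y' [[D' [a1 b1]] my' c2]].
exists y'; split; [split=> //|ord|ord].
move: c1; congr ncard; apply: set_ext => z /=; split.
  by move=> [Dz [_ ?]]; split=> //; ord.
move=> [Dz zy]; split=> //; split=> // az.
by apply: (my' z) => //; split=> //; split=> //=; ord.
Qed.

Lemma strip_open A l u y : free A l -> free A u -> A y ->
  exists a b, [/\ lt a y, lt y b &
    forall z, lt a z -> lt z b -> (strip l u y <-> strip l u z)].
Proof.
move=> fl fu Ay.
have side c : c <> y -> exists a b, [/\ lt a y, lt y b &
    forall z, lt a z -> lt z b -> (lt c y <-> lt c z)].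
  move=> cy; case: (lt_total dM c y) => // h.
    by case: (lt_above dM y) => b yb; exists c, b; split.
  case: (lt_below dM y) => a ay; exists a, c; split=> // z az zc.
  by split=> ?; exfalso; ord.
have [a1 [b1 [h1 h2 h3]]] : exists a b, [/\ lt a y, lt y b &
    forall z, lt a z -> lt z b -> (above l y <-> above l z)].
  case: l fl => [c|] /= fl; first by apply: side => e; subst.
  by case: (lt_below dM y) (lt_above dM y) => a ? [b ?]; exists a, b.
have [a2 [b2 [k1 k2 k3]]] : exists a b, [/\ lt a y, lt y b &
    forall z, lt a z -> lt z b -> ((if u is Some b then ~ lt b y else True) <->
      (if u is Some b then ~ lt b z else True))].
  case: u fu => [c|] /= fu.
    case: (side c) => [e|a [b [? ? h]]]; first by subst.
    by exists a, b; split=> // z az zb; case: (h z az zb) => p q; split; apply: contra_not.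
  by case: (lt_below dM y) (lt_above dM y) => a ? [b ?]; exists a, b.
case: (between2 dM h1 k1) (between2' dM h2 k2) => a [? ? ?] [b [? ? ?]].
exists a, b; split=> // z az zb; rewrite /strip /=.
have e1 : above l y <-> above l z by apply: h3; ord.
have e2 := k3 z ltac:(ord) ltac:(ord).
by split=> -[/e1 ? /e2 ?].
Qed.

Lemma filter_lt k (P : nat -> set T) : (forall l, l < k -> F (P l)) ->
  F [set x | forall l, l < k -> P l x].
Proof.
elim: k => [|k IH] h; first by apply: filterS filterT => x.
have h1 : forall l, l < k -> F (P l) by move=> l lk; apply: h; apply: ltnW.
have := IH h1; have := h k (ltnSn k); apply: filterS2 => x pk pl l.
by rewrite ltnS leq_eqVlt => /orP [/eqP ->|/pl].
Qed.

(** Near [x] no point of the fibre crosses an end of a given strip, as the ends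
    are not in [D x]. *)
Lemma steady_of_nth D x k : ncard k (D x) -> F [set x' | ncard k (D x')] ->
  (forall l, l < k -> nth_continuous F D l x) -> steady F D x.
Proof.
move=> ck Fk cont l u i _ fl fu ci.
have : F [set x' | forall m, m < k -> forall y z, nth_elt m (D x) y ->
    nth_elt m (D x') z -> (strip l u y <-> strip l u z)].
  apply: filter_lt => m mk; case: (nth_ex ck mk) => y my.
  have Dy : D x y by case: my.
  pose P z := strip l u y <-> strip l u z.
  suff [a [b [ay yb hP]]] : exists a b, [/\ lt a y, lt y b &
      forall z, lt a z -> lt z b -> P z].
    have := cont m mk y a b my ay yb.
    apply: filterS => x' [y' [my' ? ?]] y1 z1 m1 m2.
    have <- := nth_inj dM my m1; have <- := nth_inj dM my' m2; exact: hP.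
  exact: strip_open fl fu Dy.
apply: filterS2 Fk => x' /= ck' h.
by apply: (ncard_iso dM ck ck' _ ci) => m y z mk; apply: h.
Qed.

End Continuity.

(** * Uniform definability *)

Section Rename.
Variable L : language.

Fixpoint trename n m (s : 'I_n -> 'I_m) (t : term L n) : term L m :=
  match t with
  | Var i => Var L (s i)
  | App f ts => App (fun k => trename s (ts k))
  end.

Fixpoint frename n (phi : formula L n) : forall m, ('I_n -> 'I_m) -> formula L m :=
  match phi with
  | FFalse _ => fun m _ => FFalse L m
  | FEq _ t u => fun m s => FEq (trename s t) (trename s u)
  | FRel _ r ts => fun m s => FRel (fun k => trename s (ts k))
  | FImp _ p q => fun m s => FImp (frename p s) (frename q s)
  | FAll _ p => fun m s => FAll (frename p (snoc (fun i => lift ord_max (s i)) ord_max))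
  end.

Variable M : structure L.

Lemma teval_rename n m (s : 'I_n -> 'I_m) t (x : 'I_m -> M) :
  teval (trename s t) x = teval t (fun i => x (s i)).
Proof. by elim: t => //= f ts IH; congr fint; apply: funext. Qed.

Lemma snoc_lift (T : Type) n (x : 'I_n -> T) a i : snoc x a (lift ord_max i) = x i.
Proof. by rewrite /snoc liftK. Qed.

Lemma snoc_max (T : Type) n (x : 'I_n -> T) a : snoc x a ord_max = a.
Proof. by rewrite /snoc unlift_none. Qed.

Lemma init_snoc (T : Type) n (x : 'I_n -> T) a : init (snoc x a) = x.
Proof. by apply: funext => i; rewrite /init snoc_lift. Qed.

Lemma final_snoc (T : Type) n (x : 'I_n -> T) a : final (snoc x a) = a.
Proof. by rewrite /final snoc_max. Qed.

Lemma snocK (T : Type) n (z : 'I_n.+1 -> T) : snoc (init z) (final z) = z.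
Proof.
by apply: funext => i; case: (unliftP ord_max i) => [j|] ->; rewrite ?snoc_lift ?snoc_max.
Qed.

Lemma snoc_comp (T S : Type) n (f : T -> S) (x : 'I_n -> T) a :
  (fun k => f (snoc x a k)) = snoc (fun k => f (x k)) (f a).
Proof.
by apply: funext => i; case: (unliftP ord_max i) => [j|] ->; rewrite ?snoc_lift ?snoc_max.
Qed.

Lemma holds_rename n (phi : formula L n) m (s : 'I_n -> 'I_m) (x : 'I_m -> M) :
  holds (frename phi s) x = holds phi (fun i => x (s i)).
Proof.
elim: phi m s x => {n} //=.
- by move=> n t u m s x; rewrite !teval_rename.
- by move=> n r ts m s x; congr rint; apply: funext => k; rewrite teval_rename.
- by move=> n p IHp q IHq m s x; rewrite IHp IHq.
- move=> n p IH m s x; rewrite propeqE; split=> h a; move: (h a); rewrite IH;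
    rewrite (snoc_comp (snoc x a)) snoc_max;
    by congr holds; congr snoc; apply: funext => i; rewrite snoc_lift.
Qed.

End Rename.

Section Definability.
Variables (L : language) (J : Type) (M : J -> structure L).
Variables (K : Type) (iota : forall j, K -> M j).

Definition setfam n := forall j, set ('I_n -> M j).

Definition assign n m (s : 'I_m -> 'I_n + K) j (x : 'I_n -> M j) : 'I_m -> M j :=
  fun k => match s k with inl i => x i | inr c => iota j c end.

(** One formula, with constants from [K], defines all the members of [X].  For
    [K] empty this is definability without parameters, uniformly in [j]; for a
    single structure with [K] its carrier it is definability with parameters. *)
Definition Def n (X : setfam n) := exists m (phi : formula L m) (s : 'I_m -> 'I_n + K),
  forall j x, X j x = holds phi (assign s x).

Lemma Def_sub n m (X : setfam m) (s : 'I_m -> 'I_n + K) :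
  Def X -> Def (fun j (x : 'I_n -> M j) => X j (assign s x)).
Proof.
move=> [p [phi [t h]]]; exists p, phi, (fun k => match t k with inl i => s i | inr c => inr c end).
move=> j x; rewrite h; congr holds; apply: funext => k.
by rewrite /assign; case: (t k).
Qed.

Lemma Def_reindex n m (X : setfam m) (s : 'I_m -> 'I_n) :
  Def X -> Def (fun j (x : 'I_n -> M j) => X j (fun i => x (s i))).
Proof. exact: (@Def_sub n m X (fun i => inl (s i))). Qed.

Lemma Def_false n : Def (fun j (x : 'I_n -> M j) => False).
Proof. by exists n, (FFalse L n), inl. Qed.

Lemma Def_imp n (P Q : setfam n) : Def P -> Def Q ->
  Def (fun j (x : 'I_n -> M j) => P j x -> Q j x).
Proof.
move=> [m [phi [s h]]] [p [psi [t k]]].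
exists (m + p), (FImp (frename phi (lshift p)) (frename psi (@rshift m p))).
exists (fun i => match split i with inl a => s a | inr b => t b end) => j x /=.
rewrite !holds_rename h k; congr (_ -> _); congr holds.
  by apply: funext => i; rewrite /assign (unsplitK (inl i)).
by apply: funext => i; rewrite /assign (unsplitK (inr i)).
Qed.

Lemma Def_all n (P : forall j, ('I_n -> M j) -> M j -> Prop) :
  Def (fun j (z : 'I_n.+1 -> M j) => P j (init z) (final z)) ->
  Def (fun j (x : 'I_n -> M j) => forall a, P j x a).
Proof.
move=> [m [phi [s h]]].
have {}h j x a : P j x a = holds phi (assign s (snoc x a)).
  by rewrite -h init_snoc final_snoc.
(* The bound variable of the new formula still needs a value under the
   assignment; if there is none to choose, it is the only variable of [phi]. *)
case: (pselect (inhabited ('I_n + K))) => [[u0]|none].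
  pose v i := match s i with
    | inl k => if unlift ord_max k is Some k' then lift ord_max i else ord_max
    | inr _ => lift ord_max i end.
  pose t i := match s i with
    | inl k => if unlift ord_max k is Some k' then inl k' else u0
    | inr c => inr c end.
  exists m, (FAll (frename phi v)), t => j x /=.
  rewrite propeqE; split=> q a; move: (q a); rewrite h holds_rename;
    congr holds; apply: funext => i; rewrite /assign /v /t;
    case E: (s i) => [k|c]; rewrite ?snoc_lift ?E //;
    case F: (unlift ord_max k) => [k'|]; rewrite ?snoc_lift ?snoc_max ?E ?F /snoc ?F //.
exists 0, (FAll (frename phi (fun _ => ord_max))).
exists (fun i => match s (widen_ord (leq0n m) i) with inl k => inr (False_rect K (none (inhabits (inr
 (match i with Ordinal _ h => False_rect K (notF h) end))))) | inr c => inr c end) => j x /=.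
rewrite propeqE; split=> q a; move: (q a); rewrite h holds_rename;
  congr holds; apply: funext => i; rewrite /assign ?snoc_max; case: (s i) => [k|c];
    try (by case: (none (inhabits (inr c))));
  by case: (unliftP ord_max k) => [k' _|->];
     [case: (none (inhabits (inl k')))|rewrite snoc_max].
Qed.

Lemma Def_not n (P : setfam n) : Def P -> Def (fun j (x : 'I_n -> M j) => ~ P j x).
Proof. by move=> h; apply: Def_imp h (Def_false n). Qed.

Lemma Def_eqv n (P Q : setfam n) : (forall j x, P j x <-> Q j x) -> Def P -> Def Q.
Proof. by move=> h [m [phi [s k]]]; exists m, phi, s => j x; rewrite -k propeqE; split=> /h. Qed.

Lemma Def_and n (P Q : setfam n) : Def P -> Def Q ->
  Def (fun j (x : 'I_n -> M j) => P j x /\ Q j x).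
Proof.
move=> p q; have := Def_not (Def_imp p (Def_not q)); apply: Def_eqv => j x.
by split=> [/not_implyP [? /contrapT]|[? ?] h] //; apply: h.
Qed.

Lemma Def_or n (P Q : setfam n) : Def P -> Def Q ->
  Def (fun j (x : 'I_n -> M j) => P j x \/ Q j x).
Proof.
move=> p q; have := Def_imp (Def_not p) q; apply: Def_eqv => j x.
by split=> [h|[]//]; case: (pselect (P j x)); [left|right; exact: h].
Qed.

Lemma Def_ex n (P : forall j, ('I_n -> M j) -> M j -> Prop) :
  Def (fun j (z : 'I_n.+1 -> M j) => P j (init z) (final z)) ->
  Def (fun j (x : 'I_n -> M j) => exists a, P j x a).
Proof.
move=> h; have := Def_not (@Def_all _ (fun j x a => ~ P j x a) (Def_not h)).
apply: Def_eqv => j x; split=> [na|[a Pa] /(_ a)//].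
by apply: contrapT => k; apply: na => a Pa; apply: k; exists a.
Qed.

Lemma Def_const n (P : Prop) : Def (fun j (x : 'I_n -> M j) => P).
Proof.
case: (pselect P) => p.
  by apply: Def_eqv (Def_imp (Def_false n) (Def_false n)) => j x; split.
by apply: Def_eqv (Def_false n) => j x; split.
Qed.

Lemma Def_forall_lt n (P : nat -> setfam n) k : (forall i, Def (P i)) ->
  Def (fun j (x : 'I_n -> M j) => forall i, i < k -> P i j x).
Proof.
move=> h; elim: k => [|k IH]; first by apply: Def_eqv (Def_const n True) => j x; split.
apply: Def_eqv (Def_and IH (h k)) => j x; split=> [[p q] i|p].
  by rewrite ltnS leq_eqVlt => /orP [/eqP ->|/p].
by split=> [i ik|]; apply: p => //; apply: ltnW.
Qed.

Lemma Def_forall_ord n k (P : 'I_k -> setfam n) : (forall i, Def (P i)) ->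
  Def (fun j (x : 'I_n -> M j) => forall i, P i j x).
Proof.
move=> h.
pose Q i : setfam n := fun j x => if insub i is Some o then P o j x else True.
have hQ i : Def (Q i) by rewrite /Q; case: insub => [o|]; [apply: h|apply: Def_const].
apply: Def_eqv (Def_forall_lt k hQ) => j x; rewrite /Q; split=> [p i|p i ik].
  by have := p i (ltn_ord i); rewrite valK.
by case: insub.
Qed.

Lemma Def_forall_fin n (T : finType) (P : T -> setfam n) : (forall i, Def (P i)) ->
  Def (fun j (x : 'I_n -> M j) => forall i, P i j x).
Proof.
move=> h; have := @Def_forall_ord n #|T| (fun i => P (enum_val i)) (fun i => h _).
by apply: Def_eqv => j x; split=> p i; [have := p (enum_rank i); rewrite enum_rankK|exact: p].
Qed.

Lemma Def_allv m n (X : setfam (m + n)) : Def X ->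
  Def (fun j (x : 'I_n -> M j) => forall y : 'I_m -> M j, X j (fcat y x)).
Proof.
elim: m X => [|m IH] X hX.
  have e j (x : 'I_(0 + n) -> M j) (y : 'I_0 -> M j) : fcat y x = x.
    apply: funext => i; rewrite /fcat; case: splitP => [[]//|k e].
    by congr x; apply: val_inj.
  apply: Def_eqv hX => j x; split=> [h y|/(_ (fun i => x (lshift n i)))]; by rewrite e.
pose v (i : 'I_(m.+1 + n)) : 'I_((m + n).+1) := match split i with
  | inl a => if unlift ord_max a is Some a' then lift ord_max (lshift n a') else ord_max
  | inr b => lift ord_max (rshift m b) end.
have := IH _ (@Def_all _ (fun j z a => X j (fun i => snoc z a (v i))) _).
have -> : (fun j (z : 'I_(m + n).+1 -> M j) => X j (fun i => snoc (init z) (final z) (v i)))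
   = (fun j (z : 'I_(m + n).+1 -> M j) => X j (fun i => z (v i))).
  by apply: functional_extensionality_dep => j; apply: funext => z; rewrite snocK.
move=> /(_ (Def_reindex v hX)); apply: Def_eqv => j x.
have e (y : 'I_m -> M j) a : (fun i => snoc (fcat y x) a (v i)) = fcat (snoc y a) x.
  apply: funext => i; rewrite /v /fcat; case: (split i) => [k|k].
    case: (unliftP ord_max k) => [k' ->|->]; rewrite ?snoc_lift ?snoc_max //.
    by rewrite (unsplitK (inl k')).
  by rewrite snoc_lift (unsplitK (inr k)).
split=> h y; first by rewrite -(snocK y) -e; apply: h.
by move=> a; rewrite e; apply: h.
Qed.

Lemma Def_all_tuple m n (P : forall j, ('I_n -> M j) -> ('I_m -> M j) -> Prop) :
  Def (fun j (z : 'I_(m + n) -> M j) => P j (fun k => z (rshift m k)) (fun k => z (lshift n k))) ->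
  Def (fun j (x : 'I_n -> M j) => forall y, P j x y).
Proof.
move=> /Def_allv; apply: Def_eqv => j x.
have e (y : 'I_m -> M j) : (fun k => fcat y x (rshift m k)) = x.
  by apply: funext => i; rewrite /fcat (unsplitK (inr i)).
have e' (y : 'I_m -> M j) : (fun k => fcat y x (lshift n k)) = y.
  by apply: funext => i; rewrite /fcat (unsplitK (inl i)).
by split=> h y; move: (h y); rewrite e e'.
Qed.

Lemma Def_ex_tuple m n (P : forall j, ('I_n -> M j) -> ('I_m -> M j) -> Prop) :
  Def (fun j (z : 'I_(m + n) -> M j) => P j (fun k => z (rshift m k)) (fun k => z (lshift n k))) ->
  Def (fun j (x : 'I_n -> M j) => exists y, P j x y).
Proof.
move=> h; have := Def_not (@Def_all_tuple m n (fun j x a => ~ P j x a) (Def_not h)).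
apply: Def_eqv => j x; split=> [na|[a Pa] /(_ a)//].
by apply: contrapT => k; apply: na => a Pa; apply: k; exists a.
Qed.

Lemma Def_var_eq n (a b : 'I_n) : Def (fun j (x : 'I_n -> M j) => x a = x b).
Proof. by exists n, (FEq (Var L a) (Var L b)), inl. Qed.

Lemma Def_var_lt n (a b : 'I_n) : Def (fun j (x : 'I_n -> M j) => lt (x a) (x b)).
Proof.
exists n, (FRel (r := less L) (fun k => Var L (if val k == 0 then a else b))), inl => j x.
by rewrite /lt /=; congr rint; apply: funext => k; case: ifP.
Qed.

(** Definable functions enter formulas in the way terms do: a condition on the
    value is a condition on all the [y] of the graph, see [Def_app]. *)
Definition dterm n (t : forall j, ('I_n -> M j) -> M j) :=
  Def (fun j (z : 'I_n.+1 -> M j) => final z = t j (init z)).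

Lemma Def_app n m (X : setfam m) (T : forall j, ('I_n -> M j) -> 'I_m -> M j) :
  Def X -> (forall k, dterm (fun j x => T j x k)) ->
  Def (fun j (x : 'I_n -> M j) => X j (T j x)).
Proof.
move=> hX hT.
have h : Def (fun j (x : 'I_n -> M j) =>
    forall y : 'I_m -> M j, (forall k, y k = T j x k) -> X j y).
  apply: Def_all_tuple; apply: Def_imp; last exact: (Def_reindex (lshift n) hX).
  apply: Def_forall_ord => k.
  have := Def_reindex (snoc (fun i => rshift m i) (lshift n k)) (hT k).
  apply: Def_eqv => j z; rewrite /final snoc_max.
  suff -> : (init (fun i => z (snoc (fun i0 => rshift m i0) (lshift n k) i)))
     = (fun i => z (rshift m i)) by [].
  by apply: funext => i; rewrite /init snoc_lift.
apply: Def_eqv h => j x; split=> [p|p y /funext -> //]; exact: p.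
Qed.

Lemma dterm_var n (i : 'I_n) : dterm (fun j (x : 'I_n -> M j) => x i).
Proof. exact: Def_var_eq. Qed.

Lemma dterm_const n (c : K) : dterm (fun j (x : 'I_n -> M j) => iota j c).
Proof.
have := Def_sub (fun k : 'I_2 => if k == ord0 then inl (@ord_max n) else inr c)
  (Def_var_eq ord0 ord_max).
by apply: Def_eqv.
Qed.

Lemma dterm_sub n m (t : forall j, ('I_m -> M j) -> M j) (s : 'I_m -> 'I_n) :
  dterm t -> dterm (fun j (x : 'I_n -> M j) => t j (fun i => x (s i))).
Proof.
move=> /(Def_reindex (snoc (fun i => lift ord_max (s i)) ord_max)).
apply: Def_eqv => j x; rewrite /final snoc_max.
suff -> : (init (fun i => x (snoc (fun i0 => lift ord_max (s i0)) ord_max i)))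
     = (fun i => init x (s i)) by [].
by apply: funext => i; rewrite /init snoc_lift.
Qed.

Lemma dterm_app n m (f : forall j, ('I_m -> M j) -> M j) (T : forall j, ('I_n -> M j) -> 'I_m -> M j) :
  dterm f -> (forall k, dterm (fun j x => T j x k)) -> dterm (fun j x => f j (T j x)).
Proof.
move=> hf hT.
pose T' j (z : 'I_n.+1 -> M j) : 'I_m.+1 -> M j := snoc (T j (init z)) (final z).
have hT' k : dterm (fun j x => T' j x k).
  rewrite /T'; case: (unliftP ord_max k) => [k' ->|->].
    have := dterm_sub (lift ord_max) (hT k'); apply: Def_eqv => j x.
    by rewrite snoc_lift.
  by have := dterm_var (@ord_max n); apply: Def_eqv => j x; rewrite snoc_max.
by have := Def_app hf hT'; apply: Def_eqv => j x; rewrite /T' init_snoc final_snoc.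
Qed.

Lemma Def_lt n (s t : forall j, ('I_n -> M j) -> M j) : dterm s -> dterm t ->
  Def (fun j (x : 'I_n -> M j) => lt (s j x) (t j x)).
Proof.
move=> hs ht.
apply: (@Def_app n 2 _ (fun j x k => if k == ord0 then s j x else t j x) (Def_var_lt ord0 ord_max)).
by move=> k; case: (k == ord0).
Qed.

Lemma Def_eq n (s t : forall j, ('I_n -> M j) -> M j) : dterm s -> dterm t ->
  Def (fun j (x : 'I_n -> M j) => s j x = t j x).
Proof.
move=> hs ht.
apply: (@Def_app n 2 _ (fun j x k => if k == ord0 then s j x else t j x) (Def_var_eq ord0 ord_max)).
by move=> k; case: (k == ord0).
Qed.

Lemma Def_nle n (s t : forall j, ('I_n -> M j) -> M j) : dterm s -> dterm t ->
  Def (fun j (x : 'I_n -> M j) => ~ lt (s j x) (t j x)).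
Proof. by move=> hs ht; apply: Def_not; apply: Def_lt. Qed.

Lemma dterm_snoc n m (T : forall j, ('I_n -> M j) -> 'I_m -> M j) t :
  (forall k, dterm (fun j x => T j x k)) -> dterm t ->
  forall k, dterm (fun j x => snoc (T j x) (t j x) k).
Proof.
move=> hT ht k; rewrite /snoc; case: (unlift ord_max k) => [i|//]; exact: hT.
Qed.

Lemma Def_opt n (P : forall j, ('I_n -> M j) -> option (M j) -> Prop) :
  Def (fun j x => P j x None) ->
  Def (fun j (z : 'I_n.+1 -> M j) => P j (init z) (Some (final z))) ->
  Def (fun j (x : 'I_n -> M j) => forall o, P j x o).
Proof.
move=> h1 h2; apply: Def_eqv (Def_and h1 (@Def_all _ (fun j x a => P j x (Some a)) h2)) => j x.
by split=> [[p q] [a|]|p].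
Qed.

Lemma Def_card k n (A : forall j, ('I_n -> M j) -> set (M j)) :
  Def (fun j (z : 'I_n.+1 -> M j) => A j (init z) (final z)) ->
  Def (fun j (x : 'I_n -> M j) => ncard k (A j x)).
Proof.
elim: k n A => [|k IH] n A hA; first by apply: Def_all; apply: Def_not.
apply: (@Def_eqv _ (fun j x => exists y, A j x y /\ ((forall y', A j x y' -> ~ lt y' y) /\
   ncard k [set y' | A j x y' /\ lt y y']))).
  by move=> j x; split=> [[y [? [? ?]]]|[y [? ? ?]]]; exists y.
have v1 j : dterm (n := n.+2) (fun j z => init z ord_max) by exact: dterm_var.
have hA' : Def (fun j (z : 'I_n.+2 -> M j) => A j (init (init z)) (final z)).
  have := Def_reindex (snoc (fun i => lift ord_max (lift ord_max i)) ord_max) hA.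
  apply: Def_eqv => j z; rewrite /final snoc_max.
  set u := init _; suff -> : u = init (init z) by [].
  by apply: funext => i; rewrite /u /init snoc_lift.
apply: Def_ex; apply: Def_and => //; apply: Def_and.
  apply: Def_all; apply: Def_imp => //; apply: Def_nle; exact: dterm_var.
apply: IH; apply: Def_and => //; apply: Def_lt; exact: dterm_var.
Qed.

End Definability.

(** * Definable sets of one structure *)

Section OneStructure.
Variables (L : language) (M : structure L).

Definition dset n (X : set ('I_n -> M)) :=
  Def (J := unit) (M := fun _ => M) (fun _ c => c) (fun _ => X).

Definition dfun n (f : ('I_n -> M) -> M) :=
  dterm (J := unit) (M := fun _ => M) (fun _ c => c) (fun _ => f).

Definition dset1 (A : set M) := dset (fun x : 'I_1 -> M => A (x ord0)).

Definition dset2 (R : M -> M -> Prop) :=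
  dset (fun x : 'I_2 -> M => R (x ord0) (x ord_max)).

Definition dfun1 (f : M -> M) := dfun (fun x : 'I_1 -> M => f (x ord0)).

Notation D0 := (Def (J := unit) (M := fun _ => M) (fun _ c => c)).
Notation T0 := (dterm (J := unit) (M := fun _ => M) (fun _ c => c)).

Lemma dset_app n m (X : set ('I_m -> M)) (T : unit -> ('I_n -> M) -> 'I_m -> M) :
  dset X -> (forall k, T0 (fun j x => T j x k)) -> D0 (fun j (x : 'I_n -> M) => X (T j x)).
Proof. exact: Def_app. Qed.

Lemma dfun_app n m (f : ('I_m -> M) -> M) (T : unit -> ('I_n -> M) -> 'I_m -> M) :
  dfun f -> (forall k, T0 (fun j x => T j x k)) -> T0 (fun j (x : 'I_n -> M) => f (T j x)).
Proof. by move=> hf hT; apply: (dterm_app (f := fun _ => f)). Qed.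

Lemma dset1_app n (A : set M) (t : unit -> ('I_n -> M) -> M) :
  dset1 A -> T0 t -> D0 (fun j (x : 'I_n -> M) => A (t j x)).
Proof. by move=> hA ht; apply: (@dset_app _ _ _ (fun j x _ => t j x) hA). Qed.

Lemma dset2_app n R (s t : unit -> ('I_n -> M) -> M) :
  dset2 R -> T0 s -> T0 t -> D0 (fun j (x : 'I_n -> M) => R (s j x) (t j x)).
Proof.
move=> hR hs ht.
apply: (@dset_app _ _ _ (fun j x k => if k == ord0 then s j x else t j x) hR) => k.
by case: (k == ord0).
Qed.

Lemma dfun1_app n (f : M -> M) (t : unit -> ('I_n -> M) -> M) :
  dfun1 f -> T0 t -> T0 (fun j (x : 'I_n -> M) => f (t j x)).
Proof.
move=> hf ht.
exact: (@dfun_app n 1 (fun x => f (x ord0)) (fun j x _ => t j x) hf (fun _ => ht)).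
Qed.

Lemma definableP n (X : set ('I_n -> M)) : inhabited M -> definable X <-> dset X.
Proof.
move=> [a0]; split.
  move=> [m [phi [b ->]]].
  exists (n + m), phi, (fun k => match split k with inl i => inl i | inr c => inr (b c) end).
  move=> [] x; rewrite /mkset; congr holds; apply: funext => k.
  by rewrite /assign /fcat; case: (split k).
move=> [m [phi [s h]]].
exists m, (frename phi (fun k => match s k with inl i => lshift m i | inr _ => rshift n k end)).
exists (fun k => match s k with inl i => a0 | inr c => c end).
apply: set_ext => x; rewrite (h tt) /= holds_rename.
suff -> : assign (M := fun _ => M) (fun _ c => c) (j := tt) s x = (fun i : 'I_m =>
 fcat x (fun k : 'I_m => match s k with inl _ => a0 | inr c => c end)
   match s i with inl i0 => lshift m i0 | inr _ => rshift n i end) by [].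
apply: funext => k; rewrite /assign /fcat; case e: (s k) => [i|c].
  by rewrite (unsplitK (inl i)).
by rewrite (unsplitK (inr k)) e.
Qed.

End OneStructure.

Section Rules.
Variables (L : language) (J : Type) (M : J -> structure L).
Variables (K : Type) (iota : forall j, K -> M j).

Lemma Def_and3 n (P Q R : setfam M n) : Def iota P -> Def iota Q -> Def iota R ->
  Def iota (fun j x => [/\ P j x, Q j x & R j x]).
Proof.
move=> p q r; apply: Def_eqv (Def_and p (Def_and q r)) => j x.
by split=> [[? []]|[]].
Qed.

Lemma Def_and4 n (P Q R S : setfam M n) : Def iota P -> Def iota Q -> Def iota R ->
  Def iota S -> Def iota (fun j x => [/\ P j x, Q j x, R j x & S j x]).
Proof.
move=> p q r s; apply: Def_eqv (Def_and p (Def_and q (Def_and r s))) => j x.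
by split=> [[? [? []]]|[]].
Qed.

Lemma Def_ex2 n (P Q : forall j, ('I_n -> M j) -> M j -> Prop) :
  Def iota (fun j (z : 'I_n.+1 -> M j) => P j (init z) (final z) /\ Q j (init z) (final z)) ->
  Def iota (fun j (x : 'I_n -> M j) => exists2 a, P j x a & Q j x a).
Proof.
move=> h; have := Def_ex (P := fun j x a => P j x a /\ Q j x a) h.
by apply: Def_eqv => j x; split=> [[a [? ?]]|[a ? ?]]; exists a.
Qed.

End Rules.

Ltac dterm_tac :=
  first
  [ exact: dterm_var
  | assumption
  | exact: dterm_const
  | match goal with
    | H : dfun1 _ |- _ => solve [apply: (dfun1_app H); dterm_tac]
    | H : dfun _ |- _ => solve [apply: (dfun_app H); let k := fresh "k" in intro k; dterm_tac]
    end
  | match goal with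
    | |- context [snoc _ _ ?k] => solve [apply: dterm_snoc; [let k := fresh "k" in intro k|]; dterm_tac]
    end
  ].

(** Definability of a predicate that is written by first-order means from
    predicates and functions whose definability is in the context; the rules
    follow its outermost connective, and a quantified variable becomes the last
    coordinate. *)
Ltac def_tac :=
  cbv beta iota delta [dset dset1 dset2 mkset setI setU setC nth_elt above below free strip Defs.interval];
  first
  [ assumption
  | apply: Def_lt; dterm_tac
  | apply: Def_eq; dterm_tac
  | match goal with
    | H : dset1 _ |- _ => solve [apply: (dset1_app H); dterm_tac]
    | H : dset2 _ |- _ => solve [apply: (dset2_app H); dterm_tac]
    | H : dset _ |- _ => solve [apply: (dset_app H); let k := fresh "k" in intro k; dterm_tac]
    | H : Def _ _ |- _ => solve [apply: (Def_app H); let k := fresh "k" in intro k; dterm_tac]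
    end
  | apply: Def_card; def_tac
  | apply: Def_and; def_tac
  | apply: Def_and3; def_tac
  | apply: Def_and4; def_tac
  | apply: Def_or; def_tac
  | apply: Def_imp; def_tac
  | apply: Def_ex; def_tac
  | apply: Def_ex2; def_tac
  | apply: Def_all; def_tac
  | apply: Def_opt; def_tac
  | apply: Def_ex_tuple; def_tac
  | apply: Def_all_tuple; def_tac
  | apply: Def_forall_lt; let k := fresh "k" in intro k; def_tac
  | apply: Def_forall_fin; let k := fresh "k" in intro k; def_tac
  | apply: Def_const
  ].

(** * Definable subsets of an o-minimal line *)

Section Line.
Variables (L : language) (M : structure L).
Hypothesis om : ominimal M.
Let dM := om.1.
Implicit Types (a c x y : M) (A B : set M).

(** The points [p i] may be repeated and need not be break points, so that tame
    sets are closed under unions by collecting the points. *)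
Definition tame A := exists (T : finType) (p : T -> M), forall x y,
  lt x y -> (forall i, lt (p i) x \/ lt y (p i)) -> (A x <-> A y).

Lemma tame_union k (B : 'I_k -> set M) : (forall j, tame (B j)) -> tame (\bigcup_j B j).
Proof.
move=> hB.
have /choice [w h] j : exists w : {T : finType & T -> M}, forall x y, lt x y ->
    (forall i, lt (projT2 w i) x \/ lt y (projT2 w i)) -> (B j x <-> B j y).
  by case: (hB j) => T [p h]; exists (existT _ T p).
exists {j : 'I_k & projT1 (w j)}, (fun u => projT2 (w (tag u)) (tagged u)) => x y xy hi.
by split=> -[j _ Bj]; exists j => //; apply/(h j x y xy) => // i;
  apply: (hi (Tagged (fun j => projT1 (w j)) i)).
Qed.

Lemma ominimal_tame A : dset1 A -> tame A.
Proof.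
move=> hA; case: om => -[iM _ _ _ _]; have dM' := om.1.
move=> /(_ A); case; first exact/definableP.
move=> k [B [hB ->]]; apply: tame_union => j; case: (hB j) => [[a ->]|[l [u ->]]].
  exists unit, (fun _ => a) => x y xy /(_ tt) h /=.
  by split=> e; subst; case: h; ord.
case: l => [l|]; case: u => [u|].
- exists bool, (fun e : bool => if e then l else u) => x y xy h /=.
  by case: (h true) (h false) => [?|?] [?|?]; split=> -[? ?]; split; ord.
- exists unit, (fun _ => l) => x y xy /(_ tt) h /=.
  by split=> -[? ?]; split=> //; case: h; ord.
- exists unit, (fun _ => u) => x y xy /(_ tt) h /=.
  by split=> -[? ?]; split=> //; case: h; ord.
- by exists void, (fun v : void => match v with end).
Qed.

Definition ordb (b : bool) x y := if b then lt x y else lt y x.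

(** Next to [a] there is an interval that avoids the finitely many points where
    a tame set may change. *)
Lemma germ b A a : dset1 A -> exists s, ordb b a s /\
  ((forall x, ordb b a x -> ordb b x s -> A x) \/
   (forall x, ordb b a x -> ordb b x s -> ~ A x)).
Proof.
move=> /ominimal_tame [T [p h]].
have [s [as_ hs]] : exists s, ordb b a s /\ forall x y, lt x y ->
   ordb b a x -> ordb b x s -> ordb b a y -> ordb b y s -> (A x <-> A y).
  case: b => /=.
    case: (lt_above dM a) => s0 as0; case: (fin_gap_right dM (fin_codom dM p) as0) => s [_ as_ hs].
    exists s; split=> // x y xy ax _ _ ys; apply: h => // i.
    case: (pselect (lt a (p i))) => ai; last by left; ord.
    by right; have := hs _ (ex_intro _ i erefl) ai; ord.
  case: (lt_below dM a) => s0 as0; case: (fin_gap_left dM (fin_codom dM p) as0) => s [_ as_ hs].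
  exists s; split=> // x y xy ax xs ay ys; apply: h => // i.
  case: (pselect (lt (p i) a)) => ai; last by right; ord.
  by left; have := hs _ (ex_intro _ i erefl) ai; ord.
exists s; split=> //.
case: (pselect (exists x, [/\ ordb b a x, ordb b x s & A x])) => [[x [ax xs Ax]]|n]; last first.
  by right=> x ax xs Ax; apply: n; exists x.
left=> y ay ys; case: (lt_total dM x y) => xy; [|by subst|].
  by apply/(hs x y).
by apply/(hs y x).
Qed.

(** The main use of o-minimality below: finitely many definable properties become
    constant by passing to a subinterval once for each of them. *)
Lemma split_interval A l u : dset1 A -> lt l u -> exists l' u', [/\ ~ lt l' l, ~ lt u u', lt l' u' &
  (forall x, lt l' x -> lt x u' -> A x) \/ (forall x, lt l' x -> lt x u' -> ~ A x)].
Proof.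
move=> /(germ true l) [s [ls h]] lu; case: (min2 dM s u) => v [vs [vu e]].
exists l, v; split=> //; [ord| |].
  by case: e => ->.
by case: h => h; [left|right] => x lx xv; apply: h => //=; ord.
Qed.

Lemma fin_or_interval A : dset1 A -> fin A \/
  exists l u, lt l u /\ forall x, lt l x -> lt x u -> A x.
Proof.
move=> /ominimal_tame [T [p h]].
case: (pselect (forall x, A x -> exists i, x = p i)) => [sub|].
  by left; apply: (fin_sub dM) (fin_codom dM p) _.
move=> /existsNP [x /not_implyP [Ax nx]]; right.
case: (lt_above dM x) => s0 as0; case: (fin_gap_right dM (fin_codom dM p) as0) => s [_ xs hs].
exists x, s; split=> // y xy ys; apply/(h x y xy) => // i.
case: (lt_total dM x (p i)) => xi; [|by case: nx; exists i|by left].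
by right; have := hs _ (ex_intro _ i erefl) xi; ord.
Qed.

(** The upward closure [B] of [A] does not change between the largest candidate
    [x0] outside [B] and the smallest candidate [y0] inside it; hence one of them
    is the infimum of [A]. *)
Lemma definable_inf_lt A a c : dset1 A -> A a -> (forall x, A x -> lt c x) ->
  exists i, (forall x, A x -> ~ lt x i) /\
    forall j, lt i j -> exists x, A x /\ lt x j.
Proof.
move=> hA Aa lo.
pose B y := exists x, A x /\ lt x y.
have hB : dset1 B by rewrite /B; def_tac.
have [T [p h]] := ominimal_tame hB.
have up x y : B x -> lt x y -> B y by move=> [z [Az zx]] xy; exists z; split=> //; ord.
have nBc : ~ B c by move=> [x [/lo ? ?]]; ord.
case: (lt_above dM a) => y1 ay1; have By1 : B y1 by exists a.
have [y0 [[By0 _] my0]] : exists y0, (B y0 /\ ((exists i, y0 = p i) \/ y0 = y1)) /\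
    forall w, (B w /\ ((exists i, w = p i) \/ w = y1)) -> ~ lt w y0.
  apply: (@fin_min _ _ [set y | B y /\ ((exists i, y = p i) \/ y = y1)] y1); last by split=> //; right.
  by apply: (fin_sub dM) (fin_add dM y1 (fin_codom dM p)) _ => y [].
have [x0 [[Bx0 _] mx0]] : exists y0, (~ B y0 /\ ((exists i, y0 = p i) \/ y0 = c)) /\
    forall w, (~ B w /\ ((exists i, w = p i) \/ w = c)) -> ~ lt y0 w.
  apply: (@fin_max _ _ dM [set y | ~ B y /\ ((exists i, y = p i) \/ y = c)] c); last by split=> //; right.
  by apply: (fin_sub dM) (fin_add dM c (fin_codom dM p)) _ => y [].
have xy0 : lt x0 y0.
  by case: (lt_total dM x0 y0) => // [e|/(up _ _ By0)//]; subst.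
have const x y : lt x0 x -> lt x y -> lt y y0 -> (B x <-> B y).
  move=> xx xy yy; apply: h => // i; case: (pselect (B (p i))) => Bi.
    by right; have := my0 (p i) (conj Bi (or_introl (ex_intro _ i erefl))); ord.
  by left; have := mx0 (p i) (conj Bi (or_introl (ex_intro _ i erefl))); ord.
case: (lt_dense dM xy0) => z [xz zy]; case: (pselect (B z)) => Bz.
  exists x0; split=> [x Ax xx|j xj]; first by apply: Bx0; exists x.
  case: (between2' dM xj xz) => w [wj wz xw].
  have /(const w z xw wz zy) [x [Ax xw']] := Bz; exists x; split=> //; ord.
exists y0; split=> [x Ax xy|j yj].
  case: (between2 dM xy zy) => w [wj wz xw]; apply: Bz; apply/(const z w) => //.
  by exists x.
by case: By0 => x [Ax ?]; exists x; split=> //; ord.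
Qed.

(** Definable completeness; the case of suprema reduces to the infimum of the set
    of upper bounds. *)
Lemma definable_inf b A a c : dset1 A -> A a -> (forall x, A x -> ordb b c x) ->
  exists i, (forall x, A x -> ~ ordb b x i) /\
    forall j, ordb b i j -> exists x, A x /\ ordb b x j.
Proof.
case: b => /=; first exact: definable_inf_lt.
move=> hA Aa up.
pose U y := forall x, A x -> lt x y.
have hU : dset1 U by rewrite /U; def_tac.
have [i [h1 h2]] := definable_inf_lt hU up (fun u (h : U u) => h a Aa).
exists i; split=> [x Ax ix|j ji].
  by have [u [Uu ux]] := h2 x ix; have := Uu x Ax; ord.
case: (pselect (exists x, A x /\ lt j x)) => // none.
case: (lt_dense dM ji) => j' [jj' ji']; case: (h1 j' _ ji') => x Ax.
have nj : ~ lt j x by move=> ?; apply: none; exists x.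
ord.
Qed.

End Line.

(** * The monotonicity theorem *)

(** Order reasoning when the directions of the orders are parameters.  The case
    analysis on the directions requires that nothing else in the context depends
    on them. *)
Ltac ordd :=
  intros;
  repeat match goal with
  | H : ?T |- _ =>
      lazymatch T with
      | ordb _ _ _ => fail
      | ~ ordb _ _ _ => fail
      | lt _ _ => fail
      | ~ lt _ _ => fail
      | _ = _ => fail
      | dlo_without_endpoints _ => fail
      | _ => clear H
      end
  end;
  repeat match goal with b : bool |- _ => destruct b end;
  cbv beta iota delta [ordb negb] in *; ord.

Section Monotonicity.
Variables (L : language) (M : structure L).
Hypothesis om : ominimal M.
Let dM := om.1.
Implicit Types (x y z l u : M) (b c : bool).

Lemma ordb_total b x y : [\/ ordb b x y, x = y | ordb b y x].
Proof.
by case: b; case: (lt_total dM x y) => h; [apply: Or31|apply: Or32|apply: Or33|apply: Or33|apply: Or32|apply: Or31].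
Qed.

Lemma ordb_dense b x y : ordb b x y -> exists z, ordb b x z /\ ordb b z y.
Proof. by case: b => /= /(lt_dense dM) [z [? ?]]; exists z. Qed.

Lemma ordb_between b x y z : ordb b x z -> ordb b y z ->
  exists w, [/\ ordb b x w, ordb b y w & ordb b w z].
Proof.
by case: b => /= h1 h2; [case: (between2 dM h1 h2)|case: (between2' dM h1 h2)] => w [? ? ?]; exists w.
Qed.

Lemma ordb_between' b x y z : ordb b z x -> ordb b z y ->
  exists w, [/\ ordb b w x, ordb b w y & ordb b z w].
Proof.
by case: b => /= h1 h2; [case: (between2' dM h1 h2)|case: (between2 dM h1 h2)] => w [? ? ?]; exists w.
Qed.

Lemma ordb_max b x y z : ordb b x z -> ordb b y z ->
  exists w, [/\ ~ ordb b w x, ~ ordb b w y & ordb b w z].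
Proof. by move=> h1 h2; case: (ordb_between h1 h2) => w [? ? ?]; exists w; split=> //; ordd. Qed.

Lemma germ_left b (A : set M) a : dset1 A -> exists s, ordb b s a /\
  ((forall x, ordb b s x -> ordb b x a -> A x) \/
   (forall x, ordb b s x -> ordb b x a -> ~ A x)).
Proof.
move=> /(germ om (~~ b) a) [s]; case: b => /= -[h1 h2]; exists s; split=> //;
  by case: h2 => h2; [left|right] => *; apply: h2.
Qed.

(** The infimum of the points after which [Q] holds up to [u] is one of them. *)
Lemma threshold b (Q : set M) e u w : dset1 Q -> ordb b e u -> ordb b w u ->
  (forall y, ordb b w y -> ordb b y u -> Q y) ->
  exists i, [/\ ~ ordb b i e, ordb b i u, forall y, ordb b i y -> ordb b y u -> Q y
    & forall d, ~ ordb b d e -> ordb b d i -> exists y, [/\ ordb b d y, ordb b y u & ~ Q y]].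
Proof.
move=> hQ eu wu Qw.
pose S d := [/\ ~ ordb b d e, ordb b d u & forall y, ordb b d y -> ordb b y u -> Q y].
have hS : dset1 S by rewrite /S /ordb; case: b {eu wu Qw S}; def_tac.
have [a0 ae] : exists a0, ordb b a0 e.
  by case: b {eu wu Qw S hS}; [case: (lt_below dM e)|case: (lt_above dM e)] => a0 ?; exists a0.
have [v [v1 v2 v3]] := ordb_max eu wu.
have Sv : S v by split=> // y vy yu; apply: Qw => //; ordd.
have lo x : S x -> ordb b a0 x by move=> [xe _ _]; ordd.
have [i [h1 h2]] := definable_inf om hS Sv lo.
have ie : ~ ordb b i e by move=> /h2 [x [[xe _ _] ?]].
exists i; split=> //.
- by have := h1 v Sv; ordd.
- by move=> y iy yu; case: (h2 y iy) => x [[_ _ h] xy]; apply: h.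
- move=> d de di; apply: contrapT => no; apply: (h1 d) => //; split=> //.
    by have := h1 v Sv; ordd.
  by move=> y dy yu; apply: contrapT => nQ; apply: no; exists y.
Qed.

Definition near1 x : set_system M := fun P =>
  exists s t, [/\ lt s x, lt x t & forall y, lt s y -> lt y t -> P y].

Variable f : M -> M.
Hypothesis hf : dfun1 f.

Definition injective_on l u := forall x y, lt l x -> lt x u -> lt l y -> lt y u ->
  f x = f y -> x = y.

(** [x] is a strict local minimum of [f] for the order [ordb c]. *)
Definition extremal c x := exists s t, [/\ lt s x, lt x t &
  forall y, lt s y -> lt y t -> y <> x -> ordb c (f x) (f y)].

(** The values before [v] exceed those after [v], before meaning before for
    [ordb b] and exceed meaning for [ordb c]. *)
Definition jump b c v := exists s t, [/\ ordb b s v, ordb b v t &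
  forall x y, ordb b s x -> ordb b x v -> ordb b v y -> ordb b y t -> ordb c (f y) (f x)].

(** Close to [u], every value is undercut by a later one, for [f] cannot increase on
    an interval of local minima.  Hence the values close to [u] lie below [f e],
    for every [e]: otherwise a value that is never undercut would precede the
    final segment on which [f] exceeds [f e].  The first point from which on the
    values lie below [f e] comes after [e], and [f] jumps there; so the jumps
    accumulate at [u]. *)
Lemma extremal_jump b c l u : ordb b l u ->
  (forall x y, ordb b l x -> ordb b x u -> ordb b l y -> ordb b y u -> f x = f y -> x = y) ->
  (forall x, ordb b l x -> ordb b x u -> extremal c x) ->
  exists w, [/\ ordb b l w, ordb b w u & forall v, ordb b w v -> ordb b v u -> jump b c v].
Proof.
move=> lu inj ext.
have ext' x : ordb b l x -> ordb b x u -> exists s t, [/\ ordb b s x, ordb b x t &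
    forall y, ordb b s y -> ordb b y t -> y <> x -> ordb c (f x) (f y)].
  move=> h1 h2; case: (ext x h1 h2) => s [t [sx xt h]].
  case: b {lu inj ext h1 h2}; [exists s, t|exists t, s]; split=> // y h1 h2; exact: h.
have cmp x y : ordb b l x -> ordb b x u -> ordb b l y -> ordb b y u -> x <> y ->
    ~ ordb c (f x) (f y) -> ordb c (f y) (f x).
  by move=> h1 h2 h3 h4 ne; case: (ordb_total c (f x) (f y)) => // e _; case: ne; apply: inj.
pose B x := forall y, ordb b l y -> ordb b y u -> ordb b x y -> ordb c (f x) (f y).
have hB : dset1 B.
  by rewrite /B /ordb; case: b {lu inj ext B ext' cmp}; case: c; def_tac.
have [w0 [w0u [allB|nB]]] := germ_left b u hB.
  have [w [h1 h2 h3]] := ordb_max lu w0u.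
  have [y [wy yu]] := ordb_dense h3.
  have [|s [t [sy yt h]]] := ext' y _ yu; first by ordd.
  have [x [wx sx xy]] := ordb_between wy sy.
  have Bx : B x by apply: allB; ordd.
  have yx : ordb c (f y) (f x) by apply: h; ordd.
  have xy' : ordb c (f x) (f y) by apply: Bx => //; ordd.
  by exfalso; ordd.
have [w1 [h1 h2 w1u]] := ordb_max lu w0u.
have drop x : ordb b w1 x -> ordb b x u -> exists y, [/\ ordb b x y, ordb b y u & ordb c (f y) (f x)].
  move=> wx xu; have /existsNP [y] : ~ B x by apply: nB => //; ordd.
  move=> /not_implyP [ly /not_implyP [yu /not_implyP [xy n]]]; exists y; split=> //.
  apply: cmp => //; first by ordd.
  by move=> e; subst y; ordd.
have low e : ordb b w1 e -> ordb b e u -> exists w, ordb b w u /\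
    forall y, ordb b w y -> ordb b y u -> ordb c (f y) (f e).
  move=> we eu.
  have hA : dset1 (fun y => ordb c (f y) (f e)).
    by rewrite /ordb; clear -hf; case: c; def_tac.
  have [w [wu [h|h]]] := germ_left b u hA; first by exists w.
  exfalso; have hQ : dset1 (fun y => ordb c (f e) (f y)).
    by rewrite /ordb; clear -hf; case: c; def_tac.
  have [w' [k1 k2 w'u]] := ordb_max wu eu.
  have [|i [ie iu Qi no]] := threshold hQ eu w'u.
    move=> y wy yu; apply: cmp => //.
    - by ordd.
    - by ordd.
    - by move=> e'; subst y; ordd.
    - by apply: h => //; ordd.
  have w1i : ordb b w1 i by ordd.
  have li : ordb b l i by ordd.
  have fi : ~ ordb c (f e) (f i).
    move=> ei; have e_i : ordb b e i.
      case: (ordb_total b e i) => // e'; exfalso.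
      by rewrite e' in ei; ordd.
    have [s [t [si it hst]]] := ext' i li iu.
    have [d [ed sd di]] := ordb_between e_i si.
    have [||y [dy yu nQ]] := no d => //; first by ordd.
    apply: nQ; case: (ordb_total b y i) => [yi|->|iy] //; last exact: Qi.
    have : ordb c (f i) (f y).
      apply: hst; [ordd|ordd|].
      by move=> e'; subst; ordd.
    by ordd.
  have [y [iy yu yi]] := drop i w1i iu.
  have := Qi y iy yu; ordd.
have later e : ordb b w1 e -> ordb b e u -> exists v, [/\ ordb b e v, ordb b v u & jump b c v].
  move=> we eu; have [w [wu hw]] := low e we eu.
  have le : ordb b l e by ordd.
  have hA : dset1 (fun y => ordb c (f y) (f e)).
    by rewrite /ordb; clear -hf; case: c; def_tac.
  have [i [ie iu Qi no]] := threshold hA eu wu hw.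
  have e_i : ordb b e i.
    case: (ordb_total b e i) => // e'; exfalso.
    subst i; have [s [t [si it hst]]] := ext' e le eu.
    have [y [k1 k2 k3]] := ordb_between' it eu.
    have : ordb c (f e) (f y).
      apply: hst => //; first by ordd.
      by move=> e'; subst; ordd.
    have := Qi y k3 k2; ordd.
  have li : ordb b l i by ordd.
  exists i; split=> //.
  have [s [si hs]] := germ_left b i hA.
  case: hs => hs.
    exfalso; have [d [ed sd di]] := ordb_between e_i si.
    have [||y [dy yu nQ]] := no d => //; first by ordd.
    apply: nQ; case: (ordb_total b y i) => [yi|->|iy]; last exact: Qi.
      by apply: hs => //; ordd.
    have [s' [t' [si' it' hst]]] := ext' i li iu.
    have [z [k1 k2 k3]] := ordb_between' it' iu.
    have : ordb c (f i) (f z).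
      apply: hst => //; first by ordd.
      by move=> e'; subst; ordd.
    by have := Qi z k3 k2; ordd.
  have [s' [k1 k2 s'i]] := ordb_max si e_i.
  exists s', u; split=> // x y sx xi iy yu.
  have := Qi y iy yu; have : ordb c (f e) (f x).
    apply: cmp => //.
    - by ordd.
    - by ordd.
    - by clear -dM sx k2 ; move=> e'; subst; ordd.
    - by apply: hs => //; ordd.
  by ordd.
have hJ : dset1 (jump b c).
  by rewrite /jump /ordb; clear -hf; case: b; case: c; def_tac.
have [w [wu [h|h]]] := germ_left b u hJ.
  have [w' [k1 k2 k3]] := ordb_max wu w1u; have [w'' [k4 k5]] := ordb_dense k3.
  exists w''; split=> //; first by ordd.
  by move=> v wv vu; apply: h => //; ordd.
have [e [k1 k2 k3]] := ordb_between wu w1u.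
have [v [ev vu jv]] := later e k2 k3.
by exfalso; apply: (h v) => //; ordd.
Qed.

(** Reading the interval in the two directions, [f] would jump down and jump up
    at the same point. *)
Lemma no_interval_extremal c l u : lt l u -> injective_on l u ->
  ~ (forall x, lt l x -> lt x u -> extremal c x).
Proof.
move=> lu inj ext.
have [w [lw wu J1]] : exists w, [/\ ordb true l w, ordb true w u &
    forall v, ordb true w v -> ordb true v u -> jump true c v].
  by apply: extremal_jump => // x y lx xu ly yu; apply: inj.
rewrite /= in lw wu.
have [w' [uw' w'w J2]] : exists w', [/\ ordb false u w', ordb false w' w &
    forall v, ordb false w' v -> ordb false v w -> jump false c v].
  apply: extremal_jump => //= [x y xu wx yu wy|x xu wx].
    by apply: inj; ord.
  by apply: ext; ord.
rewrite /= in uw' w'w.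
case: (lt_dense dM w'w) => v [wv vw'].
have [|s [t [sv vt h1]]] := J1 v wv; first by rewrite /=; ord.
have [||s' [t' [s'v vt' h2]]] := J2 v; [by []|by []|].
rewrite /= in sv vt s'v vt'.
have [x [sx t'x xv]] := between2 dM sv vt'.
have [y [ty s'y vy]] := between2' dM vt s'v.
have a := h1 x y sx xv vy ty.
by have := h2 y x s'y vy xv t'x; ordd.
Qed.

Definition strictly_monotone c l u :=
  forall x y, lt l x -> lt x y -> lt y u -> ordb c (f x) (f y).

Definition rises_right c x := exists t, lt x t /\ forall y, lt x y -> lt y t -> ordb c (f x) (f y).
Definition rises_left c x := exists s, lt s x /\ forall y, lt s y -> lt y x -> ordb c (f x) (f y).

(** At the infimum [i] of the points where [f] fails to exceed [f x], the
    behaviour on the left of [i] gives that [f i] exceeds [f x], and the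
    behaviour on its right contradicts the choice of [i]. *)
Lemma monotone_of_local c l u :
  (forall x, lt l x -> lt x u -> rises_right c x) ->
  (forall x, lt l x -> lt x u -> rises_left (~~ c) x) -> strictly_monotone c l u.
Proof.
move=> hr hl x y lx xy yu; apply: contrapT => nxy.
pose S z := [/\ lt x z, lt z u & ~ ordb c (f x) (f z)].
have hS : dset1 S.
  by rewrite /S /ordb; clear -hf; case: c; def_tac.
have Sy : S y by split.
have [|i [h1 h2]] := definable_inf om (b := true) hS Sy (c := x); first by move=> z [].
rewrite /= in h1 h2.
have xu : lt x u by ord.
have [t [xt ht]] := hr x lx xu.
have x_i : lt x i.
  case: (lt_total dM x i) => // [e|ix].
    by subst i; have [z [[xz zu n] zt]] := h2 t xt; case: n; apply: ht.
  by have [z [[xz _ _] zx]] := h2 x ix; ord.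
have iu : lt i u by have := h1 y Sy; ord.
have li : lt l i by ord.
have below z : lt x z -> lt z i -> ordb c (f x) (f z).
  by move=> xz zi; apply: contrapT => n; apply: (h1 z) => //; split=> //; ord.
have fi : ordb c (f x) (f i).
  have [s [si hs]] := hl i li iu.
  have [z [sz xz zi]] := between2 dM si x_i.
  have := hs z sz zi; have := below z xz zi; ordd.
have [t' [it' ht']] := hr i li iu.
have [z [[xz zu n] zt]] := h2 t' it'.
case: (lt_total dM z i) => zi; [exact: n (below z xz zi)|by subst|].
apply: n; have := ht' z zi zt; ordd.
Qed.

(** On a subinterval, the sides on which [f] lies above [f x] close to [x] do not
    depend on [x]; if they agree, all the points are local extrema. *)
Lemma monotone_subinterval l u : lt l u -> injective_on l u ->
  exists c l' u', [/\ ~ lt l' l, ~ lt u u', lt l' u' & strictly_monotone c l' u'].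
Proof.
move=> lu inj.
have hR : dset1 (rises_right true) by rewrite /rises_right /=; def_tac.
have hL : dset1 (rises_left true) by rewrite /rises_left /=; def_tac.
have [l1 [u1 [a1 b1 lu1 cR]]] := split_interval om hR lu.
have [l2 [u2 [a2 b2 lu2 cL]]] := split_interval om hL lu1.
have inj2 : injective_on l2 u2 by move=> x y ? ? ? ?; apply: inj; ord.
have opp x y : lt l2 x -> lt x u2 -> lt l2 y -> lt y u2 -> x <> y -> ~ lt (f x) (f y) -> lt (f y) (f x).
  by move=> k1 k2 k3 k4 ne n; case: (lt_total dM (f x) (f y)) => // e; case: ne; apply: inj2.
have noR x : lt l2 x -> lt x u2 -> ~ rises_right true x -> rises_right false x.
  move=> lx xu n; have hA : dset1 (fun y => lt (f x) (f y)).
    by def_tac.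
  have [s /= [xs [h|h]]] := germ om true x hA; first by case: n; exists s.
  have [t [ts tu xt]] := between2' dM xs xu.
  exists t; split=> // y xy yt; apply: opp => //; try by ord.
  by apply: h; ord.
have noL x : lt l2 x -> lt x u2 -> ~ rises_left true x -> rises_left false x.
  move=> lx xu n; have hA : dset1 (fun y => lt (f x) (f y)).
    by def_tac.
  have [s /= [xs [h|h]]] := germ_left true x hA; first by case: n; exists s.
  have [t [ts tu xt]] := between2 dM xs lx.
  exists t; split=> // y xy yt; apply: opp => //; try by ord.
  by apply: h; ord.
have ext c x : rises_right c x -> rises_left c x -> extremal c x.
  move=> [t [xt ht]] [s [sx hs]]; exists s, t; split=> // y sy yt yx.
  by case: (lt_total dM x y) => h; [apply: ht|case: yx|apply: hs].
case: cR => cR; case: cL => cL.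
- by case: (no_interval_extremal (c := true) lu2 inj2) => x lx xu; apply: ext; [apply: cR; ord|apply: cL].
- exists true, l2, u2; split; [ord|ord|by []|].
  apply: monotone_of_local => x lx xu; [apply: cR; ord|apply: noL => //; exact: cL].
- exists false, l2, u2; split; [ord|ord|by []|].
  apply: monotone_of_local => x lx xu; [apply: noR => //; apply: cR; ord|exact: cL].
- case: (no_interval_extremal (c := false) lu2 inj2) => x lx xu.
  by apply: ext; [apply: noR => //; apply: cR; ord|apply: noL => //; apply: cL].
Qed.

Lemma constant_of_fin_image l u (V : set M) : lt l u -> fin V ->
  (forall x, lt l x -> lt x u -> V (f x)) ->
  exists l' u' y, [/\ ~ lt l' l, ~ lt u u', lt l' u' & forall x, lt l' x -> lt x u' -> f x = y].
Proof.
move=> lu [k]; elim: k V l u lu => [|k IH] V l u lu /=.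
  by move=> nV h; case: (lt_dense dM lu) => x [lx xu]; case: (nV (f x)); apply: h.
move=> [y [Vy my ck]] h.
have hA : dset1 (fun x => f x = y) by def_tac.
have [l1 [u1 [a1 b1 lu1 [c1|c1]]]] := split_interval om hA lu; first by exists l1, u1, y.
have [|l2 [u2 [z [a2 b2 lu2 hz]]]] := IH _ l1 u1 lu1 ck.
  move=> x lx xu; have Vf : V (f x) by apply: h; ord.
  by split=> //; case: (lt_total dM y (f x)) => // e; [case: (c1 x lx xu)|case: (my _ Vf)].
by exists l2, u2, z; split=> //; ord.
Qed.

Lemma fin_image (A : set M) : fin A -> fin [set y | exists2 x, A x & y = f x].
Proof.
move=> [k]; elim: k A => [|k IH] A.
  by move=> h; exists 0 => y [x /h].
move=> [x [Ax mx /IH hk]]; apply: (fin_sub dM (fin_add dM (f x) hk)) => y /= [x' Ax' ->].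
case: (lt_total dM x x') => h; [by left; exists x'|by subst; right|].
by case: (mx x' Ax').
Qed.

(** Unless [f] is constant on an interval its fibres are finite, and it takes all
    its values on the set [A] of their least elements, where it is injective.  If
    [A] contains no interval then it is finite, and so is the image of [f]. *)
Lemma constant_or_injective l u : lt l u -> exists l' u', [/\ ~ lt l' l, ~ lt u u', lt l' u' &
  (exists y, forall x, lt l' x -> lt x u' -> f x = y) \/ injective_on l' u'].
Proof.
move=> lu.
case: (pselect (exists l1 u1, [/\ ~ lt l1 l, ~ lt u u1, lt l1 u1 &
    exists y, forall x, lt l1 x -> lt x u1 -> f x = y])) => [[l1 [u1 [? ? ? ?]]]|nc].
  by exists l1, u1; split=> //; left.
pose A x := [/\ lt l x, lt x u & forall x', lt l x' -> lt x' x -> f x' <> f x].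
have hA : dset1 A by rewrite /A; def_tac.
have sub (B : set M) l1 u1 : lt l1 u1 -> (forall x, B x -> lt l x /\ lt x u) ->
    (forall x, lt l1 x -> lt x u1 -> B x) -> ~ lt l1 l /\ ~ lt u u1.
  move=> lu1 h1 h2; split=> h.
    have [x [k1 k2 k3]] := between2' dM h lu1; have [? ?] := h1 x (h2 x k3 k2); ord.
  have [x [k1 k2 k3]] := between2 dM h lu1; have [? ?] := h1 x (h2 x k2 k3); ord.
case: (fin_or_interval om hA) => [fA|[l1 [u1 [lu1 h1]]]].
  have [|l1 [u1 [y [? ? ? ?]]]] := constant_of_fin_image lu (fin_image fA); last first.
    by case: nc; exists l1, u1; split=> //; exists y.
  move=> x lx xu; pose B x' := [/\ lt l x', lt x' u & f x' = f x].
  have hB : dset1 B by rewrite /B; def_tac.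
  case: (fin_or_interval om hB) => [fB|[l1 [u1 [lu1 h1]]]].
    have [|z [[lz zu fz] mz]] := @fin_min _ _ B x fB; first by split.
    exists z; last by rewrite fz.
    split=> // x' lx' xz e; apply: (mz x') => //; split=> //; first by ord.
    by rewrite e.
  case: nc; exists l1, u1; have [|? ?] := sub B l1 u1 lu1 _ h1; first by move=> ? [].
  by split=> //; exists (f x) => z lz zu; case: (h1 z lz zu).
have [|? ?] := sub A l1 u1 lu1 _ h1; first by move=> ? [].
exists l1, u1; split=> //; right=> x y lx xu ly yu e.
have [ax bx cx] := h1 x lx xu; have [ay cy dy] := h1 y ly yu.
by case: (lt_total dM x y) => // h; [case: (dy x)|case: (cx y)].
Qed.

Definition continuous1 x := forall a d, lt a (f x) -> lt (f x) d ->
  near1 x [set y | lt a (f y) /\ lt (f y) d].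

(** The image of [f] contains an interval, and a monotone bijection between
    intervals is continuous. *)
Lemma monotone_continuous c l u : lt l u -> strictly_monotone c l u ->
  exists l' u', [/\ ~ lt l' l, ~ lt u u', lt l' u' &
    forall x, lt l' x -> lt x u' -> continuous1 x].
Proof.
move=> lu mono.
pose W y := exists x, [/\ lt l x, lt x u & y = f x].
have hW : dset1 W by rewrite /W; def_tac.
have refl x y : lt l x -> lt x u -> lt l y -> lt y u -> ordb c (f x) (f y) -> lt x y.
  move=> lx xu ly yu h; case: (lt_total dM x y) => // e; exfalso.
    by subst; ordd.
  by have := mono y x ly e xu; ordd.
case: (fin_or_interval om hW) => [fW|[r [s [rs hrs]]]].
  have [|l1 [u1 [y [? ? lu1 h1]]]] := constant_of_fin_image lu fW.
    by move=> x lx xu; exists x.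
  have [x1 [k1 k2]] := lt_dense dM lu1; have [x2 [k3 k4]] := lt_dense dM k1.
  have := mono x2 x1 ltac:(ord) k4 ltac:(ord).
  by rewrite !h1 //; [ordd|ord].
have [l1 [u1 [k1 k2 lu1 hlu]]] : exists l1 u1, [/\ ~ lt l1 l, ~ lt u u1, lt l1 u1 &
    forall x, lt l1 x -> lt x u1 -> lt r (f x) /\ lt (f x) s].
  have [r1 [k1 k2]] := lt_dense dM rs; have [s1 [k3 k4]] := lt_dense dM k2.
  have [|x1 [lx1 x1u e1]] := hrs r1 k1; first by ord.
  have [||x2 [lx2 x2u e2]] := hrs s1; [ord|by []|].
  subst r1 s1.
  case: (lt_total dM x1 x2) => x12; [exists x1, x2|by subst; exfalso; ord|exists x2, x1];
    split=> //; try ord; move=> x xx1 xx2.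
    have := mono x1 x lx1 xx1 ltac:(ord); have := mono x x2 ltac:(ord) xx2 x2u.
    by clear -dM k1 k3 k4; case: c => /= ? ?; split; ord.
  have := mono x2 x lx2 xx1 ltac:(ord); have := mono x x1 ltac:(ord) xx2 x1u.
  by clear -dM k1 k3 k4; case: c => /= ? ?; split; ord.
exists l1, u1; split=> // x lx xu a d afx fxd.
have [rfx fxs] := hlu x lx xu.
have [y1 [ay1 ry1 y1f]] := between2 dM afx rfx.
have [y2 [dy2 sy2 y2f]] := between2' dM fxd fxs.
have [|x1 [lx1 x1u e1]] := hrs y1 ry1; first by ord.
have [||x2 [lx2 x2u e2]] := hrs y2; [ord|by []|].
subst y1 y2.
have lx' : lt l x by ord.
have xu' : lt x u by ord.
case: c mono refl => /= mono refl; [exists x1, x2|exists x2, x1]; split; try (exact: refl);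
  move=> y h1 h2; rewrite /mkset.
  have p1 := mono x1 y lx1 h1 ltac:(ord); have p2 := mono y x2 ltac:(ord) h2 x2u.
  by split; ordd.
have p1 := mono x2 y lx2 h1 ltac:(ord); have p2 := mono y x1 ltac:(ord) h2 x1u.
by split; ordd.
Qed.

(** Weak monotonicity, in a form that does not mention the direction. *)
Definition monotone l u := forall x y z, lt l x -> lt x y -> lt y z -> lt z u ->
  ~ (lt (f y) (f x) /\ lt (f y) (f z)) /\ ~ (lt (f x) (f y) /\ lt (f z) (f y)).

Theorem monotonicity l u : lt l u -> exists l' u', [/\ ~ lt l' l, ~ lt u u', lt l' u' &
  monotone l' u' /\ forall x, lt l' x -> lt x u' -> continuous1 x].
Proof.
move=> lu; have [l1 [u1 [k1 k2 lu1 [[y0 cst]|inj]]]] := constant_or_injective lu.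
  exists l1, u1; split=> //; split.
    move=> x y z lx xy yz zu; rewrite !cst //; try ord.
    by split=> -[]; ord.
  move=> x lx xu a d; rewrite cst // => ay yb; exists l1, u1; split=> // y ly yu.
  by rewrite /mkset cst.
have [c [l2 [u2 [k3 k4 lu2 mono]]]] := monotone_subinterval lu1 inj.
have [l3 [u3 [k5 k6 lu3 cont]]] := monotone_continuous lu2 mono.
exists l3, u3; split=> //; [ord|ord|split=> // x y z lx xy yz zu].
have := mono x y ltac:(ord) xy ltac:(ord); have := mono y z ltac:(ord) yz ltac:(ord).
by clear -dM; case: c => /= ? ?; split=> -[? ?]; ord.
Qed.

End Monotonicity.

(** * Generic continuity of finite fibres over a line *)

Definition fibre (T : Type) n (X : set ('I_n.+1 -> T)) (x : 'I_n -> T) : set T :=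
  [set y | X (snoc x y)].

Section GenericFibres.
Variables (L : language) (M : structure L).
Hypothesis om : ominimal M.
Let dM := om.1.
Implicit Types (x y z l u : M) (b : bool).

#[local] Instance near1_filter x : Filter (near1 x).
Proof.
split.
- by case: (lt_below dM x) (lt_above dM x) => s ? [t ?]; exists s, t.
- move=> P Q [s [t [sx xt hP]]] [s' [t' [s'x xt' hQ]]].
  have [a [? ? ?]] := between2 dM sx s'x; have [c [? ? ?]] := between2' dM xt xt'.
  by exists a, c; split=> // y ay yc; split; [apply: hP|apply: hQ]; ord.
- by move=> P Q PQ [s [t [sx xt hP]]]; exists s, t; split=> // y sy yt; apply/PQ/hP.
Qed.

Lemma near1_itv x l u : lt l x -> lt x u -> near1 x [set y | lt l y /\ lt y u].
Proof. by move=> lx xu; exists l, u; split. Qed.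

Lemma near1_self x (P : set M) : near1 x P -> P x.
Proof. by move=> [s [t [? ? h]]]; apply: h. Qed.

Lemma dfun_of_rel n (R : set ('I_n.+1 -> M)) : dset R ->
  (forall (x : 'I_n -> M) y z, fibre R x y -> fibre R x z -> y = z) ->
  exists f, dfun f /\ forall (x : 'I_n -> M) y, fibre R x y -> f x = y.
Proof.
move=> hR fn; have [a0] : inhabited M by case: dM.
have /choice [f hf] (x : 'I_n -> M) : exists y, fibre R x y \/ ((~ exists y', fibre R x y') /\ y = a0).
  by case: (pselect (exists y', fibre R x y')) => [[y ?]|?]; [exists y; left|exists a0; right].
exists f; split; last first.
  by move=> x y Rxy; case: (hf x) => [/fn|[[]]]; [apply|exists y].
have hG : dset [set z : 'I_n.+1 -> M | fibre R (init z) (final z) \/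
    ((~ exists y', fibre R (init z) y') /\ final z = a0)].
  by rewrite /fibre; def_tac.
apply: Def_eqv hG => _ x.
split=> [h|e]; last by rewrite /mkset e; apply: hf.
case: (hf (init x)) h => [Rf|[n1 e1]] [Rx|[n2 e2]].
- exact: fn Rx Rf.
- by case: n2; exists (f (init x)).
- by case: n1; exists (final x).
- by rewrite e1 e2.
Qed.

Lemma dfun1_of_rel (R : M -> M -> Prop) : dset2 R ->
  (forall x y z, R x y -> R x z -> y = z) ->
  exists f, dfun1 f /\ forall x y, R x y -> f x = y.
Proof.
move=> hR fn.
have eR (x : 'I_1 -> M) y : fibre (fun z : 'I_2 -> M => R (z ord0) (z ord_max)) x y = R (x ord0) y.
  rewrite /fibre /mkset snoc_max; congr (R _ y).
  by have <- : lift ord_max ord0 = ord0 :> 'I_2; [apply: val_inj|rewrite snoc_lift].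
have [|f [df hf]] := dfun_of_rel hR; first by move=> x y z; rewrite !eR; apply: fn.
exists (fun a => f (fun _ => a)); split; last by move=> x y Rxy; apply: hf; rewrite eR.
apply: Def_eqv df => _ x; suff -> : (fun _ => init x ord0) = init x by [].
by apply: funext => i; rewrite (ord1 i).
Qed.

Lemma continuous1_ordb b (f : M -> M) x a : continuous1 f x -> ordb b (f x) a ->
  near1 x [set x' | ordb b (f x') a].
Proof.
move=> cf; case: b => /= h.
  have [c hc] := lt_below dM (f x).
  by have := cf c a hc h; apply: filterS => ? [].
have [c hc] := lt_above dM (f x).
by have := cf a c h hc; apply: filterS => ? [].
Qed.

Lemma continuous1_ordb' b (f : M -> M) x a : continuous1 f x -> ordb b a (f x) ->
  near1 x [set x' | ordb b a (f x')].
Proof. by move=> cf; have := @continuous1_ordb (~~ b) f x a cf; case: b. Qed.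

Lemma generic_function (R : M -> M -> Prop) l u : dset2 R ->
  (forall x y z, R x y -> R x z -> y = z) -> lt l u ->
  (forall x, lt l x -> lt x u -> exists y, R x y) ->
  exists f l' u', [/\ ~ lt l' l, ~ lt u u', lt l' u', dfun1 f &
    forall x, lt l' x -> lt x u' -> R x (f x) /\ continuous1 f x].
Proof.
move=> hR fn lu ex; have [f [df hf]] := dfun1_of_rel hR fn.
have [l' [u' [h1 h2 h3 [_ hc]]]] := monotonicity om df lu.
exists f, l', u'; split=> // x lx xu; split; last exact: hc.
by have [||y Rxy] := ex x; [ord|ord|rewrite (hf _ _ Rxy)].
Qed.

Variable D : M -> M -> Prop.
Hypothesis hD : dset2 D.
Hypothesis finD : forall x, fin (D x).

Definition fibre_min x y := D x y /\ forall y', D x y' -> ~ lt y' y.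
Definition fibre_max x y := D x y /\ forall y', D x y' -> ~ lt y y'.

(** Near [x], the set [D] is close to [(x, z)] either empty, or the graph of a
    partial function which has points arbitrarily close to [z]. *)
Definition normal x z :=
  ((exists a c, [/\ lt a z, lt z c & near1 x [set x' | forall y y', D x' y -> D x' y' ->
      lt a y -> lt y c -> lt a y' -> lt y' c -> y = y']]) /\
   forall a c, lt a z -> lt z c -> near1 x [set x' | exists y, [/\ D x' y, lt a y & lt y c]]) \/
  (exists a c, [/\ lt a z, lt z c & near1 x [set x' | forall y, D x' y -> lt a y -> ~ lt y c]]).

(** So that the exceptional points over [x], when they exist, have a least one. *)
Lemma normal_open x z : normal x z -> exists a c, [/\ lt a z, lt z c &
  forall z', lt a z' -> lt z' c -> normal x z'].
Proof.
move=> n; case: (n) => [[[a [c [az zc hU]]] hE]|[a [c [az zc hN]]]]; last first.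
  by exists a, c; split=> // z' ? ?; right; exists a, c.
exists a, c; split=> // z' az' z'c; case: (lt_total dM z z') => h; last 2 first.
- by subst.
- have [w [z'w wz]] := lt_dense dM h.
  right; exists a, w; split=> //.
  apply: filterS2 hU (hE w c wz zc) => x' hU [y [Dy wy yc]] y' Dy' ay' y'w.
  have e : y = y' by apply: hU => //; ord.
  by subst; ord.
have [w [zw wz']] := lt_dense dM h.
right; exists w, c; split=> //.
apply: filterS2 hU (hE a w az zw) => x' hU [y [Dy ay yw]] y' Dy' wy' y'c.
have e : y = y' by apply: hU => //; ord.
by subst; ord.
Qed.

Lemma normal_fibre x z : normal x z -> D x z -> exists a c, [/\ lt a z, lt z c &
  near1 x [set x' | forall y y', D x' y -> D x' y' ->
      lt a y -> lt y c -> lt a y' -> lt y' c -> y = y']].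
Proof.
move=> [[]//|[a [c [az zc /near1_self h]]]] Dz.
by case: (h z Dz).
Qed.

(** The closest point of [D] on the given side of [h x], when it exists on a
    subinterval, is a continuous function of [x] there. *)
Lemma generic_guard b (h : M -> M) l u : dfun1 h -> lt l u ->
  (forall x, lt l x -> lt x u -> continuous1 h x) ->
  exists l' u', [/\ ~ lt l' l, ~ lt u u', lt l' u' &
    forall x, lt l' x -> lt x u' -> exists a, ordb b a (h x) /\
      near1 x [set x' | forall y, D x' y -> ordb b a y -> ~ ordb b y (h x')]].
Proof.
move=> dh lu hc.
pose E x := exists y, D x y /\ ordb b y (h x).
have hE : dset1 E by rewrite /E /ordb; case: (b); def_tac.
have [l1 [u1 [k1 k2 lu1 [pos|neg]]]] := split_interval om hE lu; last first.
  exists l1, u1; split=> // x lx xu.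
  have [a ax] : exists a, ordb b a (h x).
    by case: b {E hE neg}; [case: (lt_below dM (h x))|case: (lt_above dM (h x))] => a; exists a.
  exists a; split=> //; apply: filterS (near1_itv lx xu) => x' [lx' x'u] y Dy _ yh.
  by apply: (neg x') => //; exists y.
pose R x y := [/\ D x y, ordb b y (h x) & forall y', D x y' -> ordb b y' (h x) -> ~ ordb b y y'].
have hR : dset2 R by rewrite /R /ordb; case: (b); def_tac.
have [||f [l2 [u2 [k3 k4 lu2 _ hf]]]] := @generic_function R l1 u1 hR _ lu1.
- move=> x y z [Dy yh my] [Dz zh mz].
  by have := my z Dz zh; have := mz y Dy yh; ordd.
- move=> x lx xu; have [y [Dy yh]] := pos x lx xu.
  pose A y := D x y /\ ordb b y (h x).
  have fA : fin A by apply: (fin_sub dM) (finD x) _ => ? [].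
  rewrite /R; case: b @A fA yh {pos hR R hE E} => /= fA yh.
    have [z [[Dz zh] mz]] := fin_max dM fA (conj Dy yh).
    by exists z; split=> // y' Dy' y'h; apply: mz.
  have [z [[Dz zh] mz]] := fin_min fA (conj Dy yh).
  by exists z; split=> // y' Dy' y'h; apply: mz.
exists l2, u2; split=> //; [ord|ord|move=> x lx xu].
have [[Df fh mf] cf] := hf x lx xu.
have ch : continuous1 h x by apply: hc; ord.
have [a [fa ah]] : exists a, ordb b (f x) a /\ ordb b a (h x).
  by case: b fh {mf hf hR R pos hE E} => /= /(lt_dense dM) [a [? ?]]; exists a.
exists a; split=> //.
have nf : near1 x [set x' | ordb b (f x') a].
  exact: continuous1_ordb cf fa.
have nl := near1_itv lx xu.
apply: filterS2 nf nl => x' /= fa' [lx' x'u] y Dy ay yh.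
have [[Df' fh' mf'] _] := hf x' lx' x'u.
by apply: (mf' y Dy yh); ordd.
Qed.

Lemma hNormal : dset2 (fun x z => normal x z).
Proof. by rewrite /normal /near1; def_tac. Qed.

(** The first exceptional point of the fibre over [x] would move continuously
    with [x], separated from the rest of [D]: a contradiction. *)
Lemma generic_normal l u : lt l u ->
  (forall x, lt l x -> lt x u -> exists y, D x y) ->
  exists l' u', [/\ ~ lt l' l, ~ lt u u', lt l' u' &
    forall x z, lt l' x -> lt x u' -> normal x z].
Proof.
move=> lu ne.
have hMin : dset2 fibre_min by rewrite /fibre_min; def_tac.
have hN : dset2 (fun x z => normal x z) := hNormal.
have hA : dset1 (fun x => exists z, ~ normal x z).
  by def_tac.
have [||f [l1 [u1 [k1 k2 lu1 _ hf]]]] := @generic_function fibre_min l u hMin _ lu.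
- by move=> x y z [Dy my] [Dz mz]; have := my z Dz; have := mz y Dy; ord.
- by move=> x lx xu; have [y Dy] := ne x lx xu; apply: fin_min (finD x) Dy.
have [l2 [u2 [k3 k4 lu2 [bad|good]]]] := split_interval om hA lu1; last first.
  exists l2, u2; split=> //; [ord|ord|move=> x z lx xu].
  by apply: contrapT => n; apply: (good x lx xu); exists z.
exfalso.
pose R x y := ~ normal x y /\ forall y', ~ normal x y' -> ~ lt y' y.
have hR : dset2 R by rewrite /R; def_tac.
have [||beta [l3 [u3 [k5 k6 lu3 db hb]]]] := @generic_function R l2 u2 hR _ lu2.
- by move=> x y z [Dy my] [Dz mz]; have := my z Dz; have := mz y Dy; ord.
- move=> x lx xu; have [z nz] := bad x lx xu.
  have hS : dset1 (fun z => ~ normal x z) by def_tac.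
  have [[Df mf] cf] : fibre_min x (f x) /\ continuous1 f x by apply: hf; ord.
  have [c cf0] := lt_below dM (f x).
  have lo z' : ~ normal x z' -> lt c z'.
    move=> n; case: (pselect (lt c z')) => // cz; case: n; right.
    have z'f : lt z' (f x) by ord.
    have [e [z'e ef]] := lt_dense dM z'f; have [a az'] := lt_below dM z'.
    exists a, e; split=> //.
    have x1 : near1 x [set y | lt l1 y /\ lt y u1] by apply: near1_itv; ord.
    have := continuous1_ordb' (b := true) cf ef.
    apply: filterS2 x1 => x' [lx' x'u] /= ef' y Dy _ ye.
    by have [[_ mf'] _] := hf x' lx' x'u; have := mf' y Dy; ord.
  have [i [h1 h2]] := definable_inf om (b := true) hS nz lo.
  exists i; split=> //= ni; have [a [e [ai ie hae]]] := normal_open ni.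
  have [z' [nz' z'e]] := h2 e ie; apply: (nz'); apply: hae => //.
  by have := h1 z' nz'; rewrite /=; ord.
have cb x : lt l3 x -> lt x u3 -> continuous1 beta x by move=> lx xu; case: (hb x lx xu).
have [l4 [u4 [k7 k8 lu4 gl]]] := generic_guard true db lu3 cb.
have [|l5 [u5 [k9 k10 lu5 gr]]] := generic_guard false db lu4.
  by move=> x lx xu; apply: cb; ord.
have hDb : dset1 (fun x => D x (beta x)) by def_tac.
have [l6 [u6 [k11 k12 lu6 on]]] := split_interval om hDb lu5.
have [x [lx xu]] := lt_dense dM lu6.
have [[nb _] cx] : R x (beta x) /\ continuous1 beta x by apply: hb; ord.
have [||a /= [ab ga]] := gl x; [ord|ord|].
have [||c /= [bc gc]] := gr x; [ord|ord|].
apply: nb.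
have nx := near1_itv lx xu.
case: on => on; [left|right]; last first.
  exists a, c; split=> //.
  apply: filterS3 ga gc nx => x' ga gc [lx' x'u] y Dy ay yc.
  case: (lt_total dM y (beta x')) => h; [exact: ga h|by subst; apply: (on x')|exact: gc h].
split.
  exists a, c; split=> //.
  have eqb : near1 x [set x' | forall y, D x' y -> lt a y -> lt y c -> y = beta x'].
    apply: filterS2 ga gc => x' ga gc y Dy ay yc.
    by case: (lt_total dM y (beta x')) => h //; [case: (ga y)|case: (gc y)].
  by apply: filterS eqb => x' eqb y y' ? ? ? ? ? ?; rewrite (eqb y) // (eqb y').
move=> a' c' ab' bc'; apply: filterS2 nx (cx a' c' ab' bc') => x' [lx' x'u] [? ?].
by exists (beta x'); split=> //; apply: on.
Qed.

(** The intervals [(p i, q i)] may overlap; each of them accounts for one point. *)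
Lemma ncard_boxes k (A : set M) (p q : nat -> M) :
  (forall y, A y -> exists2 i, i < k & lt (p i) y /\ lt y (q i)) ->
  (forall i y y', i < k -> A y -> A y' -> lt (p i) y -> lt y (q i) ->
     lt (p i) y' -> lt y' (q i) -> y = y') ->
  exists2 m, m <= k & ncard m A.
Proof.
elim: k A => [|k IH] A cov one.
  by exists 0 => // y /cov [].
have [||m mk cm] := IH [set y | A y /\ ~ (lt (p k) y /\ lt y (q k))].
- move=> y [/cov [i]]; rewrite ltnS leq_eqVlt => /orP [/eqP -> //|ik h _].
  by exists i.
- by move=> i y y' ik [Ay _] [Ay' _]; apply: one => //; apply: ltnW.
case: (pselect (exists y, [/\ A y, lt (p k) y & lt y (q k)])) => [[y [Ay py yq]]|no].
  exists m.+1 => //; have := ncard_add dM cm (b := y).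
  have n : ~ [set y0 | A y0 /\ ~ (lt (p k) y0 /\ lt y0 (q k))] y by move=> [_]; apply.
  move=> /(_ n); apply: ncard_ext => z /=; split; first by move=> [[]|->].
  move=> Az; case: (pselect (lt (p k) z /\ lt z (q k))) => [[pz zq]|?]; last by left.
  by right; apply: (one k).
exists m; first exact: leqW.
apply: ncard_ext cm => z /=; split=> [[]//|Az]; split=> // -[? ?].
by apply: no; exists z.
Qed.

(** Take [x0] such that all the points over it are normal.  To the right of [x0],
    the points of [D] that do not belong to the branches through [D x0] would have
    a least one in each fibre; its limit at [x0] contradicts normality. *)
Lemma generic_bounded l0 u0 : lt l0 u0 -> exists l' u' k, [/\ ~ lt l' l0, ~ lt u0 u', lt l' u' &
  forall x, lt l' x -> lt x u' -> exists2 m, m <= k & ncard m (D x)].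
Proof.
move=> lu0.
have hE : dset1 (fun x => exists y, D x y) by def_tac.
have [l [u [k1 k2 lu [ne|e]]]] := split_interval om hE lu0; last first.
  exists l, u, 0; split=> // x lx xu; exists 0 => // y Dy.
  by apply: (e x) => //; exists y.
have hMin : dset2 fibre_min by rewrite /fibre_min; def_tac.
have hMax : dset2 fibre_max by rewrite /fibre_max; def_tac.
have [||f [l1 [u1 [k3 k4 lu1 _ hf]]]] := @generic_function fibre_min l u hMin _ lu.
- by move=> x y z [Dy my] [Dz mz]; have := my z Dz; have := mz y Dy; ord.
- by move=> x lx xu; have [y Dy] := ne x lx xu; apply: fin_min (finD x) Dy.
have [||g [l2 [u2 [k5 k6 lu2 _ hg]]]] := @generic_function fibre_max l1 u1 hMax _ lu1.
- by move=> x y z [Dy my] [Dz mz]; have := my z Dz; have := mz y Dy; ord.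
- move=> x lx xu; have [||y Dy] := ne x; [ord|ord|].
  by apply: (fin_max dM) (finD x) Dy.
have [|l3 [u3 [k7 k8 lu3 nrm]]] := generic_normal lu2.
  by move=> x lx xu; apply: ne; ord.
have [x0 [lx0 x0u]] := lt_dense dM lu3.
have {}nrm z : normal x0 z by apply: nrm.
have [k ck] := finD x0.
have /choice [pq hpq] i : exists w : M * M, i < k -> forall y, nth_elt i (D x0) y ->
    [/\ lt w.1 y, lt y w.2 & near1 x0 [set x' | forall y y', D x' y -> D x' y' ->
      lt w.1 y -> lt y w.2 -> lt w.1 y' -> lt y' w.2 -> y = y']].
  case: (pselect (i < k)) => ik; last by exists (x0, x0).
  have [y ny] := nth_ex ck ik.
  have [a [c [ay yc h]]] := normal_fibre (nrm y) ny.1.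
  by exists (a, c) => _ y' /(nth_inj dM ny) <-.
pose p i := (pq i).1; pose q i := (pq i).2.
pose X x y := D x y /\ forall i, i < k -> ~ (lt (p i) y /\ lt y (q i)).
have hX : dset2 X by rewrite /X; def_tac.
have hXE : dset1 (fun x => exists y, X x y) by def_tac.
have single : near1 x0 [set x' | forall i, i < k -> forall y y', D x' y -> D x' y' ->
    lt (p i) y -> lt y (q i) -> lt (p i) y' -> lt y' (q i) -> y = y'].
  by apply: filter_lt => i ik; have [y /(hpq i ik) []] := nth_ex ck ik.
have [s /= [xs [extra|none]]] := germ om true x0 hXE; last first.
  case: single => a [c [ax xc hs]].
  have [w [ws wc xw]] := between2' dM xs xc.
  have [v [vs vw xv]] := between2' dM xw x0u.
  exists x0, v, k; split=> //; [ord|ord|move=> x x0x xv'].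
  apply: (@ncard_boxes k (D x) p q).
    move=> y Dy; apply: contrapT => no; apply: (none x x0x); first by ord.
    by exists y; split=> // i ik h; apply: no; exists i.
  by move=> i y y' ik Dy Dy' *; apply: (hs x _ _ i ik) => //; ord.
exfalso.
pose R x y := X x y /\ forall y', X x y' -> ~ lt y' y.
have hR : dset2 R by rewrite /R; def_tac.
have [|h [dh hh]] := dfun1_of_rel hR.
  by move=> x y z [Dy my] [Dz mz]; have := my z Dz; have := mz y Dy; ord.
have Xh x : lt x0 x -> lt x s -> X x (h x).
  move=> x0x xs'; have [y Xy] := extra x x0x xs'.
  have fX : fin (X x) by apply: (fin_sub dM) (finD x) _ => ? [].
  by have [z Rz] := fin_min fX Xy; rewrite (hh x z Rz); case: Rz.
have [[minf _] cf] : fibre_min x0 (f x0) /\ continuous1 f x0 by apply: hf; ord.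
have [_ cg] : fibre_max x0 (g x0) /\ continuous1 g x0 by apply: hg; ord.
have [c0 hc0] := lt_below dM (f x0); have [d0 hd0] := lt_above dM (g x0).
have nx0 : near1 x0 [set x | lt l2 x /\ lt x u2] by apply: near1_itv; ord.
have bnd : near1 x0 [set x | lt x0 x -> lt x s -> lt c0 (h x) /\ lt (h x) d0].
  have b1 := continuous1_ordb' (b := true) cf hc0.
  have b2 := continuous1_ordb (b := true) cg hd0.
  apply: filterS3 b1 b2 nx0 => x /= b1 b2 [lx xu] x0x xs'.
  have [Dh _] := Xh x x0x xs'.
  have [[_ mf] _] : fibre_min x (f x) /\ continuous1 f x by apply: hf; ord.
  have [[_ mg] _] : fibre_max x (g x) /\ continuous1 g x by apply: hg; ord.
  by have := mf _ Dh; have := mg _ Dh; split; ord.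
(* The limit [z] of [h] at [x0] from the right. *)
pose S c := exists t, lt x0 t /\ forall x, lt x0 x -> lt x t -> lt c (h x).
have hS : dset1 S by rewrite /S; def_tac.
have [a1 [t1 [a1x x0t1 hb]]] := bnd.
have [t2 [t2t1 t2s x0t2]] := between2' dM x0t1 xs.
have Sc0 : S c0.
  by exists t2; split=> // x x0x xt2; apply: (hb x _ _ _ _).1; ord.
have [|z [h1 h2]] := definable_inf om (b := false) hS Sc0 (c := d0).
  move=> c [t [x0t ht]] /=; have [x [xt xt2 x0x]] := between2' dM x0t x0t2.
  have := ht x x0x xt.
  by have [||||_ ?] := hb x; try ord.
rewrite /= in h1 h2.
have lim a c : lt a z -> lt z c -> exists t, lt x0 t /\
    forall x, lt x0 x -> lt x t -> lt a (h x) /\ lt (h x) c.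
  move=> az zc; have [c' [[t3 [x0t3 ht3]] ac']] := h2 a az.
  have [c1 [zc1 c1c]] := lt_dense dM zc.
  have hA : dset1 (fun x => lt c1 (h x)) by def_tac.
  have [t4 /= [x0t4 [k9|k9]]] := germ om true x0 hA.
    by case: (h1 c1) => //; exists t4.
  have [t [tt3 tt4 x0t]] := between2' dM x0t3 x0t4.
  exists t; split=> // x x0x xt; have := k9 x x0x ltac:(ord); have := ht3 x x0x ltac:(ord).
  by split; ord.
have bad a c P : lt a z -> lt z c -> near1 x0 P ->
    exists x, [/\ P x, X x (h x), lt a (h x) & lt (h x) c].
  move=> az zc [a2 [c2 [a2x xc2 hP]]]; have [t [x0t ht]] := lim a c az zc.
  have [x [xc x_t x0x]] := between2' dM xc2 x0t.
  have [y [yx ys x0y]] := between2' dM x0x xs.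
  have [||? ?] := ht y; [ord|ord|].
  by exists y; split=> //; [apply: hP; ord|apply: Xh].
case: (pselect (D x0 z)) => Dz.
  have [i ik ni] := nth_all dM ck Dz; have [pz zq _] := hpq i ik z ni.
  have [x [_ [_ nX] px xq]] := bad _ _ setT pz zq filterT.
  exact: (nX i ik).
case: (nrm z) => [[_ hE']|[a [c [az zc hN]]]].
  have [a0 a0z] := lt_below dM z; have [e0 ze0] := lt_above dM z.
  have [a [_ az ha]] := fin_gap_left dM (finD x0) a0z.
  have [e [_ ze he]] := fin_gap_right dM (finD x0) ze0.
  have /near1_self [y [Dy ay ye]] := hE' a e az ze.
  case: (lt_total dM y z) => yz; [|by subst|].
    by have := ha y Dy yz; ord.
  by have := he y Dy yz; ord.
have [x [hN' [Dh _] ah hc]] := bad a c _ az zc hN.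
exact: (hN' _ Dh).
Qed.

Lemma generic_card l u : lt l u -> exists l' u' k, [/\ ~ lt l' l, ~ lt u u', lt l' u' &
  forall x, lt l' x -> lt x u' -> ncard k (D x)].
Proof.
move=> /generic_bounded [l1 [u1 [k [k1 k2 lu h]]]].
elim: k l1 u1 k1 k2 lu h => [|k IH] l1 u1 k1 k2 lu h.
  exists l1, u1, 0; split=> // x lx xu.
  by have [m] := h x lx xu; rewrite leqn0 => /eqP ->.
have hA : dset1 (fun x => ncard k.+1 (D x)) by def_tac.
have [l2 [u2 [k3 k4 lu2 [all|no]]]] := split_interval om hA lu.
  by exists l2, u2, k.+1; split=> //; ord.
apply: (IH l2 u2) => //; [ord|ord|move=> x lx xu].
have [||m] := h x; [ord|ord|rewrite leq_eqVlt => /orP [/eqP -> c|mk c]].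
  by case: (no x).
by exists m.
Qed.

(** On a subinterval the fibres have the same number of points, and the points of
    each rank form a continuous function. *)
Theorem generic_steady l u : lt l u -> exists x, [/\ lt l x, lt x u & steady (near1 x) D x].
Proof.
move=> /generic_card [l1 [u1 [k [k1 k2 lu hk]]]].
have [l2 [u2 [k3 k4 lu2 hc]]] : exists l' u', [/\ ~ lt l' l1, ~ lt u1 u', lt l' u' &
    forall i, i < k -> forall x, lt l' x -> lt x u' -> nth_continuous (near1 x) D i x].
  move: {1 3}k (leqnn k) => m; elim: m => [|m IH] mk.
    by exists l1, u1; split=> //; ord.
  have [l2 [u2 [a1 a2 lu2 h2]]] := IH (ltnW mk).
  have hR : dset2 (fun x y => nth_elt m (D x) y).
    by def_tac.
  have [||f [l3 [u3 [a3 a4 lu3 _ hf]]]] := @generic_function _ l2 u2 hR _ lu2.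
  - by move=> x y z; apply: nth_inj.
  - by move=> x lx xu; apply: (nth_ex _ mk); apply: hk; ord.
  exists l3, u3; split=> //; [ord|ord|move=> i].
  rewrite ltnS leq_eqVlt => /orP [/eqP -> |im] x lx xu; last by apply: h2 => //; ord.
  move=> y a c ny ay yc; have [nf cf] := hf x lx xu.
  have e := nth_inj dM ny nf; subst y.
  have := cf a c ay yc; have := near1_itv lx xu; apply: filterS2 => x' [lx' x'u] [? ?].
  by exists (f x'); split=> //; case: (hf x' lx' x'u).
have [x [lx xu]] := lt_dense dM lu2.
exists x; split; [ord|ord|].
apply: (@steady_of_nth _ _ dM _ _ (near1_filter x) D x k).
- by apply: hk; ord.
- by apply: filterS (near1_itv lx xu) => x' [? ?]; apply: hk; ord.
- by move=> i ik; apply: hc.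
Qed.

End GenericFibres.

(** * Cells *)

Section Cells.
Variables (L : language) (M : structure L).
Hypothesis om : ominimal M.
Let dM := om.1.

#[local] Instance cells_near1_filter (x : M) : Filter (near1 x) := near1_filter om x.

(** The neighbourhood filter of a point of [M^n]. *)
Definition nearby n (x : 'I_n -> M) : set_system ('I_n -> M) := fun P =>
  exists u v : 'I_n -> M, (forall k, lt (u k) (x k) /\ lt (x k) (v k)) /\
    forall y : 'I_n -> M, (forall k, lt (u k) (y k) /\ lt (y k) (v k)) -> P y.

Lemma nearby_self n (x : 'I_n -> M) P : nearby x P -> P x.
Proof. by move=> [u [v [h1 h2]]]; apply: h2. Qed.

Lemma nearby_snoc n (p : 'I_n -> M) r P : nearby (snoc p r) P <->
  exists c d, [/\ lt c r, lt r d & nearby p [set y | forall s, lt c s -> lt s d -> P (snoc y s)]].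
Proof.
split=> [[u [v [h1 h2]]]|[c [d [cr rd [u [v [h1 h2]]]]]]].
  exists (final u), (final v); have := h1 ord_max; rewrite snoc_max => -[? ?].
  split=> //; exists (init u), (init v); split=> [k|y hy s us sv].
    by have := h1 (lift ord_max k); rewrite snoc_lift.
  by apply: h2 => k; case: (unliftP ord_max k) => [i ->|->]; rewrite ?snoc_lift ?snoc_max; [exact: hy|split].
exists (snoc u c), (snoc v d); split=> [k|y hy].
  by case: (unliftP ord_max k) => [i ->|->]; rewrite ?snoc_lift ?snoc_max //; apply: h1.
rewrite -(snocK y); apply: h2; last 2 first.
- by have := hy ord_max; rewrite !snoc_max => -[].
- by have := hy ord_max; rewrite !snoc_max => -[].
by move=> k; have := hy (lift ord_max k); rewrite !snoc_lift.
Qed.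

#[local] Instance nearby_filter n (x : 'I_n -> M) : Filter (nearby x).
Proof.
split.
- have /choice [u hu] k := lt_below dM (x k); have /choice [v hv] k := lt_above dM (x k).
  by exists u, v.
- elim: n x => [|n IH] x P Q; first by move=> [u [v [h1 h2]]] [u' [v' [h3 h4]]];
    exists u, v; split=> // y _; split; [apply: h2|apply: h4] => -[].
  rewrite -(snocK x) => /nearby_snoc [c [d [cx xd hP]]] /nearby_snoc [c' [d' [cx' xd' hQ]]].
  have [a [? ? ?]] := between2 dM cx cx'; have [b [? ? ?]] := between2' dM xd xd'.
  apply/nearby_snoc; exists a, b; split=> //.
  have [u [v [h1 h2]]] := IH _ _ _ hP hQ; exists u, v; split=> // y /h2 [k1 k2] r ar rb.
  by split; [apply: k1|apply: k2]; ord.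
- by move=> P Q PQ [u [v [h1 h2]]]; exists u, v; split=> // y /h2 /PQ.
Qed.

Lemma nearby_init n (z : 'I_n.+1 -> M) Q : nearby (init z) Q -> nearby z [set w | Q (init w)].
Proof.
have [[c cx] [d xd]] := (lt_below dM (final z), lt_above dM (final z)).
move=> h; rewrite -(snocK z); apply/nearby_snoc; exists c, d; split=> //.
by apply: filterS h => y Qy r _ _; rewrite /mkset init_snoc.
Qed.

(** The traces on [E] of the neighbourhoods of [x]. *)
Definition rnear n (E : set ('I_n -> M)) x : set_system ('I_n -> M) :=
  fun P => nearby x [set y | E y -> P y].

#[local] Instance rnear_filter n (E : set ('I_n -> M)) x : Filter (rnear E x).
Proof.
rewrite /rnear; split.
- by apply: filterS filterT.
- by move=> P Q; apply: filterS2 => y hP hQ Ey; split; [apply: hP|apply: hQ].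
- by move=> P Q PQ; apply: filterS => y hP Ey; apply/PQ/hP.
Qed.

Lemma rnearS n (E E' : set ('I_n -> M)) x P : (forall y, E' y -> E y) ->
  rnear E x P -> rnear E' x P.
Proof. by move=> s; rewrite /rnear; apply: filterS => y h /s. Qed.

Definition ropen n (E X : set ('I_n -> M)) := forall x, X x -> rnear E x X.

Definition rcontinuous n (E : set ('I_n -> M)) (f : ('I_n -> M) -> M) x :=
  forall a d, lt a (f x) -> lt (f x) d -> rnear E x [set y | lt a (f y) /\ lt (f y) d].

Definition cfun n (C : set ('I_n -> M)) (f : ('I_n -> M) -> M) :=
  dset [set z : 'I_n.+1 -> M | C (init z) /\ final z = f (init z)] /\
  forall x, C x -> rcontinuous C f x.

Definition cbound n (C : set ('I_n -> M)) (o : option (('I_n -> M) -> M)) :=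
  if o is Some f then cfun C f else True.

Definition value n (o : option (('I_n -> M) -> M)) x : option M := omap (@^~ x) o.

(** [tcell t C] is the notion of cell with its type [t], whose head belongs to
    the last coordinate: [false] for a graph and [true] for a band. *)
Fixpoint tcell n (t : bitseq) : set ('I_n -> M) -> Prop :=
  match n with
  | 0 => fun C => t = [::] /\ C = setT
  | n'.+1 => fun C => match t with
    | [::] => False
    | false :: t' => exists C' f, [/\ tcell t' C', cfun C' f &
        C = [set z | C' (init z) /\ final z = f (init z)]]
    | true :: t' => exists C' f g, [/\ tcell t' C', cbound C' f /\ cbound C' g,
        (forall f0 g0, f = Some f0 -> g = Some g0 -> forall x, C' x -> lt (f0 x) (g0 x)) &
        C = [set z | C' (init z) /\ Defs.interval (value f (init z)) (value g (init z)) (final z)]]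
    end
  end.

Lemma cfun_cell_fun n (C : set ('I_n -> M)) f : cfun C f -> cell_fun C f.
Proof.
have iM : inhabited M by case: dM.
move=> [df cf]; split; first exact/definableP.
move=> x Cx a b ax xb; have := cf x Cx a b ax xb.
by move=> [u [v [h1 h2]]]; exists u, v; split=> // y Cy /h2; apply.
Qed.

Lemma tcell_cell n t (C : set ('I_n -> M)) : tcell t C -> cell (count id t) C.
Proof.
elim: n t C => [|n IH] t C /=; first by move=> [-> ->]; apply: cell_point.
case: t => // -[] t.
  move=> [C' [f [g [/IH cC' [bf bg] fg ->]]]] /=; apply: cell_band => //.
    by case: f bf {fg} => // f /cfun_cell_fun.
  by case: g bg {fg} => // g /cfun_cell_fun.
by move=> [C' [f [/IH cC' /cfun_cell_fun ? ->]]] /=; apply: cell_graph.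
Qed.

Lemma graphP n t (C : set ('I_n.+1 -> M)) : tcell (false :: t) C -> exists C' f,
  [/\ tcell t C', cfun C' f & forall p r, C (snoc p r) <-> C' p /\ r = f p].
Proof.
move=> [C' [f [hC hf ->]]]; exists C', f; split=> // p r.
by rewrite /mkset init_snoc final_snoc.
Qed.

Lemma interval_nonempty (l u : option M) : (forall a b, l = Some a -> u = Some b -> lt a b) ->
  exists r, Defs.interval l u r.
Proof.
case: l => [a|]; case: u => [b|] h.
- by have [r [? ?]] := lt_dense dM (h _ _ erefl erefl); exists r.
- by have [r ?] := lt_above dM a; exists r.
- by have [r ?] := lt_below dM b; exists r.
- by case: dM => -[r] *; exists r.
Qed.

(** The last clause says that a band is relatively open in the cylinder over its
    base. *)
Lemma bandP n t (C : set ('I_n.+1 -> M)) : tcell (true :: t) C -> exists C' f g,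
  [/\ tcell t C', (forall p r, C (snoc p r) <-> C' p /\ Defs.interval (value f p) (value g p) r),
    (forall p, C' p -> exists r, C (snoc p r)) &
    (forall p r, C (snoc p r) -> exists c d, [/\ lt c r, lt r d &
      rnear C' p [set y | forall s, lt c s -> lt s d -> C (snoc y s)]])].
Proof.
move=> [C' [f [g [hC [bf bg] fg eC]]]]; exists C', f, g.
have memC p r : C (snoc p r) <-> C' p /\ Defs.interval (value f p) (value g p) r.
  by rewrite eC /mkset init_snoc final_snoc.
split=> //.
  move=> p Cp; have [|r hr] := @interval_nonempty (value f p) (value g p).
    case: f {bf memC eC} fg => // f; case: g {bg} => // g fg a b [<-] [<-].
    exact: fg Cp.
  by exists r; apply/memC.
move=> p r /memC [Cp [lr ru]].
have [c [cr hc]] : exists c, lt c r /\ rnear C' p [set y | forall s, lt c s -> above (value f y) s].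
  case: f bf lr {fg eC memC} => [f|] /=; last first.
    by move=> _ _; have [c ?] := lt_below dM r; exists c; split=> //; apply: filterS filterT.
  move=> [_ cf] fr; have [c [fc cr]] := lt_dense dM fr; have [a af] := lt_below dM (f p).
  exists c; split=> //; apply: filterS (cf p Cp a c af fc) => y [_ fyc] s cs.
  by ord.
have [d [rd hd]] : exists d, lt r d /\ rnear C' p [set y | forall s, lt s d -> below s (value g y)].
  case: g bg ru {fg eC memC} => [g|] /=; last first.
    by move=> _ _; have [d ?] := lt_above dM r; exists d; split=> //; apply: filterS filterT.
  move=> [_ cg] gr; have [d [rd dg]] := lt_dense dM gr; have [a ga] := lt_above dM (g p).
  exists d; split=> //; apply: filterS (cg p Cp d a dg ga) => y [gyd _] s sd.
  by ord.
exists c, d; split=> //; move: hc hd; rewrite /rnear.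
apply: filterS2 => y hc hd Cy s cs sd; apply/memC.
by split=> //; split; [apply: (hc Cy)|apply: (hd Cy)].
Qed.

Lemma tcell_nonempty n t (C : set ('I_n -> M)) : tcell t C -> exists x, C x.
Proof.
elim: n t C => [|n IH] t C.
  by move=> [_ ->]; case: dM => -[a] *; exists (fun _ => a).
case: t => // -[] t.
  move=> /bandP [C' [f [g [/IH [p Cp] _ /(_ p Cp) [r Cr] _]]]].
  by exists (snoc p r).
by move=> /graphP [C' [f [/IH [p Cp] _ mC]]]; exists (snoc p (f p)); apply/mC.
Qed.

Lemma tcell_dset n t (C : set ('I_n -> M)) : tcell t C -> dset C.
Proof.
elim: n t C => [|n IH] t C /=; first by move=> [_ ->]; apply: Def_const.
case: t => // -[] t; last by move=> [C' [f [_ [df _] ->]]].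
move=> [C' [f [g [/IH dC' [bf bg] _ ->]]]].
have df : dset [set z : 'I_n.+1 -> M | C' (init z) -> above (value f (init z)) (final z)].
  case: f bf => [f [df _]|_]; last by apply: Def_imp; [def_tac|apply: Def_const].
  apply: (@Def_eqv _ _ _ _ _ _ (fun _ z => forall y,
    [set z | C' (init z) /\ final z = f (init z)] (snoc (init z) y) -> lt y (final z))).
    move=> _ z; split=> [h Cz|h y]; last by rewrite /mkset init_snoc final_snoc => -[? ->]; apply: h.
    by apply: h; rewrite /mkset init_snoc final_snoc.
  by move: [set z | _] df => G dG; def_tac.
have dg : dset [set z : 'I_n.+1 -> M | C' (init z) -> below (final z) (value g (init z))].
  case: g bg => [g [dg _]|_]; last by apply: Def_imp; [def_tac|apply: Def_const].
  apply: (@Def_eqv _ _ _ _ _ _ (fun _ z => forall y,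
    [set z | C' (init z) /\ final z = g (init z)] (snoc (init z) y) -> lt (final z) y)).
    move=> _ z; split=> [h Cz|h y]; last by rewrite /mkset init_snoc final_snoc => -[? ->]; apply: h.
    by apply: h; rewrite /mkset init_snoc final_snoc.
  by move: [set z | _] dg => G dG; def_tac.
have dC : dset [set z : 'I_n.+1 -> M | C' (init z)] by def_tac.
apply: Def_eqv (Def_and dC (Def_and df dg)) => _ z.
by split=> [[Cz [h1 h2]]|[Cz [h1 h2]]]; split=> //; split; [apply: h1|apply: h2| |].
Qed.

Lemma interval_not_fin c d : lt c d -> ~ fin [set r : M | lt c r /\ lt r d].
Proof.
move=> cd fA; have [r [cr rd]] := lt_dense dM cd.
have [z [[cz zd] mz]] := fin_max dM fA (conj cr rd).
have [w [zw wd]] := lt_dense dM zd; apply: (mz w) => //; split=> //; ord.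
Qed.

Definition proj n (X : set ('I_n.+1 -> M)) : set ('I_n -> M) := [set p | exists r, X (snoc p r)].

Lemma proj_ropen n b t (E X : set ('I_n.+1 -> M)) : tcell (b :: t) E ->
  (forall x, X x -> E x) -> ropen E X -> ropen (proj E) (proj X).
Proof.
move=> cE XE oX p [r Xr]; have Er := XE _ Xr.
have [c [d [cr rd hX]]] := (nearby_snoc p r _).1 (oX _ Xr).
case: b cE => [/bandP|/graphP].
  move=> [E' [f [g [_ mE _ oE]]]].
  have [c' [d' [cr' rd' hE]]] := oE _ _ Er.
  have pE y : proj E y -> E' y by move=> [s /mE []].
  apply: filterS2 hX hE => y hX hE /pE Ey; exists r; apply: hX => //; exact: hE.
move=> [E' [f [_ [_ cf] mE]]].
have [Ep er] := (mE p r).1 Er; subst r.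
have pE y : proj E y -> E' y by move=> [s /mE []].
apply: filterS2 hX (cf p Ep c d cr rd) => y hX hf /pE Ey; exists (f y).
by case: (hf Ey) => ? ?; apply: hX => //; apply/mE.
Qed.

Lemma tcell_proj n b t (E : set ('I_n.+1 -> M)) : tcell (b :: t) E -> tcell t (proj E).
Proof.
case: b => [/bandP [E' [f [g [cE mE nE _]]]]|/graphP [E' [f [cE _ mE]]]].
  suff -> : proj E = E' by [].
  by apply: set_ext => p; split=> [[r /mE []]|/nE].
suff -> : proj E = E' by [].
by apply: set_ext => p; split=> [[r /mE []]|Ep] //; exists (f p); apply/mE.
Qed.

Lemma band_open n t (C : set ('I_n.+1 -> M)) p r : tcell (true :: t) C -> C (snoc p r) ->
  exists c d, [/\ lt c r, lt r d &
    rnear (proj C) p [set y | forall s, lt c s -> lt s d -> C (snoc y s)]].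
Proof.
move=> cC Cr; have [C' [f [g [_ mC _ oC]]]] := bandP cC.
have [c [d [cr rd h]]] := oC _ _ Cr; exists c, d; split=> //.
by apply: rnearS h => y [s /mC []].
Qed.

(** The substitute for dimension theory.  Over a band, the fibres of [X] contain
    intervals, which finitely many graphs cannot cover: so some of the cells are
    bands, and their bases cover the projection of [X]. *)
Lemma open_cover_type n t (E X : set ('I_n -> M)) (T : finType) (ti : T -> bitseq)
    (Ei : T -> set ('I_n -> M)) : tcell t E ->
  (forall x, X x -> E x) -> ropen E X -> (exists x, X x) ->
  (forall i, Ei i = set0 \/ tcell (ti i) (Ei i)) -> (forall i x, Ei i x -> E x) ->
  (forall x, X x -> exists i, Ei i x) -> exists i, ti i = t /\ exists x, Ei i x.
Proof.
elim: n t E X ti Ei => [|n IH] t E X ti Ei.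
  move=> [-> eE] _ _ [x Xx] cell_i _ /(_ x Xx) [i Eix]; exists i; split; last by exists x.
  by case: (cell_i i) => [e|[]//]; rewrite e in Eix.
case: t => // b t cE XE oX [x0 Xx0] cell_i iE cov.
have cell_i' i x : Ei i x -> tcell (ti i) (Ei i).
  by case: (cell_i i) => // -> [].
pose Fi i : set ('I_n -> M) := if head false (ti i) == b then proj (Ei i) else set0.
have FiP i p : head false (ti i) = b -> proj (Ei i) p -> Fi i p.
  by rewrite /Fi => ->; rewrite eqxx.
have [|||||||i [ei [p Fp]]] := IH t (proj E) (proj X) (fun i => behead (ti i)) Fi.
- exact: tcell_proj cE.
- by move=> p [r /XE Er]; exists r.
- exact: proj_ropen cE XE oX.
- by exists (init x0), (final x0); rewrite snocK.
- move=> i; rewrite /Fi; case: eqP => _; last by left.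
  case: (cell_i i) => [->|ci]; [left|right].
    by apply: set_ext => p; split=> // -[].
  by case: (ti i) ci => // c s /tcell_proj.
- move=> i p; rewrite /Fi; case: eqP => // _ [r Ep]; exists r; exact: iE Ep.
- move=> p [r Xr]; clearbody Fi; case: b cE FiP => [/bandP|/graphP] cE FiP.
    have [E' [f [g [_ mE _ oE]]]] := cE.
    have [c [d [cr rd hX]]] := (nearby_snoc p r _).1 (oX _ Xr).
    have [c' [d' [cr' rd' hE]]] := oE _ _ (XE _ Xr).
    have Ep : E' p by case/mE: (XE _ Xr).
    have [c1 [h1 h2 h3]] := between2 dM cr cr'; have [d1 [h4 h5 h6]] := between2' dM rd rd'.
    have cd : lt c1 d1 by ord.
    apply: contrapT => no; apply: (interval_not_fin cd).
    have /choice [q hq] i : exists q, forall s, lt c1 s -> lt s d1 -> Ei i (snoc p s) -> s = q.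
      case: (pselect (exists s, Ei i (snoc p s))) => [[s Es]|n1]; last first.
        by exists r => s _ _ Es; case: n1; exists s.
      have := cell_i' _ _ Es; case eti: (ti i) => [//|[] s'] ci.
        by case: no; exists i; apply: FiP; [rewrite eti|exists s].
      have [E1 [f1 [_ _ m1]]] := graphP ci.
      by exists (f1 p) => s1 _ _ /m1 [].
    apply: (fin_sub dM) (fin_codom dM q) _ => s /= [cs sd].
    have Xs : X (snoc p s).
      apply: (nearby_self hX); [ord|ord|].
      by apply: (nearby_self hE) => //; ord.
    by have [i Es] := cov _ Xs; exists i; apply: hq.
  have [i Eir] := cov _ Xr; exists i; apply: FiP; last by exists r.
  have := cell_i' _ _ Eir; case eti: (ti i) => [//|[] s] ci //=; exfalso.
  have [E' [f [_ _ mE]]] := cE.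
  have [E1 [f1 [g1 [_ m1 _ o1]]]] := bandP ci.
  have [c [d [cr rd h1]]] := o1 _ _ Eir.
  have E1p : E1 p by case/m1: Eir.
  have [s1 [cs1 s1r]] := lt_dense dM cr.
  have /mE [_ e1] : E (snoc p r) by exact: iE Eir.
  have /mE [_ e2] : E (snoc p s1).
    by apply: (iE i); apply: (nearby_self h1) => //; ord.
  by subst; ord.
exists i; move: Fp; rewrite /Fi; case: eqP => // eb [r Er]; split; last by exists (snoc p r).
by have := cell_i' _ _ Er; move: ei eb; case: (ti i) => //= c s -> ->.
Qed.

(** By induction on [n]: with equal types, the fibres of a graph coincide with
    those of the larger graph, and those of a band are open. *)
Lemma subcell_ropen n t (E E2 : set ('I_n -> M)) : tcell t E -> tcell t E2 ->
  (forall x, E2 x -> E x) -> ropen E E2.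
Proof.
elim: n t E E2 => [|n IH] t E E2.
  by move=> _ [_ ->] _ x _; apply: filterS filterT.
case: t => // b t cE cE2 sub x Ex.
have oP : ropen (proj E) (proj E2).
  apply: IH (tcell_proj cE) (tcell_proj cE2) _.
  by move=> p [r /sub ?]; exists r.
rewrite -(snocK x) in Ex *; move: (init x) (final x) Ex => {x} p r Er.
have pp : proj E2 p by exists r.
case: b cE cE2 => [cE /bandP [E2' [f [g [_ m2 n2 o2]]]]|/graphP [E' [f [_ _ m]]] /graphP [E2' [f2 [_ _ m2]]]].
  have [c [d [cr rd h]]] := o2 _ _ Er.
  apply/nearby_snoc; exists c, d; split=> //.
  move: (oP p pp) h; rewrite /rnear; apply: filterS2 => y hp h s cs sd Es.
  have [|s' /m2 [E2y _]] := hp; first by exists s.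
  exact: h.
have h : nearby (snoc p r) [set w | proj E (init w) -> proj E2 (init w)].
  by apply: (@nearby_init _ (snoc p r) [set y | proj E y -> proj E2 y]); rewrite init_snoc; apply: oP.
apply: filterS h => w hp Ew; rewrite -(snocK w) in Ew *.
have [|s Es] := hp; first by exists (final w).
by have /m [_ e1] := sub _ Es; have /m [_ e2] := Ew; rewrite e2 -e1.
Qed.

(** Neither of the two alternatives can hold at the first point where [A]
    fails. *)
Lemma itv_connected b (A : set M) x y : dset1 A -> ordb b x y ->
  (forall z, ~ ordb b z x -> ~ ordb b y z -> near1 z A \/ near1 z (~` A)) -> A x -> A y.
Proof.
move=> hA xy loc Ax; apply: contrapT => nAy.
pose S z := [/\ ordb b x z, ~ ordb b y z & ~ A z].
have hS : dset1 S by rewrite /S /ordb; clear -hA; case: b; def_tac.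
have irr (z : M) : ~ ordb b z z by case: (b) => /=; ord.
have Sy : S y by split.
have [|i [h1 h2]] := definable_inf om (b := b) hS Sy (c := x); first by move=> z [].
have xi : ~ ordb b i x by move=> /h2 [z [[xz _ _] zx]]; ordd.
have iy : ~ ordb b y i by exact: h1.
case: (loc i xi iy) => -[s [t [si it hst]]].
  have [i' ii'] : exists i', ordb b i i' /\ forall z, ~ ordb b z i -> ordb b z i' -> lt s z /\ lt z t.
    case: b {xi iy h1 h2 hS loc xy Sy irr} @S => S /=; [exists t|exists s]; split=> // z ? ?; split; ord.
  have [z [Sz zi']] := h2 i' ii'.1; have [_ _ nz] := Sz; apply: nz.
  by have [? ?] := ii'.2 z (h1 z Sz) zi'; apply: hst.
have xi' : ordb b x i.
  case: (ordb_total om b x i) => // e; subst.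
  by case: (hst i si it).
have [i' ii'] : exists i', ordb b i' i /\ forall z, ordb b i' z -> ordb b z i -> lt s z /\ lt z t.
  case: b {xi iy h1 h2 hS loc xy Sy irr xi'} @S => S /=; [exists s|exists t]; split=> // z ? ?; split; ord.
have [z [xz iz zi]] := ordb_between om xi' ii'.1.
have [sz zt] := ii'.2 z iz zi.
apply: (h1 z) => //; split=> //; last exact: hst.
by ordd.
Qed.

Lemma fibre_near n t (E : set ('I_n.+1 -> M)) p r P : tcell (true :: t) E -> E (snoc p r) ->
  rnear E (snoc p r) P -> near1 r [set s | E (snoc p s) /\ P (snoc p s)].
Proof.
move=> cE Er hP.
have [c [d [cr rd h1]]] := (nearby_snoc _ _ _).1 hP.
have [E' [f [g [_ mE _ oE]]]] := bandP cE.
have [c' [d' [cr' rd' h2]]] := oE _ _ Er.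
have [a [? ? ?]] := between2 dM cr cr'; have [b [? ? ?]] := between2' dM rd rd'.
have Ep : E' p by case/mE: Er.
exists a, b; split=> // s as_ sb.
have Es : E (snoc p s) by apply: (nearby_self h2) => //; ord.
by split=> //; apply: (nearby_self h1) => //; ord.
Qed.

(** Definable connectedness: the fibres of a band are intervals, so that [X] is the
    part of [E] over its projection, which is clopen in the base. *)
Lemma cell_connected n t (E X : set ('I_n -> M)) : tcell t E -> dset X ->
  (forall x, X x -> E x) -> ropen E X -> ropen E [set x | E x /\ ~ X x] ->
  (exists x, X x) -> forall x, E x -> X x.
Proof.
elim: n t E X => [|n IH] t E X.
  move=> _ _ _ _ _ [x Xx] y _; suff -> : y = x by [].
  by apply: funext => -[].
case: t => // b t cE dX XE oX oX' [x0 Xx0].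
have fibres p r s : E (snoc p r) -> E (snoc p s) -> X (snoc p r) -> X (snoc p s).
  case: b cE => [cE|/graphP [E' [f [_ _ mE]]]]; last first.
    by move=> /mE [_ ->] /mE [_ ->].
  have [E' [f [g [_ mE _ _]]]] := bandP cE.
  move=> Er Es Xr; have /mE [Ep [lr ru]] := Er; have /mE [_ [ls su]] := Es.
  have hA : dset1 (fun s => X (snoc p s)) by def_tac.
  have key b z : ordb b r s -> ~ ordb b z r -> ~ ordb b s z ->
      near1 z [set s | X (snoc p s)] \/ near1 z (~` [set s | X (snoc p s)]).
    move=> rs zr sz.
    have Ez : E (snoc p z).
      apply/mE; split=> //; split.
        by case: (value f p) lr ls => //= l lr ls; ordd.
      by case: (value g p) ru su => //= u ru su; ordd.
    case: (pselect (X (snoc p z))) => Xz; [left|right].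
      by have := fibre_near cE Ez (oX _ Xz); apply: filterS => ? [].
    by have := fibre_near cE Ez (oX' _ (conj Ez Xz)); apply: filterS => ? [? []].
  case: (lt_total dM r s) => rs; [|by subst|].
    by apply: (itv_connected (b := true) hA rs) => // z; apply: (key true).
  by apply: (itv_connected (b := false) hA rs) => // z; apply: (key false).
have all_p : forall p, proj E p -> proj X p.
  apply: (IH t) => //.
  - exact: tcell_proj cE.
  - by rewrite /proj; def_tac.
  - by move=> p [r /XE Er]; exists r.
  - exact: proj_ropen cE XE oX.
  - have := @proj_ropen _ b t E [set x | E x /\ ~ X x] cE (fun x => @proj1 _ _) oX'.
    congr ropen; apply: set_ext => p; split.
      by move=> [r [Er nX]]; split; [exists r|move=> [s Xs]; apply: nX; exact: fibres (XE _ Xs) Er Xs].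
    by move=> [[r Er] nX]; exists r; split=> // Xr; apply: nX; exists r.
  - by exists (init x0), (final x0); rewrite snocK.
move=> x Ex; rewrite -(snocK x) in Ex *.
have [|s Xs] := all_p (init x); first by exists (final x).
exact: fibres (XE _ Xs) Ex Xs.
Qed.

End Cells.

(** * Cell covers *)

Definition steady_on L (M : structure L) n (E : set ('I_n -> M)) (D : set ('I_n.+1 -> M)) :=
  forall x, E x -> steady (rnear E x) (fibre D) x.

Section Covers.
Variables (L : language) (J : Type) (M : J -> structure L).
Variables (K : Type) (iota : forall j, K -> M j).

(** Members may be empty, because a family of cells need not meet every
    structure. *)
Definition ucell n (t : bitseq) (C : setfam M n) :=
  Def iota C /\ forall j, C j = set0 \/ tcell t (C j).

Definition ucover n (r : finType) (t : r -> bitseq) (C : r -> setfam M n) :=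
  (forall i, ucell (t i) (C i)) /\ forall j x, exists i, C i j x.

Definition compatible T (A B : set T) := (forall x, A x -> B x) \/ (forall x, A x -> ~ B x).

(** Covers, rather than partitions: overlapping cells do no harm below, and covers
    are easier to combine. *)
Definition cell_covers n := forall (T : finType) (X : T -> setfam M n),
  (forall l, Def iota (X l)) -> exists (r : finType) (t : r -> bitseq) (C : r -> setfam M n),
    ucover t C /\ forall i l j, compatible (C i j) (X l j).

Definition steady_covers n := forall D : setfam M n.+1, Def iota D ->
  (forall j x, fin (fibre (D j) x)) ->
  exists (r : finType) (t : r -> bitseq) (C : r -> setfam M n),
    ucover t C /\ forall i j, steady_on (C i j) (D j).

Lemma steadyS (T : Type) j (F G : set_system T) (D : T -> set (M j)) x :
  (forall P, F P -> G P) -> steady F D x -> steady G D x.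
Proof. by move=> FG h l u i i2 fl fu c; apply/FG/h. Qed.

Hypothesis om : forall j, ominimal (M j).

Lemma steady_onS n j (E E' : set ('I_n -> M j)) D : (forall x, E' x -> E x) ->
  steady_on E D -> steady_on E' D.
Proof.
move=> sub st x E'x; apply: steadyS (st x (sub x E'x)) => P.
exact: (rnearS (om j)).
Qed.

Lemma steady_compatible_covers n : cell_covers n -> steady_covers n ->
  forall (D : setfam M n.+1) (T : finType) (X : T -> setfam M n),
    Def iota D -> (forall j x, fin (fibre (D j) x)) -> (forall l, Def iota (X l)) ->
  exists (r : finType) (t : r -> bitseq) (C : r -> setfam M n),
    [/\ ucover t C, forall i l j, compatible (C i j) (X l j) & forall i j, steady_on (C i j) (D j)].
Proof.
move=> cc sc D T X dD fD dX; have [r0 [t0 [C0 [[uC cov] st]]]] := sc D dD fD.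
have [|r [t [C [uC' comp]]]] :=
  cc (T + r0)%type (fun i => match i with inl l => X l | inr l => C0 l end).
  by case=> l; [apply: dX|case: (uC l)].
exists r, t, C; split=> // [i l j|i j x Cx]; first exact: (comp i (inl l) j).
have [i0 C0x] := cov j x.
case: (comp i (inr i0) j) => [sub|n0]; last by case: (n0 x Cx).
exact: steady_onS sub (st i0 j) _ Cx.
Qed.

Lemma Def_slice n (X : setfam M n) j : Def iota X -> dset (X j).
Proof.
move=> [m [phi [s h]]].
exists m, phi, (fun k => match s k with inl i => inl i | inr c => inr (iota j c) end) => -[] x.
rewrite h; congr holds; apply: funext => k; rewrite /assign.
by case: (s k).
Qed.

End Covers.

Section Sheets.
Variables (L : language) (M : structure L).
Hypothesis om : ominimal M.
Let dM := om.1.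

(** The number of points is locally constant, and cells are connected. *)
Lemma steady_card_const n t (E : set ('I_n -> M)) D : tcell t E -> dset D ->
  (forall x, fin (fibre D x)) -> steady_on E D -> exists k, forall x, E x -> ncard k (fibre D x).
Proof.
move=> cE dD fD st; have [x0 Ex0] := tcell_nonempty om cE; have [k ck] := fD x0.
exists k; have dE := tcell_dset cE.
have loc x m : E x -> ncard m (fibre D x) -> rnear E x [set y | ncard m (fibre D y)].
  by move=> Ex; apply: (@steady_cardT _ _ dM _ _ (rnear_filter om E x)); apply: st.
suff h : forall x, E x -> [set x | E x /\ ncard k (fibre D x)] x by move=> x Ex; case: (h x Ex).
apply: (cell_connected om cE).
- by rewrite /fibre; def_tac.
- by move=> x [].
- move=> x [Ex cx]; have := loc x k Ex cx; rewrite /rnear.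
  by apply: (@filterS _ _ (nearby_filter om x)) => y h Ey; split=> //; apply: h.
- move=> x [Ex nx]; have [m cm] := fD x; have := loc x m Ex cm; rewrite /rnear.
  apply: (@filterS _ _ (nearby_filter om x)) => y h Ey; split=> // -[_ ck'].
  by apply: nx; split=> //; rewrite -(ncard_uniq dM (h Ey) ck').
- by exists x0.
Qed.

Lemma sheet n t (E : set ('I_n -> M)) D k m : tcell t E -> dset D ->
  (forall x, fin (fibre D x)) -> steady_on E D -> (forall x, E x -> ncard k (fibre D x)) ->
  m < k -> exists f, cfun E f /\ forall x, E x -> nth_elt m (fibre D x) (f x).
Proof.
move=> cE dD fD st ck mk; have dE := tcell_dset cE.
have [||f [df hf]] := @dfun_of_rel _ _ om n [set z | nth_elt m (fibre D (init z)) (final z)].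
- by rewrite /fibre; def_tac.
- by move=> x y z; rewrite /fibre /mkset !init_snoc !final_snoc; apply: nth_inj.
have nf x : E x -> nth_elt m (fibre D x) (f x).
  move=> Ex; have [y ny] := nth_ex (ck x Ex) mk.
  by rewrite (hf x y) // /fibre /mkset init_snoc final_snoc.
exists f; split=> //; split.
  by def_tac.
move=> x Ex a d ax xd.
have := @steady_nth _ _ dM _ _ (rnear_filter om E x) _ x m (fD x) (st x Ex) _ _ _ (nf x Ex) ax xd.
rewrite /rnear; apply: (@filterS _ _ (nearby_filter om x)) => y h Ey.
by have [y' [/(nth_inj dM (nf y Ey)) <- ? ?]] := h Ey.
Qed.

Lemma rnear_open n (E : set ('I_n -> M)) x P : dset E -> E x -> rnear E x P ->
  exists U : set ('I_n -> M), [/\ dset U, U x, ropen E U & forall y, U y -> E y /\ P y].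
Proof.
move=> dE Ex [u [v [h1 h2]]].
exists [set y | E y /\ forall k, lt (u k) (y k) /\ lt (y k) (v k)]; split=> //.
- by def_tac.
- by move=> y [Ey hy]; exists u, v; split=> // z hz Ez; split.
- by move=> y [Ey hy]; split=> //; apply: h2.
Qed.

End Sheets.

(** * Density of the points where fibres vary continuously *)

Section Density.
Variables (L : language) (M : structure L).
Hypothesis om : ominimal M.
Let dM := om.1.

#[local] Instance density_near1_filter (x : M) : Filter (near1 x) := near1_filter om x.
#[local] Instance density_near_filter n (x : 'I_n -> M) : Filter (nearby x) := nearby_filter om x.
#[local] Instance density_rnear_filter n (E : set ('I_n -> M)) x : Filter (rnear E x) :=
  rnear_filter om E x.

Notation covers0 := (cell_covers (J := unit) (M := fun _ => M) (fun _ c => c)).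
Notation steady0 := (steady_covers (J := unit) (M := fun _ => M) (fun _ c => c)).

Lemma subcell_in_open n t (E X : set ('I_n -> M)) (T : finType) (Y : T -> set ('I_n -> M)) :
  covers0 n -> tcell t E -> (forall x, X x -> E x) -> dset X -> ropen E X ->
  (exists x, X x) -> (forall l, dset (Y l)) ->
  exists E2, [/\ tcell t E2, forall x, E2 x -> X x & forall l, compatible E2 (Y l)].
Proof.
move=> cc cE XE dX oX [x0 Xx0] dY.
have [|r [ti [C [[uC cov] comp]]]] := cc (option T)
  (fun o _ => if o is Some l then Y l else X); first by case=> [l|]; [apply: dY|].
pose F i : set ('I_n -> M) := if `[< forall x, C i tt x -> X x >] then C i tt else set0.
have [|||i [ei [x Fx]]] := @open_cover_type _ _ om n t E X r ti F cE XE oX (ex_intro _ x0 Xx0).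
- by move=> i; rewrite /F; case: asboolP => _; [case: (uC i) => _ /(_ tt)|left].
- by move=> i x; rewrite /F; case: asboolP => // h Cx; exact/XE/h.
- move=> x Xx; have [i Cx] := cov tt x; exists i; rewrite /F; case: asboolP => // n0; exfalso.
  by case: (comp i None tt) => h; [apply: n0|apply: (h x)].
move: Fx; rewrite /F; case: asboolP => // sub Cx; exists (C i tt); split=> //.
  by case: (uC i) => _ /(_ tt) [e|]; [rewrite e in Cx|rewrite ei].
by move=> l; apply: (comp i (Some l) tt).
Qed.

Lemma steady_subcell n t (E X : set ('I_n -> M)) D :
  covers0 n -> steady0 n -> tcell t E -> (forall x, X x -> E x) -> dset X -> ropen E X ->
  (exists x, X x) -> dset D -> (forall x, fin (fibre D x)) ->
  exists E2, [/\ tcell t E2, forall x, E2 x -> X x & steady_on E2 D].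
Proof.
move=> cc sc cE XE dX oX ne dD fD.
have [r [ti [C [[uC cov] st]]]] := sc (fun _ => D) dD (fun _ => fD).
have [|E2 [cE2 E2X comp]] := subcell_in_open (Y := fun i => C i tt) cc cE XE dX oX ne.
  by move=> i; apply: (Def_slice tt (uC i).1).
exists E2; split=> // x Ex; have [i Cx] := cov tt x.
case: (comp i) => h; last by case: (h x Ex).
exact: (steady_onS (M := fun _ : unit => M) (j := tt) (fun _ => om) h (st i tt)) Ex.
Qed.

Lemma ropen_refl n (E : set ('I_n -> M)) : ropen E E.
Proof. by move=> x Ex; rewrite /rnear; apply: filterS filterT => y _ Ey. Qed.

(** A cover of [X] by cells contains a band over a subcell of the type of [E], as
    graphs cannot cover intervals; a band contains boxes by the continuity of its
    bounds.  This replaces the definable choice of an interval in each fibre. *)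
Lemma box_in_set n t (E : set ('I_n -> M)) (X : set ('I_n.+1 -> M)) :
  covers0 n -> covers0 n.+1 -> tcell t E -> dset X ->
  (forall p, E p -> exists c d, lt c d /\ forall r, lt c r -> lt r d -> X (snoc p r)) ->
  exists E2 c d, [/\ tcell t E2, forall x, E2 x -> E x, lt c d &
    forall p r, E2 p -> lt c r -> lt r d -> X (snoc p r)].
Proof.
move=> cc cc1 cE dX hX; have dE := tcell_dset cE.
have [|r [ti [C [[uC cov] comp]]]] := cc1 unit (fun _ _ => [set z | E (init z) /\ X z]).
  by move=> _; def_tac.
have cell_i i x : C i tt x -> tcell (ti i) (C i tt).
  by case: (uC i) => _ /(_ tt) [->|].
pose good i := [/\ head false (ti i) & forall z, C i tt z -> E (init z) /\ X z].
pose F i : set ('I_n -> M) := if `[< good i >] then proj (C i tt) else set0.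
have [x0 Ex0] := tcell_nonempty om cE.
have [|||i [ei [p Fp]]] := @open_cover_type _ _ om n t E E r (fun i => behead (ti i)) F cE
  (fun _ h => h) (@ropen_refl _ E) (ex_intro _ x0 Ex0).
- move=> i; rewrite /F; case: asboolP => [[h _]|_]; last by left.
  case: (uC i) => _ /(_ tt) [->|ci]; [left|right].
    by apply: set_ext => p; split=> // -[].
  by case: (ti i) ci h => [|c s] ci _ //; exact: (tcell_proj om ci).
- move=> i p; rewrite /F; case: asboolP => // -[_ h] [s /h].
  by rewrite init_snoc => -[].
- move=> p Ep; have [c [d [cd hp]]] := hX p Ep.
  apply: contrapT => no; apply: (interval_not_fin om cd).
  have [q0 _] := lt_dense dM cd.
  have /choice [q hq] i : exists q, forall s, lt c s -> lt s d -> C i tt (snoc p s) -> s = q.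
    case: (pselect (exists s, [/\ lt c s, lt s d & C i tt (snoc p s)])) => [[s [cs sd Cs]]|n1];
      last by exists q0 => s cs sd Cs; case: n1; exists s.
    case eti: (ti i) (cell_i _ _ Cs) => [//|[] s'] ci.
      case: no; exists i; rewrite /F; case: asboolP => [_|ng]; first by exists s.
      case: ng; split; first by rewrite eti.
      case: (comp i tt tt) => // h; case: (h _ Cs); rewrite /mkset init_snoc; split=> //.
      exact: hp.
    have [E1 [f1 [_ _ m1]]] := graphP ci.
    by exists (f1 p) => s1 _ _ /m1 [].
  apply: (fin_sub dM) (fin_codom dM q) _ => s /= [cs sd].
  by have [i Cs] := cov tt (snoc p s); exists i; apply: hq.
move: Fp; rewrite /F; case: asboolP => // -[hd sub] [s Cs].
have ci : tcell (true :: t) (C i tt).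
  by have := cell_i _ _ Cs; move: ei hd; case: (ti i) => //= b u -> ->.
have [Z' [f [g [cZ mZ _ oZ]]]] := bandP om ci.
have [c [d [cs sd near_p]]] := oZ _ _ Cs.
have Zp : Z' p by case/mZ: Cs.
have [U [dU Up oU subU]] := rnear_open (tcell_dset cZ) Zp near_p.
have [E2 [cE2 E2U _]] := subcell_in_open (Y := fun v : void => match v with end) cc cZ
  (fun y h => (subU y h).1) dU oU (ex_intro _ p Up) (fun v => match v with end).
exists E2, c, d; split=> //; last 2 first.
- by ord.
- by move=> y u Ey cu ud; have [_] := subU y (E2U y Ey); move=> /(_ u cu ud) /sub [].
move=> y Ey; have [_ h] := subU y (E2U y Ey).
by have := h s cs sd => /sub; rewrite init_snoc => -[].
Qed.

(** The values at [(y, w)] lie between the values at [(y, s)] and [(y, t)], for fixed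
    [s] and [t] on the two sides of [w], and these depend continuously on [y]. *)
Lemma separately_continuous n (E : set ('I_n -> M)) (f : ('I_n.+1 -> M) -> M) p r u v a d :
  lt u r -> lt r v -> 
  (forall y, E y -> monotone (fun s => f (snoc y s)) u v) -> E p ->
  near1 r [set s | lt a (f (snoc p s)) /\ lt (f (snoc p s)) d /\
    rnear E p [set y | lt a (f (snoc y s)) /\ lt (f (snoc y s)) d]] ->
  nearby (snoc p r) [set z | E (init z) -> lt a (f z) /\ lt (f z) d].
Proof.
move=> ur rv mono Ep [s0 [t0 [s0r rt0 h]]].
have [s [s0s us sr]] := between2 dM s0r ur.
have [t [tt0 tv rt]] := between2' dM rt0 rv.
have [||_ [_ ns]] := h s => //; first by ord.
have [||_ [_ nt]] := h t => //; first by ord.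
apply/nearby_snoc; exists s, t; split=> //.
move: ns nt; rewrite /rnear; apply: filterS2 => y hs ht w sw wt.
rewrite /mkset init_snoc => Ey; have [? ?] := hs Ey; have [? ?] := ht Ey.
have [m1 m2] := mono y Ey s w t us sw wt tv.
by split; apply: contrapT => ?; [apply: m1|apply: m2]; split; ord.
Qed.

Lemma monotone_pieces (F : nat -> M -> M) l u k : (forall i, dfun1 (F i)) -> lt l u ->
  exists l' u', [/\ ~ lt l' l, ~ lt u u', lt l' u' & forall i, i < k ->
    monotone (F i) l' u' /\ forall x, lt l' x -> lt x u' -> continuous1 (F i) x].
Proof.
move=> dF lu; elim: k => [|k [l1 [u1 [k1 k2 lu1 h1]]]].
  by exists l, u; split=> //; ord.
have [l2 [u2 [k3 k4 lu2 [mono cont]]]] := monotonicity om (dF k) lu1.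
exists l2, u2; split=> //; [ord|ord|move=> i].
rewrite ltnS leq_eqVlt => /orP [/eqP -> //|/h1 [m1 c1]]; split.
  by move=> x y z lx xy yz zu; apply: m1 => //; ord.
by move=> x lx xu; apply: c1; ord.
Qed.

Lemma product_cell n t (E : set ('I_n -> M)) u v : tcell t E -> lt u v ->
  tcell (true :: t) [set z : 'I_n.+1 -> M | E (init z) /\ lt u (final z) /\ lt (final z) v].
Proof.
move=> cE uv; have dE := tcell_dset cE.
have cst (c : M) : cfun E (fun _ => c).
  split; first by def_tac.
  by move=> x Ex a d ax xd; apply: filterS filterT.
exists E, (Some (fun _ => u)), (Some (fun _ => v)); split=> //.
- by split; apply: cst.
- by move=> f g [<-] [<-].
Qed.

(** On a box over a subcell of the base, the fibres vary continuously along vertical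
    lines and have constant size.  Their points of given rank are functions which,
    on a smaller box, are monotone and continuous in the last variable and
    continuous in the other ones, hence continuous. *)
Theorem band_steady_point n t (C : set ('I_n.+1 -> M)) (D : set ('I_n.+2 -> M)) :
  covers0 n -> covers0 n.+1 -> steady0 n -> tcell (true :: t) C -> dset D ->
  (forall x, fin (fibre D x)) -> exists x, C x /\ steady (rnear C x) (fibre D) x.
Proof.
move=> cc cc1 sc cC dD fD; have dC := tcell_dset cC.
pose D1 p r := fibre D (snoc p r).
have fD1 p r : fin (D1 p r) by apply: fD.
have dD1 p : dset2 (D1 p) by rewrite /D1 /fibre; def_tac.
(* Over a vertical line, the fibres vary continuously at almost all points. *)
pose X1 z := C z /\ steady (near1 (final z)) (D1 (init z)) (final z).
have dX1 : dset X1.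
  by rewrite /X1 /steady /near1 /D1 /fibre; def_tac.
have pC p : proj C p -> exists c d, lt c d /\ forall r, lt c r -> lt r d -> C (snoc p r).
  move=> [r Cr]; have := fibre_near om cC Cr filterT.
  by move=> [c [d [cr rd h]]]; exists c, d; split=> [|s cs sd]; [ord|case: (h s cs sd)].
have [|E1 [a [b [cE1 E1C ab hE1]]]] := box_in_set cc cc1 (tcell_proj om cC) dX1.
  move=> p /pC [c [d [cd hp]]].
  have hA : dset1 (fun r => steady (near1 r) (D1 p) r).
    by rewrite /steady /near1 /D1 /fibre; def_tac.
  have [c1 [d1 [k1 k2 cd1 [pos|neg]]]] := split_interval om hA cd; last first.
    by have [x [cx xd /(neg x cx xd)]] := generic_steady om (dD1 p) (fD1 p) cd1.
  exists c1, d1; split=> // r cr rd; split; first by apply: hp; ord.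
  by rewrite init_snoc final_snoc; apply: pos.
(* The number of points of the fibres is constant on a box. *)
have [r1 [ar1 r1b]] := lt_dense dM ab.
pose slice r := [set z | D1 (init z) r (final z)].
have dS r : dset (slice r) by rewrite /slice /D1 /fibre; def_tac.
have eS r p : fibre (slice r) p = D1 p r.
  by apply: set_ext => y; rewrite /fibre /slice /mkset init_snoc final_snoc.
have fS r p : fin (fibre (slice r) p) by rewrite eS.
have [E2 [cE2 E21 sE2]] := steady_subcell cc sc cE1 (fun x h => h) (tcell_dset cE1)
  (@ropen_refl _ E1) (tcell_nonempty om cE1) (dS r1) (fS r1).
have [k ck1] := steady_card_const om cE2 (dS r1) (fS r1) sE2.
have ck p r : E2 p -> lt a r -> lt r b -> ncard k (D1 p r).
  move=> Ep ar rb.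
  have hA : dset1 (fun r => ncard k (D1 p r)).
    by rewrite /D1 /fibre; def_tac.
  have cr1 : ncard k (D1 p r1) by rewrite -eS; apply: ck1.
  have loc z : lt a z -> lt z b ->
      near1 z [set r | ncard k (D1 p r)] \/ near1 z (~` [set r | ncard k (D1 p r)]).
    move=> az zb; have [_] := hE1 p z (E21 p Ep) az zb; rewrite init_snoc final_snoc => st.
    have [m cm] := fD1 p z; have nm := @steady_cardT _ _ dM _ _ (near1_filter om z) _ _ _ st cm.
    case: (pselect (m = k)) => [e|ne]; [left|right]; first by subst.
    by apply: filterS nm => s cs ck; apply: ne; apply: (ncard_uniq dM) cs ck.
  case: (lt_total dM r1 r) => h; [|by subst|].
    by apply: (itv_connected om (b := true) hA h) => //= z *; apply: loc; ord.
  by apply: (itv_connected om (b := false) hA h) => //= z *; apply: loc; ord.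
(* The points of the fibres as functions on the box. *)
have /choice [f hf] l : exists f, dfun f /\ forall z y, nth_elt l (fibre D z) y -> f z = y.
  have [||f [df hf]] := @dfun_of_rel _ _ om n.+1 [set w | nth_elt l (fibre D (init w)) (final w)].
  - by rewrite /fibre; def_tac.
  - by move=> x y z; rewrite /fibre /mkset !init_snoc !final_snoc; apply: nth_inj.
  exists f; split=> // z y nz; apply: hf; by rewrite /fibre /mkset init_snoc final_snoc.
have df l : dfun (f l) by case: (hf l).
have nf p r l : E2 p -> lt a r -> lt r b -> l < k -> nth_elt l (D1 p r) (f l (snoc p r)).
  move=> Ep ar rb lk; have [y ny] := nth_ex (ck p r Ep ar rb) lk.
  by have [_ h] := hf l; rewrite (h _ y).
have df1 p l : dfun1 (fun r => f l (snoc p r)).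
  by rewrite /dfun1 /dfun; have := df l; move: (f l) => g dg; dterm_tac.
(* They are monotone and continuous in the last variable, on a smaller box. *)
pose good p u v := [/\ lt a u, lt u v, lt v b & forall l, l < k ->
  monotone (fun r => f l (snoc p r)) u v /\
  forall x, lt u x -> lt x v -> continuous1 (fun r => f l (snoc p r)) x].
have goodS p u v u' v' : good p u v -> ~ lt u' u -> ~ lt v v' -> lt u' v' -> good p u' v'.
  move=> [au uv vb h] uu' vv' uv'; split=> //; [ord|ord|move=> l lk].
  have [m c] := h l lk; split; first by move=> x y z *; apply: m; ord.
  by move=> x *; apply: c; ord.
have dgood n' (T : unit -> ('I_n' -> M) -> 'I_n -> M) s1 s2 :
    let tm := dterm (J := unit) (M := fun _ => M) (fun _ c => c) in
    (forall i, tm _ (fun j x => T j x i)) -> tm _ s1 -> tm _ s2 ->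
    Def (J := unit) (M := fun _ => M) (fun _ c => c) (fun j x => good (T j x) (s1 j x) (s2 j x)).
  move=> tm hT h1 h2.
  have : dset [set z : 'I_n.+2 -> M | good (init (init z)) (final (init z)) (final z)].
    rewrite /good /monotone /continuous1 /near1.
    apply: Def_and4; [clear; def_tac|clear; def_tac|clear; def_tac|].
    by apply: Def_forall_lt => l; have := df l; move: (f l) => g dg; clear -dg; def_tac.
  move=> /(dset_app (T := fun j x => snoc (snoc (T j x) (s1 j x)) (s2 j x))).
  case; first by apply: dterm_snoc => //; apply: dterm_snoc.
  move=> m [phi [s e]]; exists m, phi, s => j x.
  by rewrite -e /mkset !init_snoc !final_snoc.
have [||E3 [u1 [u2 [cE3 E32 u12 hE3]]]] :=
    box_in_set (X := [set z | exists v, good (init z) (final z) v]) cc cc1 cE2.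
- by apply: Def_ex; apply: dgood => [i||]; exact: dterm_var.
- move=> p Ep; have [u0 [v0 [k1 k2 uv0 h]]] := monotone_pieces k (df1 p) ab.
  have [v1 [uv1 vv1]] := lt_dense dM uv0; have [w1 [uw1 wv1]] := lt_dense dM uv1.
  exists w1, v1; split=> // r wr rv; exists v1; rewrite init_snoc final_snoc.
  split; [ord|ord|ord|move=> l lk]; have [m c] := h l lk.
  by split=> [x y z *|x *]; [apply: m|apply: c]; ord.
have [u [u1u uu2]] := lt_dense dM u12.
have [||E4 [v1 [v2 [cE4 E43 v12 hE4]]]] :=
    box_in_set (X := [set z | good (init z) u (final z)]) cc cc1 cE3.
- by apply: dgood => [i||]; [exact: dterm_var|exact: dterm_const|exact: dterm_var].
- move=> p Ep; have [v] := hE3 p u Ep u1u uu2; rewrite init_snoc final_snoc => gv.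
  have [_ uv _ _] := gv; exists u, v; split=> // r ur rv.
  by rewrite /mkset init_snoc final_snoc; apply: goodS gv _ _ _; ord.
have [v [v1v vv2]] := lt_dense dM v12.
have gE4 p : E4 p -> good p u v.
  by move=> Ep; have := hE4 p v Ep v1v vv2; rewrite /mkset init_snoc final_snoc.
have [p4 Ep4] := tcell_nonempty om cE4; have [au uv vb _] := gE4 p4 Ep4.
have E42 p : E4 p -> E2 p by move=> /E43 /E32.
have dE4 := tcell_dset cE4.
pose W := [set z : 'I_n.+1 -> M | E4 (init z) /\ lt u (final z) /\ lt (final z) v].
have cW : tcell (true :: t) W := product_cell cE4 uv.
have WC z : W z -> C z.
  rewrite -(snocK z) /W /mkset init_snoc final_snoc => -[Ez [uz zv]].
  by have [] := hE1 (init z) (final z) (E21 _ (E42 _ Ez)) ltac:(ord) ltac:(ord).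
(* They are continuous in the other variables, on a subcell of the box. *)
pose Y := [set z : 'I_n.+1 -> M | forall l, l < k -> forall c d, lt c (f l z) -> lt (f l z) d ->
  nearby (init z) [set y | E4 y -> lt c (f l (snoc y (final z))) /\ lt (f l (snoc y (final z))) d]].
have dY : dset Y.
  rewrite /Y /nearby; apply: Def_forall_lt => l.
  by have := df l; move: (f l) => g dg; clear -dg dE4; def_tac.
have [Z [cZ ZW ZY]] := subcell_in_open (Y := fun _ : unit => Y) cc1 cW (fun x h => h)
  (tcell_dset cW) (@ropen_refl _ W) (tcell_nonempty om cW) (fun _ => dY).
have {}ZY : forall z, Z z -> Y z.
  case: (ZY tt) => // ZnY; exfalso.
  have [z Zz] := tcell_nonempty om cZ.
  have {z Zz} [p [r Zp]] : exists p r, Z (snoc p r) by exists (init z), (final z); rewrite snocK.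
  have pZ y : proj Z y -> E4 y by move=> [s /ZW]; rewrite /W /mkset init_snoc => -[].
  have dU : dset [set y | Z (snoc y r)].
    by have dZ := tcell_dset cZ; def_tac.
  have oU : ropen (proj Z) [set y | Z (snoc y r)].
    move=> y Zy; have [c [d [cr rd h]]] := band_open om cZ Zy.
    by apply: filterS h => q; apply.
  have [E5 [cE5 E5U sE5]] := steady_subcell cc sc (tcell_proj om cZ)
    (fun y h => ex_intro _ r h) dU oU (ex_intro _ p Zp) (dS r) (fS r).
  have E54 y : E5 y -> E4 y by move=> /E5U Zy; apply: pZ; exists r.
  have oE5 := subcell_ropen om cE4 cE5 E54.
  have [q Eq] := tcell_nonempty om cE5.
  have Zq : Z (snoc q r) by apply: E5U.
  have [ur rv] : lt u r /\ lt r v by have := ZW _ Zq; rewrite /W /mkset final_snoc => -[].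
  apply: (ZnY _ Zq) => l lk c d cf fd; rewrite init_snoc final_snoc.
  have nq : nth_elt l (fibre (slice r) q) (f l (snoc q r)).
    by rewrite eS; apply: nf => //; [apply/E42/E54|ord|ord].
  have := @steady_nth _ _ dM _ _ (rnear_filter om E5 q) _ q l (fS r q) (sE5 q Eq) _ _ _ nq cf fd.
  have := oE5 q Eq; rewrite /rnear; apply: filterS2 => y h1 h2 Ey.
  have [y' [ny' ? ?]] := h2 (h1 Ey).
  by rewrite eS in ny'; have [_ hfl] := hf l; rewrite /mkset (hfl _ _ ny').
have [z Zz] := tcell_nonempty om cZ.
have {z Zz} [p [r Zp]] : exists p r, Z (snoc p r) by exists (init z), (final z); rewrite snocK.
have ZC z : Z z -> C z by move=> /ZW /WC.
have oZC := subcell_ropen om cC cZ ZC.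
have cZk z : Z z -> ncard k (fibre D z).
  move=> /ZW; rewrite -(snocK z) /W /mkset init_snoc final_snoc => -[Ez [uz zv]].
  by apply: ck; [apply: E42|ord|ord].
exists (snoc p r); split; first exact: ZC.
apply: (@steady_of_nth _ _ dM _ _ (rnear_filter om C (snoc p r)) (fibre D) _ k).
- exact: cZk.
- by apply: filterS (oZC _ Zp) => w; apply: cZk.
move=> l lk y c d ny cy yd.
have := ZW _ Zp; rewrite /W /mkset init_snoc final_snoc => -[Ep [ur rv]].
have e : f l (snoc p r) = y by have [_ h] := hf l; apply: h.
rewrite -e in cy yd.
have [_ _ _ /(_ l lk) [mono cont]] := gE4 p Ep.
have := @separately_continuous n E4 (f l) p r u v c d ur rv
  (fun q Eq => (let: And4 _ _ _ h := gE4 q Eq in h l lk).1) Ep.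
case.
  apply: filterS2 (fibre_near om cZ Zp filterT) (cont r ur rv c d cy yd) => s [Zs _] [cs sd].
  by split=> //; split=> //; have := ZY _ Zs l lk c d cs sd; rewrite init_snoc final_snoc.
move=> u0 [v0 [h1 h2]].
have hn : nearby (snoc p r) [set z | E4 (init z) -> lt c (f l z) /\ lt (f l z) d] by exists u0, v0.
have := oZC _ Zp; rewrite /rnear; apply: filterS2 hn => w hw hC Cw.
have Zw := hC Cw; have := ZW _ Zw => -[Ew [uw wv]].
have [? ?] := hw Ew; exists (f l w); split=> //.
by rewrite -(snocK w); apply: nf => //; [apply: E42|ord|ord].
Qed.

End Density.

(** * Uniform cell covers *)

Section Pieces.
Variables (L : language) (M : structure L).
Hypothesis om : ominimal M.
Let dM := om.1.

Definition boundary (A : set M) y := ~ exists c d, [/\ lt c y, lt y d &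
  (forall r, lt c r -> lt r d -> A r) \/ (forall r, lt c r -> lt r d -> ~ A r)].

(** Otherwise the boundary would contain an interval, but [A] is constant on some
    subinterval. *)
Lemma fin_boundary (A : set M) : dset1 A -> fin (boundary A).
Proof.
move=> dA; have dB : dset1 (boundary A) by rewrite /boundary; def_tac.
case: (fin_or_interval om dB) => // -[l [u [lu h]]]; exfalso.
have [l1 [u1 [k1 k2 lu1 cst]]] := split_interval om dA lu.
have [x [lx xu]] := lt_dense dM lu1; apply: (h x); [ord|ord|].
by exists l1, u1.
Qed.

Lemma constant_between b (A : set M) x y : dset1 A -> ordb b x y ->
  (forall z, ~ ordb b z x -> ~ ordb b y z -> ~ boundary A z) -> A x -> A y.
Proof.
move=> dA xy nb; apply: (itv_connected om dA xy) => z zx yz.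
have /contrapT [c [d [cz zd [h|h]]]] := nb z zx yz; [left|right];
  by exists c, d; split.
Qed.

Lemma fin_setU (A B : set M) : fin A -> fin B -> fin [set y | A y \/ B y].
Proof.
move=> [k]; elim: k A => [|k IH] A.
  by move=> nA fB; apply: (fin_sub dM) fB _ => y [/nA|].
move=> /ncardS [y [Ay my ck]] fB; apply: (fin_sub dM) (fin_add dM y (IH _ ck fB)) _ => z [Az|Bz].
  case: (lt_total dM y z) => h; [by left; left|by right|by case: (my z Az)].
by left; right.
Qed.

Lemma fin_union (T : finType) (A : T -> set M) : (forall i, fin (A i)) ->
  fin [set y | exists i, A i y].
Proof.
move=> fA; suff h (s : seq T) : fin [set y | exists2 i, i \in s & A i y].
  by apply: (fin_sub dM) (h (enum T)) _ => y [i Ay]; exists i => //; rewrite mem_enum.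
elim: s => [|i s IH]; first by exists 0 => y [].
apply: (fin_sub dM) (fin_setU (fA i) IH) _ => y [i'].
by rewrite inE => /orP [/eqP ->|i's] Ay; [left|right; exists i'].
Qed.

(** For [e] true, the point of [A] of rank [m]; for [e] false, the gap that comes
    after [m] points of [A]. *)
Definition piece (A : set M) m (e : bool) y :=
  ncard m [set y' | A y' /\ lt y' y] /\ (if e then A y else ~ A y).

Lemma piece_true A m y : piece A m true y <-> nth_elt m A y.
Proof. by split=> [[? ?]|[? ?]]; split. Qed.

Lemma piece_ex k A y : ncard k A -> exists m e, m <= k /\ piece A m e y.
Proof.
move=> kA; have [|m mk cm] := @ncard_sub _ _ dM k A [set y' | A y' /\ lt y' y] kA.
  by move=> z [].
by exists m, `[< A y >]; split=> //; split=> //; case: asboolP.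
Qed.

Lemma piece_gap A m x y z : piece A m false x -> piece A m false y -> lt x z -> lt z y -> ~ A z.
Proof.
move=> [cx _] [cy _] xz zy Az.
have := ncard_add dM cx (b := z) => h.
have : ncard m.+1 [set y0 | [set y' | A y' /\ lt y' x] y0 \/ y0 = z].
  by apply: h => -[_ ?]; ord.
move=> c; have : m < m; last by rewrite ltnn.
by apply: (ncard_le dM cy c) => w [[Aw wx]|->]; split=> //; ord.
Qed.

Lemma piece_convex A m x y z : piece A m false x -> piece A m false y -> lt x z -> lt z y ->
  piece A m false z.
Proof.
move=> px py xz zy; split; last exact: piece_gap px py xz zy.
have [cx nx] := px; apply: ncard_ext cx => w; split=> [[Aw wx]|[Aw wz]]; split=> //; first by ord.
case: (lt_total dM w x) => // h; first by subst.
by case: (piece_gap px py h _ Aw); ord.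
Qed.

Lemma piece_gapE k (A : set M) m y (f g : M) : ncard k A -> m <= k ->
  (0 < m -> nth_elt m.-1 A f) -> (m < k -> nth_elt m A g) ->
  piece A m false y <-> ((0 < m -> lt f y) /\ (m < k -> lt y g)).
Proof.
move=> kA mk nf ng; split.
  move=> [cy ny]; split=> [m0|mk'].
    have [Af cf] := nf m0; case: (lt_total dM f y) => // h; first by subst.
    have : m <= m.-1; last by rewrite leqNgt prednK // leqnn.
    by apply: (ncard_le dM cf cy) => z [Az zy]; split=> //; ord.
  have [Ag cg] := ng mk'; case: (lt_total dM y g) => // h; first by subst.
  have := ncard_add dM cg (b := g) => /(_ (fun h => lt_irr dM h.2)) c.
  have : m < m; last by rewrite ltnn.
  by apply: (ncard_le dM cy c) => z [[Az zg]|->]; split=> //; ord.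
move=> [fy yg]; have nAy : ~ A y.
  move=> Ay; have [l lk nl] := nth_all dM kA Ay.
  case: (ltnP l m) => lm.
    have m0 : 0 < m by case: (m) lm.
    have : l <= m.-1 by rewrite -ltnS prednK.
    rewrite leq_eqVlt => /orP [/eqP e|h].
      by have := fy m0; rewrite -e in nf; rewrite (nth_inj dM nl (nf m0)); ord.
    by have := nth_mono' dM nl (nf m0) h; have := fy m0; ord.
  have mk' : m < k by apply: leq_ltn_trans lm lk.
  move: lm; rewrite leq_eqVlt => /orP [/eqP e|h].
    by have := yg mk'; rewrite e in ng; rewrite (nth_inj dM nl (ng _)) -?e //; ord.
  by have := nth_mono' dM (ng mk') nl h; have := yg mk'; ord.
split=> //.
have [|l lk cl] := @ncard_sub _ _ dM k A [set y' | A y' /\ lt y' y] kA; first by move=> z [].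
suff <- : l = m by [].
apply/eqP; rewrite eqn_leq; apply/andP; split.
  case: (ltnP m k) => [mk'|km]; last by apply: leq_trans lk km.
  have [Ag cg] := ng mk'; apply: (ncard_le dM cg cl) => z [Az zy]; split=> //.
  by have := yg mk'; ord.
case: (posnP m) => [->//|m0]; have [Af cf] := nf m0.
have := ncard_add dM cf (b := f) => /(_ (fun h => lt_irr dM h.2)); rewrite prednK // => c.
apply: (ncard_le dM cl c) => z [[Az zf]|->]; have := fy m0; split=> //; ord.
Qed.

(** In each coordinate, a band does not fit into a graph. *)
Lemma subcell_type n s t (E C : set ('I_n -> M)) : tcell s E -> tcell t C ->
  (forall x, E x -> C x) -> s = t \/ count id s < count id t.
Proof.
elim: n s t E C => [|n IH] s t E C; first by move=> [-> _] [-> _] _; left.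
case: s => // b s; case: t => // c t cE cC EC.
have [e|lt_st] : s = t \/ count id s < count id t.
  apply: IH (tcell_proj om cE) (tcell_proj om cC) _.
  by move=> p [r /EC Cr]; exists r.
- subst s; case: b cE => cE; case: c cC => cC; [by left| |by right|by left].
  have [x Ex] := tcell_nonempty om cE; exfalso.
  have [r1 [r2 [r12 [E1 E2]]]] : exists r1 r2, lt r1 r2 /\ (E (snoc (init x) r1) /\ E (snoc (init x) r2)).
    have Ex' : E (snoc (init x) (final x)) by rewrite snocK.
    have := fibre_near om cE Ex' (@filterT _ _ (rnear_filter om E _)).
    move=> [c [d [cx xd h]]]; have [r1 [c1 r1x]] := lt_dense dM cx.
    by exists r1, (final x); split=> //; split; [case: (h r1 c1 _)|]; ord.
  have [C' [f [_ _ mC]]] := graphP cC.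
  have [_ e1] := (mC _ _).1 (EC _ E1); have [_ e2] := (mC _ _).1 (EC _ E2).
  by subst; ord.
right; case: b cE => cE; case: c cC => cC /=.
- by rewrite ltn_add2l.
- exfalso; have [x Ex] := tcell_nonempty om cE.
  have Ex' : E (snoc (init x) (final x)) by rewrite snocK.
  have := fibre_near om cE Ex' (@filterT _ _ (rnear_filter om E _)).
  move=> [c [d [cx xd h]]]; have [r1 [c1 r1x]] := lt_dense dM cx.
  have [|E1 _] := h r1 c1; first by ord.
  have [C' [f [_ _ mC]]] := graphP cC.
  have [_ e1] := (mC _ _).1 (EC _ E1); have [_ e2] := (mC _ _).1 (EC _ Ex').
  by subst; ord.
- by apply: leq_trans lt_st _; apply: leq_addl.
- by [].
Qed.

End Pieces.

Notation covers1 M := (cell_covers (J := unit) (M := fun _ => M) (fun _ c => c)).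
Notation steady1 M := (steady_covers (J := unit) (M := fun _ => M) (fun _ c => c)).

Section Steps.
Variables (L : language) (J : Type) (M : J -> structure L).
Variables (K : Type) (iota : forall j, K -> M j).
Hypothesis om : forall j, ominimal (M j).

(** The size of the fibres is constant on each [C j] by [steady_card_const]; this is
    the number of sheets of [D j] over [C j]. *)
Definition sheets_bounded := forall n t (C : setfam M n) (D : setfam M n.+1),
  ucell iota t C -> Def iota D -> (forall j x, fin (fibre (D j) x)) ->
  (forall j, steady_on (C j) (D j)) ->
  exists N, forall j x k, C j x -> ncard k (fibre (D j) x) -> k <= N.

Definition steady_refinement n (D : setfam M n.+1) (C : setfam M n) :=
  exists (r : finType) (t : r -> bitseq) (C' : r -> setfam M n),
    [/\ forall i, ucell iota (t i) (C' i), forall j x, C j x -> exists i, C' i j x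
      & forall i j, steady_on (C' i j) (D j)].

Lemma steady_refinement_glue n (D : setfam M n.+1) (C : setfam M n) (r : finType)
    (C0 : r -> setfam M n) :
  (forall i, steady_refinement D (C0 i)) -> (forall j x, C j x -> exists i, C0 i j x) ->
  steady_refinement D C.
Proof.
move=> ref cov.
have /choice [w hw] i : exists w : {r : finType & ((r -> bitseq) * (r -> setfam M n))%type},
    [/\ forall i, ucell iota ((projT2 w).1 i) ((projT2 w).2 i),
      forall j x, C0 i j x -> exists i, (projT2 w).2 i j x
      & forall i j, steady_on ((projT2 w).2 i j) (D j)].
  by have [r' [t [C' h]]] := ref i; exists (existT _ r' (t, C')).
exists {i : r & projT1 (w i)}, (fun u => (projT2 (w (tag u))).1 (tagged u)),
  (fun u => (projT2 (w (tag u))).2 (tagged u)); split=> [[i i']|j x Cx|[i i'] j] /=.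
- by case: (hw i).
- have [i C0x] := cov j x Cx; have [_ h _] := hw i; have [i' Cx'] := h j x C0x.
  by exists (Tagged (fun i => projT1 (w i)) i').
- by case: (hw i).
Qed.

(** A bound for each of the finitely many cells of a cover suffices. *)
Lemma uniform_finiteness n (D : setfam M n.+1) : sheets_bounded ->
  steady_covers iota n -> Def iota D -> (forall j x, fin (fibre (D j) x)) ->
  exists N, forall j x k, ncard k (fibre (D j) x) -> k <= N.
Proof.
move=> sb sc dD fD; have [r [t [C [[uC cov] st]]]] := sc D dD fD.
have /choice [N hN] i := sb n (t i) (C i) D (uC i) dD fD (st i).
exists (\max_i N i) => j x k ck; have [i Cx] := cov j x.
by apply: leq_trans (hN i j x k Cx ck) _; apply: leq_bigmax.
Qed.

Lemma Def_exists_fin n (T : finType) (P : T -> setfam M n) : (forall i, Def iota (P i)) ->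
  Def iota (fun j x => exists i, P i j x).
Proof.
move=> h; have := Def_not (@Def_forall_fin _ _ _ _ iota n T (fun i j x => ~ P i j x) (fun i => Def_not (h i))).
by apply: Def_eqv => j x; split=> [/existsNP [i /contrapT]|[i Pi] /(_ i)//]; exists i.
Qed.

Lemma piece_cell n t j (E : set ('I_n -> M j)) (D : set ('I_n.+1 -> M j)) k m e :
  tcell t E -> dset D -> (forall x, fin (fibre D x)) -> steady_on E D ->
  (forall x, E x -> ncard k (fibre D x)) ->
  let P := [set z : 'I_n.+1 -> M j | E (init z) /\ piece (fibre D (init z)) m e (final z)] in
  P = set0 \/ tcell (~~ e :: t) P.
Proof.
move=> cE dD fD st ck P; have dM := (om j).1.
have sh l : l < k -> exists f, cfun E f /\ forall x, E x -> nth_elt l (fibre D x) (f x).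
  by move=> lk; apply: sheet cE dD fD st ck lk.
case: e @P => P.
  case: (ltnP m k) => mk; last first.
    left; apply: set_ext => z; split=> // -[Ez /piece_true nz].
    by have := nth_lt dM (ck _ Ez) nz; rewrite ltnNge mk.
  right; have [f [cf nf]] := sh m mk; exists E, f; split=> //.
  apply: set_ext => z; split=> -[Ez]; last by move=> e; split=> //; rewrite e; apply/piece_true/nf.
  by move=> /piece_true nz; split=> //; apply: (nth_inj dM) nz (nf _ Ez).
case: (ltnP k m) => km.
  left; apply: set_ext => z; split=> // -[Ez [cz _]].
  have := ncard_le dM (ck _ Ez) cz; rewrite leqNgt km => h.
  by suff: false by []; apply: h => w [].
have [a0] : inhabited (M j) by case: dM.
have [f hf] : exists f, 0 < m -> cfun E f /\ forall x, E x -> nth_elt m.-1 (fibre D x) (f x).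
  case: (posnP m) => [->|m0]; first by exists (fun _ => a0).
  by have [|f hf] := sh m.-1; [rewrite prednK|exists f].
have [g hg] : exists g, m < k -> cfun E g /\ forall x, E x -> nth_elt m (fibre D x) (g x).
  case: (ltnP m k) => mk; last by exists (fun _ => a0).
  by have [g hg] := sh m mk; exists g.
right; exists E, (if 0 < m then Some f else None), (if m < k then Some g else None); split=> //.
- split; first by case: (0 < m) hf => [/(_ isT) []|].
  by case: (m < k) hg => [/(_ isT) []|].
- move=> f0 g0; case m0: (0 < m) => // -[<-]; case mk: (m < k) => // -[<-] x Ex.
  have [_ nf] := hf m0; have [_ ng] := hg mk.
  by apply: (nth_mono' dM (nf x Ex) (ng x Ex)); rewrite prednK.
apply: set_ext => z.
have key : E (init z) -> piece (fibre D (init z)) m false (final z) <->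
    (0 < m -> lt (f (init z)) (final z)) /\ (m < k -> lt (final z) (g (init z))).
  move=> Ez; apply: (piece_gapE (om j) _ (ck _ Ez) km).
    by move=> m0; apply: (hf m0).2.
  by move=> mk; apply: (hg mk).2.
split=> -[Ez].
  move=> /(key Ez) [h1 h2]; split=> //; split.
    by case: (0 < m) h1 => //=; apply.
  by case: (m < k) h2 => //=; apply.
move=> [h1 h2]; split=> //; apply/(key Ez); split=> h.
  by move: h1; rewrite h.
by move: h2; rewrite h.
Qed.

(** Between two boundary points of its fibre, a set is constant.  The cover of [M^n]
    is chosen compatible with the sets [V] of the points over which a given piece
    meets a given set, so that this constant does not change along a cell. *)
Lemma cell_covers_step n : sheets_bounded -> cell_covers iota n -> steady_covers iota n ->
  cell_covers iota n.+1.
Proof.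
move=> sb cc sc T X dX.
pose D : setfam M n.+1 := fun j z => exists l, boundary (fibre (X l j) (init z)) (final z).
have dXj l j : dset (X l j) := Def_slice j (dX l).
have dF l j x : dset1 (fibre (X l j) x).
  by have d := dXj l j; rewrite /fibre; def_tac.
have dD : Def iota D.
  apply: Def_exists_fin => l; have d := dX l; rewrite /boundary /fibre.
  by move: (X l) d => Y d; def_tac.
have eD j x : fibre (D j) x = [set y | exists l, boundary (fibre (X l j) x) y].
  by apply: set_ext => y; rewrite /fibre /D /mkset init_snoc final_snoc.
have fD j x : fin (fibre (D j) x).
  by rewrite eD; apply: (fin_union (om j)) => l; apply: fin_boundary (om j) _ (dF l j x).
have [N hN] := uniform_finiteness sb sc dD fD.
pose P (m : 'I_N.+1) (e : bool) : setfam M n.+1 :=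
  fun j z => piece (fibre (D j) (init z)) m e (final z).
have dP m e : Def iota (P m e).
  by rewrite /P /piece /fibre; case: e; def_tac.
pose V (w : T * ('I_N.+1 * bool)) : setfam M n :=
  fun j x => exists y, P w.2.1 w.2.2 j (snoc x y) /\ X w.1 j (snoc x y).
have dV w : Def iota (V w).
  have d1 := dP w.2.1 w.2.2; have d2 := dX w.1; rewrite /V.
  by move: (P _ _) (X _) d1 d2 => Y Z d1 d2; def_tac.
have [r [t [E [[uE cov] comp st]]]] := steady_compatible_covers om cc sc dD fD dV.
exists (r * ('I_N.+1 * bool))%type, (fun w => ~~ w.2.2 :: t w.1).
exists (fun w j z => E w.1 j (init z) /\ P w.2.1 w.2.2 j z); split; first split.
- move=> [i [m e]] /=; have [dE cE] := uE i; split.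
    have d1 := dP m e; move: (P m e) (E i) d1 dE => Y Z d1 d2; def_tac.
  move=> j; case: (cE j) => [->|cEj]; first by left; apply: set_ext => z; split=> // -[].
  have [k ck] := steady_card_const (om j) cEj (Def_slice j dD) (fD j) (st i j).
  exact: piece_cell cEj (Def_slice j dD) (fD j) (st i j) ck.
- move=> j z; have [i Ez] := cov j (init z); have [k ck] := fD j (init z).
  have [m [e [mk pz]]] := piece_ex (om j) (final z) ck.
  have mN : m < N.+1 by rewrite ltnS; apply: leq_trans mk (hN _ _ _ ck).
  by exists (i, (Ordinal mN, e)).
move=> [i [m e]] l j; have dM := (om j).1.
case: (comp i (l, (m, e)) j) => /= h; [left|right] => z [Ez Pz]; last first.
  by move=> Xz; apply: (h _ Ez); exists (final z); rewrite snocK.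
have [y [Py Xy]] := h _ Ez; rewrite /= in Xy.
rewrite -(snocK z) in Pz *; move: (init z) (final z) Pz Xy Py {Ez} => x y' Py' Xy Py.
rewrite /P /= !init_snoc !final_snoc in Py Py'.
case: e Py Py' {h} => [/piece_true ny /piece_true ny'|py py'].
  by rewrite -(nth_inj dM ny ny').
have nb z1 : piece (fibre (D j) x) m false z1 -> ~ boundary (fibre (X l j) x) z1.
  by move=> [_ n1] b1; apply: n1; rewrite eD; exists l.
case: (lt_total dM y y') => yy; [|by subst|].
  apply: (constant_between (om j) (b := true) (dF l j x) yy) Xy => /= z1 z1y y'z1.
  apply: nb; case: (lt_total dM y z1) => h1; [|by subst|by case: z1y].
  by case: (lt_total dM z1 y') => h2; [exact: piece_convex (om j) _ _ _ _ _ py py' h1 h2|by subst|by case: y'z1].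
apply: (constant_between (om j) (b := false) (dF l j x) yy) Xy => /= z1 z1y y'z1.
apply: nb; case: (lt_total dM y' z1) => h1; [|by subst|by case: y'z1].
by case: (lt_total dM z1 y) => h2; [exact: piece_convex (om j) _ _ _ _ _ py' py h1 h2|by subst|by case: z1y].
Qed.

Lemma compatible_inter T (A B : set T) : compatible A B ->
  A `&` B = A \/ A `&` B = set0.
Proof.
by case=> h; [left|right]; apply: set_ext => x; split=> [[Ax Bx]|Ax] //; [split=> //; exact: h|exact: h Ax Bx].
Qed.

(** A graph is homeomorphic to its base, to which [D] is transported. *)
Lemma steady_refinement_graph n t (C : setfam M n.+1) (D : setfam M n.+2) :
  cell_covers iota n -> steady_covers iota n -> ucell iota (false :: t) C -> Def iota D ->
  (forall j x, fin (fibre (D j) x)) -> steady_refinement D C.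
Proof.
move=> cc sc [dC cC] dD fD.
pose D' : setfam M n.+1 := fun j z =>
  exists r, C j (snoc (init z) r) /\ D j (snoc (snoc (init z) r) (final z)).
have dD' : Def iota D' by rewrite /D'; def_tac.
have eD' j x : C j x -> fibre (D' j) (init x) = fibre (D j) x.
  move=> Cx; have := cC j; case=> [e|/graphP [C' [f [_ _ mC]]]]; first by rewrite e in Cx.
  rewrite -(snocK x) in Cx *; have [_ ->] := (mC _ _).1 Cx; rewrite init_snoc.
  apply: set_ext => y; rewrite /fibre /D' /mkset init_snoc final_snoc.
  by split=> [[r [/mC [_ ->]]]|Dy] //; exists (f (init x)); split=> //; apply/mC; case/mC: Cx.
have fD' j x : fin (fibre (D' j) x).
  case: (pselect (exists r, C j (snoc x r))) => [[r Cr]|no].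
    by have := eD' j _ Cr; rewrite init_snoc => ->.
  exists 0 => y; rewrite /fibre /D' /mkset init_snoc => -[r [Cr _]].
  by apply: no; exists r.
have [|r [s [E [[uE cov] comp st]]]] := steady_compatible_covers om cc sc dD' fD'
    (X := fun _ : unit => fun j => proj (C j)) _.
  by move=> _; rewrite /proj; def_tac.
exists r, (fun i => false :: s i), (fun i j z => C j z /\ E i j (init z)); split=> [i|j x Cx|i j].
- have [dE cE] := uE i; split.
    by move: (E i) dE => Y dY; def_tac.
  move=> j; case: (cC j) => [->|cCj]; first by left; apply: set_ext => z; split=> // -[].
  case: (cE j) => [->|cEj]; first by left; apply: set_ext => z; split=> // -[].
  have [C' [f [cC' [df cf] mC]]] := graphP cCj.
  case: (comp i tt j) => h; [right|left]; last first.
    apply: set_ext => z; split=> // -[Cz Ez]; apply: (h _ Ez).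
    by exists (final z); rewrite snocK.
  have EC x : E i j x -> C' x by move=> /h [y /mC []].
  have eq : [set z | C j z /\ E i j (init z)] = [set z | E i j (init z) /\ final z = f (init z)].
    have mz z : C j z <-> C' (init z) /\ final z = f (init z).
      by have := mC (init z) (final z); rewrite snocK.
    apply: set_ext => z; split=> -[].
      by move=> /mz [_ e] Ez; split.
    by move=> Ez e; split=> //; apply/mz; split=> //; apply: EC.
  exists (E i j), f; split=> //; split.
    rewrite -eq; have d1 := Def_slice j dC; have d2 := Def_slice j dE.
    by move: (C j) (E i j) d1 d2 => Y Z d1 d2; def_tac.
  by move=> x Ex a d ax xd; apply: (rnearS (om j) EC); apply: cf => //; apply: EC.
- by have [i Ex] := cov j (init x); exists i.
move=> x [Cx Ex] l u i0 i2; rewrite -(eD' j x Cx) => fl fu c.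
have := st i j (init x) Ex l u i0 i2 fl fu c; rewrite /rnear => h.
have := @nearby_init _ _ (om j) _ x _ h.
apply: (@filterS _ _ (nearby_filter (om j) x)) => w hw [Cw Ew].
by rewrite /mkset -(eD' j w Cw); apply: hw.
Qed.

Lemma steady_refinement_self n (C : setfam M n) t (D : setfam M n.+1) :
  ucell iota t C -> (forall j, steady_on (C j) (D j)) -> steady_refinement D C.
Proof.
move=> uC st; exists unit, (fun _ => t), (fun _ => C).
by split=> // j x Cx; exists tt.
Qed.

(** By induction on the dimension of [C].  Over a band, in a cover compatible with the
    set [G] of the points where the fibres vary continuously, the cells of the type
    of [C] meet [G], hence are contained in it; the others have smaller
    dimension. *)
Lemma steady_refinement_cell n t (C : setfam M n.+1) (D : setfam M n.+2) :
  (forall j, covers1 (M j) n) ->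
  (forall j, covers1 (M j) n.+1) ->
  (forall j, steady1 (M j) n) ->
  cell_covers iota n -> steady_covers iota n -> cell_covers iota n.+1 ->
  ucell iota t C -> Def iota D -> (forall j x, fin (fibre (D j) x)) -> steady_refinement D C.
Proof.
move=> cc0 cc1 sc0 cc sc ccS uC dD fD.
have [d] := ubnP (count id t); elim: d t C uC => // d IH t C uC ltd.
case: t uC ltd => [|[] t] uC ltd; last exact: steady_refinement_graph uC dD fD.
  apply: (steady_refinement_self uC) => j x Cx; case: uC => _ /(_ j) [e|//].
  by rewrite e in Cx.
have [dC cC] := uC.
pose G : setfam M n.+1 := fun j z => C j z /\ steady (rnear (C j) z) (fibre (D j)) z.
have dG : Def iota G by rewrite /G /steady /rnear /nearby /fibre; def_tac.
have [|r [s [E [[uE cov] comp]]]] := ccS bool (fun b => if b then C else G); first by case.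
have comp1 i j := comp i true j; have comp2 i j := comp i false j.
pose F i : setfam M n.+1 := fun j => E i j `&` C j.
have uF i : ucell iota (s i) (F i).
  have [dE cE] := uE i; split.
    by rewrite /F; move: (E i) dE => Y dY; def_tac.
  by move=> j; rewrite /F; case: (compatible_inter (comp1 i j)) => ->; [apply: cE|left].
apply: (steady_refinement_glue (C0 := F)); last first.
  by move=> j x Cx; have [i Ex] := cov j x; exists i.
move=> i; have FC j x : F i j x -> C j x by case.
case: (pselect (s i = true :: t)) => es.
  apply: (steady_refinement_self (uF i)) => j x Fx.
  have cF : tcell (true :: t) (F i j).
    by rewrite -es; case: (uF i) => _ /(_ j) [e|//]; rewrite e in Fx.
  have cCj : tcell (true :: t) (C j).
    by case: (cC j) => // e; move: (FC _ _ Fx); rewrite e.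
  have [x0 [Fx0 st]] := band_steady_point (om j) (cc0 j) (cc1 j) (sc0 j) cF (Def_slice j dD) (fD j).
  have oF := subcell_ropen (om j) cCj cF (FC j).
  have Gx0 : G j x0.
    split; first exact: FC Fx0.
    apply: steadyS st => P hP; have := oF x0 Fx0; move: hP; rewrite /rnear.
    apply: (@filterS2 _ _ (nearby_filter (om j) x0)) => y h1 h2 Cy; apply: h1; exact: h2.
  have [_ st'] : G j x.
    by case: (comp2 i j) => h; [apply: h; case: Fx|case: (h x0) => //; case: Fx0].
  by apply: steadyS st' => P; apply: (rnearS (om j) (FC j)).
case: (pselect (exists j x, F i j x)) => [[j [x Fx]]|no]; last first.
  by apply: (steady_refinement_self (uF i)) => j x Fx; case: no; exists j, x.
apply: (IH (s i)); first exact: uF.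
have cF : tcell (s i) (F i j) by case: (uF i) => _ /(_ j) [e|//]; rewrite e in Fx.
have cCj : tcell (true :: t) (C j).
  by case: (cC j) => // e; move: (FC _ _ Fx); rewrite e.
case: (subcell_type (om j) cF cCj (FC j)) => // h.
by apply: leq_trans h _; rewrite -ltnS.
Qed.

End Steps.

Section Induction.
Variable L : language.

(** In a single structure the size of the fibres over a cell is itself the bound. *)
Lemma sheets_bounded_single (M : structure L) : ominimal M ->
  sheets_bounded (J := unit) (M := fun _ => M) (fun _ c => c).
Proof.
move=> om n t C D [dC cC] dD fD st.
case: (cC tt) => [e|cE]; first by exists 0 => -[] x k; rewrite e.
have [k ck] := steady_card_const om cE (Def_slice tt dD) (fD tt) (st tt).
by exists k => -[] x k' Cx ck'; rewrite (ncard_uniq om.1 (ck x Cx) ck').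
Qed.

Lemma steady_covers_step n (J : Type) (M : J -> structure L) (K : Type)
    (iota : forall j, K -> M j) : (forall j, ominimal (M j)) ->
  (forall j, covers1 (M j) n) ->
  (forall j, covers1 (M j) n.+1) ->
  (forall j, steady1 (M j) n) ->
  cell_covers iota n -> steady_covers iota n -> cell_covers iota n.+1 -> steady_covers iota n.+1.
Proof.
move=> om cc0 cc1 sc0 cc sc ccS D dD fD.
have [|r [t [C [[uC cov] _]]]] := ccS void (fun v => match v with end); first by case.
have ref i := steady_refinement_cell om cc0 cc1 sc0 cc sc ccS (uC i) dD fD.
have [|r' [t' [C' [u c s]]]] := @steady_refinement_glue _ _ _ _ iota _ D (fun _ => setT) r C ref.
  by move=> j x _; apply: cov.
by exists r', t', C'; split=> //; split=> // j x; apply: c.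
Qed.

(** Uniform cell decomposition.  The induction is on [n] for all families at once:
    the local arguments need covers for the single structures [M j] with all
    their elements as constants. *)
Theorem uniform_covers n (J : Type) (M : J -> structure L) (K : Type)
    (iota : forall j, K -> M j) : (forall j, ominimal (M j)) -> sheets_bounded iota ->
  cell_covers iota n /\ steady_covers iota n.
Proof.
elim: n J M K iota => [|n IH] J M K iota om sb.
  have pt j (x y : 'I_0 -> M j) : x = y by apply: funext => -[].
  have uT : ucell iota [::] (fun j => [set: 'I_0 -> M j]).
    by split=> [|j]; [apply: Def_const|right].
  split.
    move=> T X dX; exists unit, (fun _ => [::]), (fun _ j => setT); split.
      by split=> // j x; exists tt.
    move=> _ l j; case: (pselect (exists x, X l j x)) => [[x Xx]|no].
      by left=> y _; rewrite (pt j y x).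
    by right=> y _ Xy; apply: no; exists y.
  move=> D dD fD; exists unit, (fun _ => [::]), (fun _ j => setT); split.
    by split=> // j x; exists tt.
  move=> _ j x _ l u i i2 fl fu c; exists x, x; split=> [[]//|y _ _].
  by rewrite /mkset (pt j y x).
have [cc sc] := IH _ _ _ iota om sb.
have IH0 j := IH unit (fun _ => M j) (M j) (fun _ c => c) (fun _ => om j) (sheets_bounded_single (om j)).
have cc1 j := @cell_covers_step _ unit (fun _ => M j) (M j) (fun _ c => c) (fun _ => om j) n
  (sheets_bounded_single (om j)) (IH0 j).1 (IH0 j).2.
have ccS := cell_covers_step om sb cc sc.
split=> //.
exact: steady_covers_step om (fun j => (IH0 j).1) cc1 (fun j => (IH0 j).2) cc sc ccS.
Qed.

End Induction.

(** * The Euler characteristic does not depend on the decomposition *)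

Section Euler.
Import GRing.Theory Num.Theory.
Local Open Scope ring_scope.
Variables (L : language) (M : structure L).
Hypothesis om : ominimal M.
Let dM := om.1.

Definition ind T (A : set T) (x : T) : int := (`[< A x >] : nat)%:Z.

Lemma ind1 T (A : set T) x : A x -> ind A x = 1.
Proof. by rewrite /ind; case: asboolP. Qed.

Lemma ind0 T (A : set T) x : ~ A x -> ind A x = 0.
Proof. by rewrite /ind; case: asboolP. Qed.

Lemma ind_eq T T' (A : set T) (B : set T') x y : (A x <-> B y) -> ind A x = ind B y.
Proof. by move=> h; rewrite /ind; congr (nat_of_bool _)%:Z; apply/asboolP/asboolP; apply h. Qed.

Definition sample_sum (S : seq (M * int)) (A : set M) : int := \sum_(s <- S) s.2 * ind A s.1.

Definition endpoint (A : set M) (o : option M) := if o is Some y then A y else True.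

(** A signed sampling of the line that computes the Euler characteristic of the
    points of [A] and of the intervals with endpoints in [A]: the points count
    positively, and one point of each gap counts negatively. *)
Lemma samples k (A : set M) (o : option M) : ncard k A -> (forall y, A y -> above o y) ->
  exists S, [/\ forall P Q : set M, (forall x, above o x -> (P x <-> Q x)) -> sample_sum S P = sample_sum S Q,
    forall u, endpoint A u -> sample_sum S (Defs.interval o u) = -1,
    forall l u, A l -> endpoint A u -> below l u -> sample_sum S (Defs.interval (Some l) u) = -1
  & forall a, A a -> sample_sum S [set a] = 1].
Proof.
elim: k A o => [|k IH] A o.
  move=> nA _; have [m hm] : exists m, above o m.
    by case: o => [a|] /=; [apply: lt_above|case: dM => -[a] *; exists a].
  exists [:: (m, -1)]; split.
  - move=> P Q PQ; rewrite /sample_sum !big_seq1; congr (_ * _); apply: ind_eq; exact: PQ.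
  - by case=> [y /nA//|_]; rewrite /sample_sum big_seq1 ind1.
  - by move=> l u /nA.
  - by move=> a /nA.
move=> /ncardS [y [Ay my ck]] oA.
have [m [oam my']] : exists m, above o m /\ lt m y.
  have := oA y Ay; case: (o) => [a|] /= h; first exact: lt_dense.
  by have [m ?] := lt_below dM y; exists m.
have [|S [hS h1 h2 h3]] := IH _ (Some y) ck; first by move=> z [].
have zero (P : set M) : (forall x, lt y x -> ~ P x) -> sample_sum S P = 0.
  move=> nP; rewrite (hS P set0); first by rewrite /sample_sum big1 // => s _; rewrite ind0 ?mulr0.
  by move=> x /nP; split.
have rest z : A z -> z = y \/ lt y z.
  by move=> Az; case: (lt_total dM y z) => h; [right|left|case: (my z Az)].
exists [:: (m, -1), (y, 1) & S].
have E P : sample_sum [:: (m, -1), (y, 1) & S] P = ind P y - ind P m + sample_sum S P.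
  by rewrite /sample_sum !big_cons /= mul1r mulN1r addrA [- _ + _]addrC.
split=> [P Q PQ|u Au|l u Al Au lu|a Aa]; rewrite !E.
- rewrite (hS P Q); last by move=> x /= yx; apply: PQ; case: o oA oam => //= a oA oam; ord.
  rewrite (@ind_eq _ _ P Q y y); last by apply: PQ; apply: oA.
  by rewrite (@ind_eq _ _ P Q m m) //; apply: PQ.
- case: (pselect (u = Some y)) => [->|uy].
    rewrite ind0 ?ind1 ?zero ?addr0 ?sub0r //.
    + by move=> x yx [_ /=]; ord.
    + by move=> [_ /=]; apply: lt_irr.
  have yu : below y u by case: u Au uy => //= z /rest [->|].
  rewrite ind1 ?ind1 ?subrr ?add0r; last 2 first.
  + by split=> //; case: (u) yu => //= z; ord.
  + by split=> //; apply: oA.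
  rewrite -(h1 u); first by apply: hS => x /= yx; split=> -[? ?]; split=> //; case: o oA oam => //= a oA oam; ord.
  by case: u Au uy yu => //= z Az _ yz; split.
- have [->|yl] := rest l Al.
    rewrite ind0 ?ind0 ?subrr ?add0r; last 2 first.
    + by move=> [/=]; ord.
    + by move=> [/=]; ord.
    apply: h1; case: u Au lu => //= z Az; case: (rest z Az) => [->|]; last by split.
    by have [?|?] := rest l Al; [subst|]; ord.
  rewrite ind0 ?ind0 ?subrr ?add0r; last 2 first.
  + by move=> [/=]; ord.
  + by move=> [/=]; ord.
  apply: h2 => //; case: u Au lu => //= z Az lz; split=> //; ord.
have [->|ya] := rest a Aa.
  rewrite ind1 // ind0 ?zero ?subr0 ?addr0 //.
  + by move=> x yx /= e; subst; ord.
  + by move=> /= e; subst; ord.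
rewrite ind0 ?ind0 ?subrr ?add0r; last 2 first.
+ by move=> /= e; subst; ord.
+ by move=> /= e; subst; ord.
by apply: h3.
Qed.

Definition proper_interval (B : set M) := exists l u, B = Defs.interval l u /\
  forall a b, l = Some a -> u = Some b -> lt a b.

(** One sampling of the line, at the endpoints of all the [B i] and between them,
    computes all their Euler characteristics, and the relation between the
    indicators holds at each sample. *)
Lemma line_relation (T : finType) (c : T -> int) (e : T -> bool) (B : T -> set M) :
  (forall i, if e i then proper_interval (B i) else exists a, B i = [set a]) ->
  (forall x, \sum_i c i * ind (B i) x = 0) -> \sum_i c i * (-1) ^+ e i = 0.
Proof.
move=> hB h0.
have [a0] : inhabited M by case: dM.
have /choice [w hw] i : exists w : option M * option M, if e i
    then B i = Defs.interval w.1 w.2 /\ forall a b, w.1 = Some a -> w.2 = Some b -> lt a b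
    else exists2 a, w.1 = Some a & B i = [set a].
  have := hB i; case: (e i) => [[l [u ?]]|[a ?]]; first by exists (l, u).
  by exists (Some a, None), a.
pose A y := exists i, (w i).1 = Some y \/ (w i).2 = Some y.
have fA : fin A.
  pose p (v : T * bool) := if (if v.2 then (w v.1).1 else (w v.1).2) is Some y then y else a0.
  apply: (fin_sub dM) (fin_codom dM p) _ => y [i [h|h]].
    by exists (i, true); rewrite /p /= h.
  by exists (i, false); rewrite /p /= h.
have [k ck] := fA.
have [S [_ h1 h2 h3]] := samples (o := None) ck (fun _ _ => I).
have val i : sample_sum S (B i) = (-1) ^+ e i.
  have Al : endpoint A (w i).1 by case E: (w i).1 => [y|] //; exists i; left.
  have Au : endpoint A (w i).2 by case E: (w i).2 => [y|] //; exists i; right.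
  have := hw i; case: (e i) => [[-> lu]|[a ea ->]]; last by rewrite expr0 h3 //; rewrite ea in Al.
  rewrite expr1; case E: (w i).1 Al lu => [l|] Al lu; last exact: h1.
  by apply: h2 => //; case: (w i).2 lu => //= u lu; apply: lu.
rewrite (eq_bigr (fun i => \sum_(s <- S) s.2 * (c i * ind (B i) s.1))); last first.
  by move=> i _; rewrite -val mulr_sumr; apply: eq_bigr => s _; rewrite mulrCA.
rewrite exchange_big big1 // => s _.
by rewrite -mulr_sumr h0 mulr0.
Qed.

(** The Euler characteristic of a cell depends only on the shape of its fibres; the
    continuity and the definability of the bounds are forgotten. *)
Fixpoint wcell n (t : bitseq) : set ('I_n -> M) -> Prop :=
  match n with
  | 0 => fun C => t = [::] /\ C = setT
  | n'.+1 => fun C => if t is b :: t' then exists C', [/\ wcell t' C',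
      forall p r, C (snoc p r) -> C' p
    & forall p, C' p -> if b then proper_interval (fibre C p) else exists a, fibre C p = [set a]]
    else False
  end.

Lemma cell_wcell n d (C : set ('I_n -> M)) : cell d C -> exists2 t, wcell t C & count id t = d.
Proof.
elim=> {n d C}; first by exists [::].
  move=> n d C f _ [t wC <-] _; exists (false :: t) => //=; exists C; split=> //.
    by move=> p r; rewrite /mkset init_snoc => -[].
  move=> p Cp; exists (f p); apply: set_ext => r; rewrite /fibre /mkset init_snoc final_snoc.
  by split=> [[]|].
move=> n d C f g _ [t wC <-] _ _ fg; exists (true :: t) => //=; exists C; split=> //.
  by move=> p r; rewrite /mkset init_snoc => -[].
move=> p Cp; exists (value f p), (value g p); split.
  apply: set_ext => r; rewrite /fibre /mkset init_snoc final_snoc.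
  by split=> [[]|].
by case: f fg => // f; case: g => // g fg a b [<-] [<-]; apply: fg Cp.
Qed.

(** Integration with respect to the Euler characteristic, one variable at a
    time: a linear relation between the indicators of cells is inherited by
    their Euler characteristics. *)
Lemma euler_relation n (T : finType) (c : T -> int) (t : T -> bitseq) (C : T -> set ('I_n -> M)) :
  (forall i, wcell (t i) (C i)) -> (forall x, \sum_i c i * ind (C i) x = 0) ->
  \sum_i c i * (-1) ^+ count id (t i) = 0.
Proof.
elim: n T c t C => [|n IH] T c t C hC h0.
  have [a0] : inhabited M by case: dM.
  rewrite -[RHS](h0 (fun _ => a0)); apply: eq_bigr => i _.
  by have [-> ->] := hC i; rewrite ind1.
have /choice [w hw] i : exists w : bool * bitseq * set ('I_n -> M), [/\ t i = w.1.1 :: w.1.2,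
    wcell w.1.2 w.2, forall p r, C i (snoc p r) -> w.2 p
  & forall p, w.2 p -> if w.1.1 then proper_interval (fibre (C i) p) else exists a, fibre (C i) p = [set a]].
  have := hC i; case: (t i) => //= b s [C' [? ? ?]].
  by exists (b, s, C').
have := IH T (fun i => c i * (-1) ^+ (w i).1.1) (fun i => (w i).1.2) (fun i => (w i).2).
have -> : \sum_i c i * (-1) ^+ (w i).1.1 * (-1) ^+ count id (w i).1.2
   = \sum_i c i * (-1) ^+ count id (t i).
  by apply: eq_bigr => i _; have [-> _ _ _] := hw i; rewrite /= exprD mulrA.
apply; first by move=> i; case: (hw i).
have [a0] : inhabited M by case: dM.
move=> p.
pose B i : set M := if `[< (w i).2 p >] then fibre (C i) p
  else if (w i).1.1 then setT else [set a0].
rewrite -[RHS](@line_relation T (fun i => c i * ind (w i).2 p) (fun i => (w i).1.1) B).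
- by apply: eq_bigr => i _; rewrite -!mulrA [_ * ind _ _]mulrC.
- move=> i; rewrite /B; case: asboolP => [wp|_]; first by have [_ _ _ h] := hw i; apply: h.
  case: (w i).1.1; last by exists a0.
  by exists None, None; split=> //; apply: set_ext => y; split.
- move=> x; rewrite -[RHS](h0 (snoc p x)); apply: eq_bigr => i _.
  rewrite -mulrA; congr (_ * _); rewrite /B; case: asboolP => wp.
    by rewrite ind1 // mul1r.
  rewrite ind0 // mul0r ind0 //; by have [_ _ h _] := hw i; move=> /h.
Qed.

Lemma decomposition_sum n (X : set ('I_n -> M)) k d (C : 'I_k -> set ('I_n -> M)) x :
  cell_decomposition X d C -> \sum_j ind (C j) x = ind X x.
Proof.
move=> [_ tC ->]; case: (pselect (exists j, C j x)) => [[j Cj]|no]; last first.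
  rewrite ind0; last by move=> [j _ Cj]; apply: no; exists j.
  by rewrite big1 // => j _; rewrite ind0 // => Cj; apply: no; exists j.
rewrite (bigD1 j) //= ind1 // big1 => [|i ij]; last first.
  rewrite ind0 // => Ci; move/eqP: ij; apply.
  by apply: tC => //; exists x.
by rewrite addr0 ind1 //; exists j.
Qed.

Lemma euler_unique n (X : set ('I_n -> M)) k d (C : 'I_k -> set ('I_n -> M))
    k' d' (C' : 'I_k' -> set ('I_n -> M)) :
  cell_decomposition X d C -> cell_decomposition X d' C' ->
  \sum_j (-1) ^+ d j = \sum_j (-1) ^+ d' j :> int.
Proof.
move=> dC dC'.
have /choice [t ht] j : exists t, wcell t (C j) /\ count id t = d j.
  by case: dC => h _ _; have [t ? ?] := cell_wcell (h j); exists t.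
have /choice [t' ht'] j : exists t, wcell t (C' j) /\ count id t = d' j.
  by case: dC' => h _ _; have [t'' ? ?] := cell_wcell (h j); exists t''.
have := @euler_relation n ('I_k + 'I_k')%type (fun i => if i is inl _ then 1 else -1)
  (fun i => match i with inl j => t j | inr j => t' j end)
  (fun i => match i with inl j => C j | inr j => C' j end).
rewrite !big_sumType /=.
have -> : \sum_i 1 * (-1) ^+ count id (t i) = \sum_j (-1) ^+ d j :> int.
  by apply: eq_bigr => j _; rewrite mul1r (ht j).2.
have -> : \sum_i -1 * (-1) ^+ count id (t' i) = - \sum_j (-1) ^+ d' j :> int.
  by rewrite -sumrN; apply: eq_bigr => j _; rewrite mulN1r (ht' j).2.
move=> h; apply/eqP; rewrite -subr_eq0; apply/eqP; apply: h.
  by case=> j; [case: (ht j)|case: (ht' j)].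
move=> x; rewrite big_sumType /=.
under eq_bigr do rewrite mul1r.
under [X in _ + X]eq_bigr do rewrite mulN1r.
by rewrite sumrN (decomposition_sum x dC) (decomposition_sum x dC') subrr.
Qed.

Lemma euler_decomposition n (X : set ('I_n -> M)) k d (C : 'I_k -> set ('I_n -> M)) :
  cell_decomposition X d C -> euler X = \sum_j (-1) ^+ d j.
Proof.
move=> dC; rewrite /euler; apply: xget_unique; first by exists k, d, C.
by move=> z [k' [d' [C' [dC' ->]]]]; apply: euler_unique dC' dC.
Qed.

End Euler.

(** * Bounded Euler characteristics bound the number of sheets *)

Section BoundedEuler.
Import GRing.Theory Num.Theory.
Variables (L : language) (J : Type) (M : J -> structure L).
Hypothesis om : forall j, ominimal (M j).

(** Uniform definability without parameters. *)
Definition no_constants j (v : void) : M j := match v with end.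

Lemma Def_formula n (X : setfam M n) : Def no_constants X ->
  exists phi : formula L n, forall j, X j = solutions (M := M j) phi.
Proof.
move=> [m [phi [s h]]].
exists (frename phi (fun k => match s k with inl i => i | inr v => match v with end end)) => j.
apply: set_ext => x; rewrite h /solutions /mkset holds_rename /assign.
suff -> : (fun k => match s k with inl i => x i | inr c => no_constants j c end) =
  (fun i => x match s i with inl i0 => i0 | inr v => match v with end end) by [].
by apply: funext => k; case: (s k).
Qed.

(** The fibres over [C] are cut into [k] graphs by the ranks of their points. *)
Lemma euler_sheets n t j (C : set ('I_n -> M j)) (D : set ('I_n.+1 -> M j)) k :
  tcell t C -> dset D -> (forall x, fin (fibre D x)) -> steady_on C D ->
  (forall x, C x -> ncard k (fibre D x)) ->
  euler [set z : 'I_n.+1 -> M j | C (init z) /\ D z] = ((-1) ^+ count id t *+ k)%R.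
Proof.
move=> cC dD fD st ck; have dM := (om j).1.
have /choice [f hf] (l : 'I_k) : exists f, cfun C f /\ forall x, C x -> nth_elt l (fibre D x) (f x).
  exact: (sheet (om j) cC dD fD st ck (ltn_ord l)).
rewrite (@euler_decomposition _ _ (om j) _ _ k (fun _ => count id t)
  (fun l => [set z | C (init z) /\ final z = f l (init z)])).
  by rewrite sumr_const card_ord.
split.
- move=> l; apply: cell_graph; first exact: (tcell_cell (om j) cC).
  by apply: (cfun_cell_fun (om j)); case: (hf l).
- move=> l l' _ _ [z [[Cz e] [_ e']]]; apply: val_inj.
  have [_ /(_ _ Cz) n1] := hf l; have [_ /(_ _ Cz) n2] := hf l'.
  by rewrite -e in n1; rewrite -e' in n2; exact: (ncard_uniq dM n1.2 n2.2).
- apply: set_ext => z; have fz : fibre D (init z) (final z) <-> D z.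
    by rewrite /fibre /mkset snocK.
  split=> [[Cz /fz Dz]|[l _ [Cz e]]].
    have [l lk nl] := nth_all dM (ck _ Cz) Dz; exists (Ordinal lk) => //; split=> //.
    by have [_ /(_ _ Cz) n1] := hf (Ordinal lk); exact: (nth_inj dM nl n1).
  split=> //; apply/fz; rewrite e.
  by have [_ /(_ _ Cz) []] := hf l.
Qed.

Lemma sheets_bounded_of_euler : (forall (n : nat) (phi : formula L n), exists N : nat,
    forall j : J, (`|euler (solutions (M := M j) phi)| <= N%:Z)%R) ->
  sheets_bounded no_constants.
Proof.
move=> bd n t C D [dC cC] dD fD st.
have dX : Def no_constants (fun j (z : 'I_n.+1 -> M j) => C j (init z) /\ D j z).
  by def_tac.
have [phi hphi] := Def_formula dX; have [N hN] := bd _ phi.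
exists N => j x k Cx ck.
have cCj : tcell t (C j) by case: (cC j) => // e; rewrite e in Cx.
have dDj := Def_slice j dD.
have [k' ck'] := steady_card_const (om j) cCj dDj (fD j) (st j).
rewrite (ncard_uniq (om j).1 ck (ck' x Cx)).
have := hN j; rewrite -(hphi j) (euler_sheets cCj dDj (fD j) (st j) ck').
by rewrite normrMn normrX normrN1 expr1n natz lez_nat.
Qed.

End BoundedEuler.

(** * Ultraproducts *)

Section Los.
Variables (L : language) (I : Type) (U : set_system I) (FU : UltraFilter U).
Variable M : I -> structure L.
Hypothesis ne : forall i, inhabited (M i).
Notation P := (ultraproduct FU M).

Definition rep (a : P) i : M i := (repr (a : ultraproduct_type FU M) : forall i, M i) i.

Definition cls (g : forall i, M i) : P := (\pi_(ultraproduct_type FU M) (g : {classic forall i, M i}))%qT.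

Lemma clsK (a : P) : cls (rep a) = a.
Proof. exact: reprK. Qed.

Lemma cls_eq g h : cls g = cls h <-> U [set i | g i = h i].
Proof.
split=> [/eqmodP/asboolP //|h1].
by apply/eqmodP/asboolP.
Qed.

Lemma rep_cls g : U [set i | rep (cls g) i = g i].
Proof. by apply/cls_eq; rewrite clsK. Qed.

Lemma rep_eq (a b : P) : a = b <-> U [set i | rep a i = rep b i].
Proof. by rewrite -{1}(clsK a) -{1}(clsK b); apply: cls_eq. Qed.

Let PF : ProperFilter U := @ultra_proper _ _ FU.

Lemma U_forall_fin (T : finType) (Q : T -> set I) : (forall k, U (Q k)) ->
  U [set i | forall k, Q k i].
Proof.
move=> h; suff g (s : seq T) : U [set i | forall k, k \in s -> Q k i].
  by apply: filterS (g (enum T)) => i hi k; apply: hi; rewrite mem_enum.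
elim: s => [|k s IH]; first by apply: filterS filterT => i _ k.
apply: filterS2 (h k) IH => i Qk Qs k'; rewrite inE => /orP [/eqP ->//|]; exact: Qs.
Qed.

Lemma U_congr (Q R : set I) : U [set i | Q i <-> R i] -> U Q <-> U R.
Proof. by move=> h; split; apply: filterS2 h => i [? ?] ?; auto. Qed.

Lemma teval_ultra n (t : term L n) (x : 'I_n -> P) :
  U [set i | rep (teval t x) i = teval t (fun k => rep (x k) i)].
Proof.
elim: t => [k|f ts IH] /=; first by apply: filterS filterT.
pose g i := fint (fun k => rep (teval (ts k) x) i).
apply: filterS2 (rep_cls g) (U_forall_fin IH) => i /= e h.
by rewrite [LHS]e /g; congr fint; apply: funext => k; apply: h.
Qed.

(** The theorem of Los; a counterexample to a universal formula in the ultraproduct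
    is assembled from counterexamples in the factors. *)
Theorem holds_ultra n (phi : formula L n) (x : 'I_n -> P) :
  holds phi x <-> U [set i | holds phi (fun k => rep (x k) i)].
Proof.
elim: phi x => {n} /= [n|n t u|n r ts|n p IHp q IHq|n p IH] x.
- split=> // h; have := filter_not_empty U; apply.
  by move: h; congr U; apply: set_ext.
- apply: (iff_trans (rep_eq _ _)); apply: U_congr.
  by apply: filterS2 (teval_ultra t x) (teval_ultra u x) => i /= -> ->.
- apply: U_congr; apply: filterS (U_forall_fin (fun k => teval_ultra (ts k) x)) => i /= h.
  have e : (fun k => rep (@teval L P n (ts k) x) i) =
      (fun k => teval (ts k) (fun k0 => rep (x k0) i)) by apply: funext => k; apply: h.
  by rewrite -e; apply: iff_refl.
- split=> [h|h /IHp hp]; last by apply/IHq; apply: filterS2 h hp => i; apply.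
  have [hp|hp] := in_ultra_setVsetC [set i | holds p (fun k => rep (x k) i)] FU.
    by have /IHq := h ((IHp x).2 hp); apply: filterS => i ? _.
  by apply: filterS hp => i n1 /n1.
have eS a i : (fun k => rep (snoc x a k) i) = snoc (fun k => rep (x k) i) (rep a i).
  exact: (snoc_comp (fun b => rep b i)).
split=> [h|h a]; last by apply/IH; apply: filterS h => i /(_ (rep a i)); rewrite /mkset eS.
have [//|hn] := in_ultra_setVsetC [set i | forall a, holds p (snoc (fun k => rep (x k) i) a)] FU.
exfalso.
have ex i : exists a : M i, (~ forall a, holds p (snoc (fun k => rep (x k) i) a)) ->
    ~ holds p (snoc (fun k => rep (x k) i) a).
  case: (pselect (forall a, holds p (snoc (fun k => rep (x k) i) a))) => [h1|/existsNP [a na]].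
    by case: (ne i) => a; exists a => /(_ h1).
  by exists a.
pose g i := projT1 (cid (ex i)).
have hg i := projT2 (cid (ex i)).
have := (IH (snoc x (cls g))).1 (h (cls g)) => hp.
have := filter_not_empty U; apply.
apply: filterS3 hp hn (rep_cls g) => i /= h1 h2 h3.
by apply: (hg i h2); rewrite -/(g i) -h3 -eS.
Qed.

Lemma lt_ultra (a b : P) : lt a b <-> U [set i | lt (rep a i) (rep b i)].
Proof.
rewrite {1}/lt /=; apply: U_congr; apply: filterS filterT => i _ /=.
rewrite /lt; suff -> : (fun k : 'I_(rarity (less L)) =>
   (repr ((if val k == 0 then a else b) : ultraproduct_type FU M) : forall i, M i) i) =
   (fun k => if val k == 0 then rep a i else rep b i) by [].
by apply: funext => k; case: ifP.
Qed.

Lemma ultraproduct_dlo : (forall i, dlo_without_endpoints (M i)) -> dlo_without_endpoints P.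
Proof.
move=> dM; have nU Q : U Q -> (forall i, ~ Q i) -> False.
  move=> hQ nQ; have := filter_not_empty U; apply; move: hQ; congr U.
  by apply: set_ext => i; split=> // /nQ.
split.
- by exists; apply: cls => i; case: (cid (let: inhabits a := ne i in ex_intro xpredT a isT)).
- split=> [a /lt_ultra h|a b c /lt_ultra h1 /lt_ultra h2].
    by apply: nU h _ => i; apply: (lt_irr (dM i)).
  by apply/lt_ultra; apply: filterS2 h1 h2 => i; apply: (lt_trans (dM i)).
- move=> a b.
  have [h|h] := in_ultra_setVsetC [set i | lt (rep a i) (rep b i)] FU; first by apply: Or31; apply/lt_ultra.
  have [h'|h'] := in_ultra_setVsetC [set i | rep a i = rep b i] FU; first by apply: Or32; apply/rep_eq.
  apply: Or33; apply/lt_ultra; apply: filterS2 h h' => i n1 n2.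
  by case: (lt_total (dM i) (rep a i) (rep b i)).
- move=> a b /lt_ultra h.
  have ex i : exists c, lt (rep a i) (rep b i) -> lt (rep a i) c /\ lt c (rep b i).
    case: (pselect (lt (rep a i) (rep b i))) => [/(lt_dense (dM i)) [c ?]|?]; first by exists c.
    by case: (ne i) => c; exists c.
  exists (cls (fun i => projT1 (cid (ex i)))).
  split; apply/lt_ultra; apply: filterS2 h (rep_cls (fun i => projT1 (cid (ex i)))) => i /= ab ->;
    by case: (projT2 (cid (ex i)) ab).
- move=> a; have ex i : exists c, lt c (rep a i) := lt_below (dM i) (rep a i).
  have ex' i : exists c, lt (rep a i) c := lt_above (dM i) (rep a i).
  split; [exists (cls (fun i => projT1 (cid (ex i))))|exists (cls (fun i => projT1 (cid (ex' i))))];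
    apply/lt_ultra.
    by apply: filterS (rep_cls (fun i => projT1 (cid (ex i)))) => i /= ->; case: (cid (ex i)).
  by apply: filterS (rep_cls (fun i => projT1 (cid (ex' i)))) => i /= ->; case: (cid (ex' i)).
Qed.

End Los.

(** * O-minimality of the ultraproduct *)

(** All the intervals between two of the points [p i] or infinity are candidates;
    those not contained in [A] are replaced by an empty interval. *)
Lemma tame_finite_union L (M : structure L) (A : set M) : dlo_without_endpoints M -> tame A ->
  exists k (B : 'I_k -> set M),
    (forall j, (exists a, B j = [set a]) \/ (exists l u, B j = Defs.interval l u)) /\
    A = \bigcup_j B j.
Proof.
move=> dM [T [p h]]; have [a0] : inhabited M by case: dM.
pose empty := Defs.interval (Some a0) (Some a0).
have emptyP x : ~ empty x by move=> [/= ? ?]; ord.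
pose itv (lu : option T * option T) := Defs.interval (omap p lu.1) (omap p lu.2).
pose B (w : T + option T * option T) : set M := match w with
  | inl i => if `[< A (p i) >] then [set p i] else empty
  | inr lu => if `[< forall x, itv lu x -> A x >] then itv lu else empty end.
exists #|{: T + option T * option T}|, (fun j => B (enum_val j)); split.
  move=> j; case: (enum_val j) => [i|lu] /=; case: asboolP => _; [left|right|right|right].
  - by exists (p i).
  - by exists (Some a0), (Some a0).
  - by exists (omap p lu.1), (omap p lu.2).
  - by exists (Some a0), (Some a0).
have fp := fin_codom dM p.
apply: set_ext => x; split=> [Ax|[j _]]; last first.
  case: (enum_val j) => [i|lu] /=; case: asboolP => hA Bx; try by case: (emptyP _ Bx).
    by rewrite Bx.
  exact: hA.
suff [w Bw] : exists w, B w x by exists (enum_rank w) => //; rewrite enum_rankK.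
case: (pselect (exists i, x = p i)) => [[i e]|no].
  by exists (inl i); rewrite /B -e; case: asboolP.
have [l [lx hl]] : exists l, above (omap p l) x /\ forall i, lt (p i) x -> ~ lt x (p i) /\
    (if l is Some i' then ~ lt (p i') (p i) else False).
  case: (pselect (exists i, lt (p i) x)) => [[i ix]|n1]; last first.
    by exists None; split=> // i ix; case: n1; exists i.
  have [||z [[[i' ->] i'x] mz]] := @fin_max _ _ dM [set y | (exists i, y = p i) /\ lt y x] (p i).
  - by apply: (fin_sub dM) fp _ => y [].
  - by split=> //; exists i.
  exists (Some i'); split=> // i1 h1; split; first by ord.
  by apply: mz; split=> //; exists i1.
have [u [xu hu]] : exists u, below x (omap p u) /\ forall i, lt x (p i) ->
    (if u is Some i' then ~ lt (p i) (p i') else False).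
  case: (pselect (exists i, lt x (p i))) => [[i ix]|n1]; last first.
    by exists None; split=> // i ix; case: n1; exists i.
  have [||z [[[i' ->] i'x] mz]] := @fin_min _ _ [set y | (exists i, y = p i) /\ lt x y] (p i).
  - by apply: (fin_sub dM) fp _ => y [].
  - by split=> //; exists i.
  exists (Some i'); split=> // i1 h1.
  by apply: mz; split=> //; exists i1.
exists (inr (l, u)); rewrite /B; case: asboolP => [_|n1]; first by split.
exfalso; apply: n1 => y [/= ly yu].
have side i : lt (p i) x \/ lt x (p i).
  by case: (lt_total dM (p i) x) => h1; [left|case: no; exists i|right].
case: (lt_total dM x y) => xy; [|by subst|].
  apply/(h x y xy) => // i; case: (side i) => hi; [by left|right].
  by have := hu i hi; case: (u) yu => //= i' yu n1; ord.
apply/(h y x xy) => // i; case: (side i) => hi; [left|by right].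
by have [_] := hl i hi; case: (l) ly => //= i' ly n1; ord.
Qed.

Theorem theorem12p19 (L : language) (I : Type) (M : I -> structure L)
    (U : set_system I) (FU : UltraFilter U)
    (U_nonprincipal : forall i : I, U <> principal_filter i)
    (M_ominimal : forall i : I, ominimal (M i))
    (euler_bounded : forall (n : nat) (phi : formula L n),
       exists N : nat, forall i : I,
         (`|euler (solutions (M := M i) phi)| <= N%:Z)%R) :
  ominimal (ultraproduct FU M).
Proof.
have ne i : inhabited (M i) by case: (M_ominimal i) => -[].
have dP : dlo_without_endpoints (ultraproduct FU M).
  by apply: ultraproduct_dlo => // i; case: (M_ominimal i).
split=> // A [m [phi [b eA]]]; apply: tame_finite_union => //.
pose Y : setfam M m.+1 := fun i z => holds phi (fcat (fun _ : 'I_1 => final z) (init z)).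
have dY : Def (no_constants M) Y.
  exists (1 + m), phi, (fun k => inl (match split k with inl _ => ord_max | inr i => lift ord_max i end)).
  move=> i z; congr holds; apply: funext => k.
  by rewrite /fcat /assign /final /init; case: (split k).
have fY i z : fibre (Y i) z = [set a | holds phi (fcat (fun _ : 'I_1 => a) z)].
  by apply: set_ext => a; rewrite /fibre /Y /mkset init_snoc final_snoc.
pose D : setfam M m.+1 := fun i z => boundary (fibre (Y i) (init z)) (final z).
have dD : Def (no_constants M) D by rewrite /D /boundary /fibre; def_tac.
have eD i z : fibre (D i) z = boundary (fibre (Y i) z).
  by apply: set_ext => a; rewrite /fibre /D /mkset init_snoc final_snoc.
have d1 i z : dset1 (fibre (Y i) z).
  by have d := Def_slice i dY; rewrite /fibre; def_tac.
have fD i z : fin (fibre (D i) z) by rewrite eD; apply: fin_boundary.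
have sb := sheets_bounded_of_euler M_ominimal euler_bounded.
have [_ sc] := uniform_covers m M_ominimal sb.
have [N hN] := uniform_finiteness sb sc dD fD.
pose c i : 'I_m -> M i := fun k => rep (b k) i.
have ex i : exists p : 'I_N -> M i, forall a, boundary (fibre (Y i) (c i)) a -> exists l, a = p l.
  have [k ck] := fD i (c i); have kN := hN _ _ _ ck; case: (ne i) => a0.
  have /choice [p hp] (l : 'I_N) : exists a, l < k -> nth_elt l (fibre (D i) (c i)) a.
    case: (ltnP l k) => lk; last by exists a0.
    by have [a na] := nth_ex ck lk; exists a.
  exists p => a; rewrite -eD => Da; have [l lk nl] := nth_all (M_ominimal i).1 ck Da.
  exists (Ordinal (leq_trans lk kN)); apply: (nth_inj (M_ominimal i).1) nl _; exact: hp.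
pose p i := projT1 (cid (ex i)); have hp i := projT2 (cid (ex i)).
have memA x : A x <-> U [set i | fibre (Y i) (c i) (rep x i)].
  have -> : A x = holds phi (fcat (fun _ : 'I_1 => x) b).
    by have := congr1 (fun S => S (fun _ => x)) eA.
  apply: iff_trans (holds_ultra ne _ _) _; apply: U_congr; apply: filterS filterT => i _ /=.
  rewrite fY; suff -> : (fun k => rep (fcat (fun _ : 'I_1 => x) b k) i) =
    fcat (fun _ : 'I_1 => rep x i) (c i) by [].
  by apply: funext => k; rewrite /fcat; case: (split k).
exists 'I_N, (fun l => cls FU (fun i => p i l)) => x y /lt_ultra xy sep.
have sep' := U_forall_fin FU (Q := fun l : 'I_N => [set i | lt (p i l) (rep x i) \/ lt (rep y i) (p i l)]).
have {sep'} : U [set i | forall l, lt (p i l) (rep x i) \/ lt (rep y i) (p i l)].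
  apply: sep' => l; have hr := rep_cls FU (fun i => p i l).
  by case: (sep l) => /lt_ultra h; apply: filterS2 hr h => i /= <- ?; [left|right].
move=> sep'; apply: iff_trans (memA x) (iff_trans _ (iff_sym (memA y))).
apply: U_congr; apply: filterS2 xy sep' => i /= xy sep'; have dM := (M_ominimal i).1.
have nb z : ~ lt z (rep x i) -> ~ lt (rep y i) z -> ~ boundary (fibre (Y i) (c i)) z.
  by move=> zx yz /(hp i) [l e]; have := sep' l; rewrite /p -e => -[|].
split.
  by apply: (constant_between (M_ominimal i) (b := true) (d1 i (c i)) xy) => z; apply: nb.
apply: (constant_between (M_ominimal i) (b := false) (d1 i (c i)) xy) => z /= zy xz.
by apply: nb.
Qed.
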